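(* For every $\omega\cdot n^{3/2}<m\le m^*$, with probability at least $1-n^{-2\log n}$ either the event $\mathcal X(m-1)\cap\mathcal Y(m-1)$ fails, or $$\text{(a)}\ \frac{Q(m)}{\tilde Q(m)}\in1\pm g_q(t),\qquad\text{(b)}\ \frac{\overline X(m)}{\tilde X(m)}\in1\pm g_q(t),\qquad\text{(c)}\ \frac{\overline Y(m)}{\tilde Y(m)}\in1\pm g_q(t),$$ where $t=m\,n^{-3/2}$.
   Context: Triangle-free process on $[n]$ ($G_0$ empty; $G_m$ from $G_{m-1}$ by adding a uniformly random non-edge whose addition creates no triangle). $\varepsilon>0$ fixed sufficiently small, $C=C(\varepsilon)$ sufficiently large constant, $\omega=\omega(n)\to\infty$ sufficiently slowly, $n$ sufficiently large; $t^*=(\frac1{2\sqrt2}-\varepsilon)\sqrt{\log n}$, $m^*=t^*n^{3/2}$. Open edges $O(G_m)=\{e\notin E(G_m):e\not\subseteq N_{G_m}(v)\ \forall v\}$, $Q(m)=|O(G_m)|$. For $e\in O(G_m)$: $Y_e(m)$ (resp. $X_e(m)$) is the number of $f\in O(G_m)$ such that $e,f$ form two sides of a triangle whose third side is in $E(G_m)$ (resp. in $O(G_m)$). $\overline X(m),\overline Y(m)$ are the averages of $X_e(m),Y_e(m)$ over $e\in O(G_m)$. $\tilde Q(m)=e^{-4t^2}\binom n2$, $\tilde X(m)=2e^{-8t^2}n$, $\tilde Y(m)=4te^{-4t^2}\sqrt n$; $f_y(t)=e^{Ct^2}n^{-1/4}(\log n)^{5/2}$, $f_x(t)=e^{-4t^2}f_y(t)$,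 $g_y(t)=e^{2t^2}n^{-1/4}(\log n)^4$, $g_x(t)=Cg_y(t)$, $g_q(t)=e^{2t^2}n^{-1/4}(\log n)^3$. $\mathcal X(m')$: $X_e(m)\in\tilde X(m)\pm f_x(t)\tilde X(n^{3/2})$ for all $e\in O(G_m)$ and $m\le\min\{\omega n^{3/2},m'\}$, and $X_e(m)\in(1\pm g_x(t))\tilde X(m)$ for all $e\in O(G_m)$ and $\omega n^{3/2}<m\le m'$. $\mathcal Y(m')$: the same with $Y_e,\tilde Y,f_y,g_y$ in place of $X_e,\tilde X,f_x,g_x$. *)

(* Defs.v *)
From mathcomp Require Import all_boot all_order all_algebra.
From mathcomp Require Import all_classical all_reals all_analysis.

Set Implicit Arguments.
Unset Strict Implicit.
Unset Printing Implicit Defensive.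

Import Order.TTheory GRing.Theory Num.Theory.
Local Open Scope ring_scope.

(* A graph on the vertex set [n] is identified with its edge set, a set of
   2-element subsets of 'I_n. *)
Notation graph n := {set {set 'I_n}}.

Section Graphs.
Variable n : nat.
Implicit Types (E : graph n) (e f g : {set 'I_n}).

Definition pairs : graph n := [set e : {set 'I_n} | #|e| == 2%N].

Definition nbhd E (v : 'I_n) : {set 'I_n} := [set u | [set u; v] \in E].

Definition triangle e f g : bool :=
  [exists u : 'I_n, exists v : 'I_n, exists w : 'I_n,
    [&& u != v, u != w, v != w,
        e == [set u; v], f == [set u; w] & g == [set v; w]]].

Definition triangle_free E : bool :=
  [forall e in E, forall f in E, forall g in E, ~~ triangle e f g].

(* The edges which the process may add to E, E being triangle-free. *)
Definition addable E : graph n :=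
  [set e in pairs | (e \notin E) && triangle_free (e |: E)].

Definition open_edges E : graph n :=
  [set e in pairs | (e \notin E) && [forall v, ~~ (e \subset nbhd E v)]].

Definition Xcount E e : nat :=
  #|[set f in open_edges E | [exists g in open_edges E, triangle e f g]]|.

Definition Ycount E e : nat :=
  #|[set f in open_edges E | [exists g in E, triangle e f g]]|.

End Graphs.

Section Process.
Variables (R : realType) (n : nat).

(* One-step transition probability; a graph with no addable edge is absorbing. *)
Definition step (E E' : graph n) : R :=
  if addable E == finset.set0 then (E' == E)%:R
  else (E' \in [set e |: E | e in addable E]%SET)%:R / #|addable E|%:R.

(* The law of the trajectory (G_0, ..., G_m). *)
Definition trajectory (m : nat) := {ffun 'I_m.+1 -> graph n}.

Definition trajectory_law (m : nat) (G : trajectory m) : R :=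
  (G ord0 == finset.set0)%:R *
  \prod_(i < m) step (G (widen_ord (leqnSn m) i)) (G (lift ord0 i)).

Definition Prob (m : nat) (A : pred (trajectory m)) : R :=
  \sum_(G : trajectory m | A G) trajectory_law G.

Definition avg_open (F : graph n -> {set 'I_n} -> nat) (E : graph n) : R :=
  (\sum_(e in open_edges E) (F E e)%:R) / #|open_edges E|%:R.

End Process.

Section Tracking.
Variables (R : realType) (n : nat).
Implicit Types (m t C w a b d : R).

Definition n32 : R := n%:R `^ (3 / 2).

Definition time_of m : R := m / n32.

Definition tstar (eps : R) : R :=
  ((2 * Num.sqrt 2)^-1 - eps) * Num.sqrt (ln n%:R).
Definition mstar (eps : R) : R := tstar eps * n32.

Definition Qt m : R := expR (- 4 * time_of m ^+ 2) * 'C(n, 2)%:R.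
Definition Xt m : R := 2 * expR (- 8 * time_of m ^+ 2) * n%:R.
Definition Yt m : R :=
  4 * time_of m * expR (- 4 * time_of m ^+ 2) * Num.sqrt n%:R.

Definition fy C t : R :=
  expR (C * t ^+ 2) * n%:R `^ (- (1 / 4)) * ln n%:R `^ (5 / 2).
Definition fx C t : R := expR (- 4 * t ^+ 2) * fy C t.
Definition gy t : R := expR (2 * t ^+ 2) * n%:R `^ (- (1 / 4)) * ln n%:R ^+ 4.
Definition gx C t : R := C * gy t.
Definition gq t : R := expR (2 * t ^+ 2) * n%:R `^ (- (1 / 4)) * ln n%:R ^+ 3.

(* a \in b +- d *)
Definition in_pm a b d : bool := b - d <= a <= b + d.

(* The events X(m') and Y(m') on trajectories of length M >= m';
   w stands for the value omega(n). *)
Definition eventX C w (M m' : nat) (G : trajectory n M) : bool :=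
  [forall k : 'I_M.+1, (k <= m')%N ==>
    [forall e in open_edges (G k),
      let x := (Xcount (G k) e)%:R in
      let t := time_of k%:R in
      if k%:R <= w * n32 then in_pm x (Xt k%:R) (fx C t * Xt n32)
      else in_pm x (Xt k%:R) (gx C t * Xt k%:R)]].

Definition eventY C w (M m' : nat) (G : trajectory n M) : bool :=
  [forall k : 'I_M.+1, (k <= m')%N ==>
    [forall e in open_edges (G k),
      let y := (Ycount (G k) e)%:R in
      let t := time_of k%:R in
      if k%:R <= w * n32 then in_pm y (Yt k%:R) (fy C t * Yt n32)
      else in_pm y (Yt k%:R) (gy t * Yt k%:R)]].

End Tracking.

(* Main.v *)
(** Write [Q] for the number of open edges, and let [A] and [B] be the sums of [X_e]
    and [Y_e] over the open edges [e]. Since the graph is triangle-free, adding [e]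
    changes these quantities by exact amounts: [Q] loses [1 + Y_e], [A] loses
    [3 (X_e + sum X_f)] and [B] gains [X_e - 2 sum Y_f], where [f] runs over the
    edges counted by [Y_e]. Averaging over [e], and up to the covariances of [X] and
    [Y] (which the events bound by [g_x g_y], far below [g_q]), the drift of
    [U = A / Q^3] is 0, that of [V = B / Q^2] is [U], and that of [ln Q] is [- V].
    Hence [U], [V - k U] and [ln Q + k V - k (k + 1) / 2 U] are near-martingales, whose
    increments are so small that an exponential supermartingale confines them.
    Before time [omega] the events control every step of the process, so the three
    processes start deterministically close to their ideal values; since these
    errors then grow at most like [t ^ 2 <= e^(2 t^2)], they stay below [g_q].
    Inverting the three relations gives [Q], [A] and [B]. *)

Require Import Defs.
From mathcomp Require Import all_boot all_order all_algebra.
From mathcomp Require Import all_classical all_reals all_analysis.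
From mathcomp Require Import ring lra.

Set Implicit Arguments.
Unset Strict Implicit.
Unset Printing Implicit Defensive.

Import Order.TTheory GRing.Theory Num.Theory.
Import numFieldNormedType.Exports.
Local Open Scope classical_set_scope.
Local Open Scope ring_scope.

(** * Edge counts of triangle-free graphs *)

Section Triangles.
Variable n : nat.
Implicit Types (E : graph n) (e f g : {set 'I_n}) (u v w : 'I_n).

(** Tracking [Q] and the two averages directly would feed each error into the drift of the others.
    In the coordinates used here the system is triangular and solved by polynomials in [t], so
    errors add up and are not amplified; only inverting the change of coordinates costs a factor of
    order [t ^ 2]. One scale governs the late estimates: [G = e^(2t^2) n^(-1/4)]. The events give
    relative errors [C G L^4] with [L = log n], and covariances square them, so the drift per step
    is [G^2 n^(-3/2)] times powers of [t], [L] and [C]. The tolerance is let grow like [G], by about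
    [4 t G n^(-3/2)] per step, which absorbs this as soon as [G] times a power of [L] is small.
    Since [1/(2 sqrt 2)] is the value at which [G] reaches 1, stopping [eps] earlier gives
    [G <= n^(-eps)]. The exponential rate is [sqrt n]. Increments are about [n^(-3/2)], so the
    quadratic term is negligible, and an initial gap of [n^(-1/4)] already gives failure probability
    [6 exp(-n^(1/4))]. The half power of [L] between [f_y] and [g_q] pays for all constants that
    depend on [omega], which is why [omega] must grow slowly. *)

Lemma set2_eq_cases u v u' v' :
  [set u; v]%SET = [set u'; v']%SET -> (u = u' /\ v = v') \/ (u = v' /\ v = u').
Proof.
move=> /setP H.
have := H u; have := H v; have := H u'; have := H v'.
rewrite !inE !eqxx ?orbT /=.
by move=> /orP[]/eqP ? /orP[]/eqP ? /esym/orP[]/eqP ? /esym/orP[]/eqP ?; subst; auto.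
Qed.

Lemma triangleP e f g :
  reflect (exists u v w, [/\ u != v, u != w, v != w &
     [/\ e = [set u; v]%SET, f = [set u; w]%SET & g = [set v; w]%SET]])
    (triangle e f g).
Proof.
apply: (iffP existsP) => [[u /existsP[v /existsP[w]]]|[u [v [w]]]].
  move=> /and5P[uv uw vw /eqP eE /andP[/eqP fE /eqP gE]].
  by exists u, v, w; split.
move=> [uv uw vw [-> -> ->]]; exists u; apply/existsP; exists v.
by apply/existsP; exists w; rewrite uv uw vw !eqxx.
Qed.

Lemma triangleACB e f g : triangle e f g = triangle e g f.
Proof.
apply/triangleP/triangleP => -[u [v [w [uv uw vw [-> -> ->]]]]];
  exists v, u, w; split=> //; rewrite 1?eq_sym //; split=> //;
  by rewrite finset.setUC.
Qed.

Lemma triangleBAC e f g : triangle e f g = triangle f e g.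
Proof.
apply/triangleP/triangleP => -[u [v [w [uv uw vw [-> -> ->]]]]];
  exists u, w, v; split=> //; rewrite 1?eq_sym //; split=> //;
  by rewrite finset.setUC.
Qed.

(** This turns the existential in [Xcount] and [Ycount] into a sum: every counted [f] has exactly
    one witness [g]. *)
Lemma triangle_third_unique e f g g' :
  triangle e f g -> triangle e f g' -> g = g'.
Proof.
move=> /triangleP[u [v [w [uv uw vw [-> -> ->]]]]].
move=> /triangleP[u' [v' [w' [uv' uw' vw' [e1 e2 ->]]]]].
case: (set2_eq_cases e1) => -[? ?]; subst;
case: (set2_eq_cases e2) => -[? ?]; subst => //;
  by rewrite ?eqxx in uv uw vw uv' uw' vw'.
Qed.

Lemma triangle_neq e f g : triangle e f g -> e != f.
Proof.
move=> /triangleP[u [v [w [uv uw vw [-> -> _]]]]].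
by apply/eqP => /set2_eq_cases[] [? ?]; subst; rewrite ?eqxx in uv uw vw.
Qed.

(** The invariant of reachable states. Outside it [addable] and [open_edges] may differ. *)
Definition valid E := (E \subset pairs n) && triangle_free E.

Lemma valid_pairs E e : valid E -> e \in E -> e \in pairs n.
Proof. by move=> /andP[/fintype.subsetP + _]; apply. Qed.

Lemma valid_triangle E e f g :
  valid E -> triangle e f g -> e \in E -> f \in E -> g \in E -> False.
Proof.
move=> /andP[_ /forallP tf] t eE fE gE.
have /implyP/(_ eE)/forallP/(_ f)/implyP/(_ fE)/forallP/(_ g)/implyP/(_ gE) := tf e.
by rewrite t.
Qed.

Lemma open_pairs E e : e \in open_edges E -> e \in pairs n.
Proof. by rewrite inE => /andP[]. Qed.

Lemma open_notin E e : e \in open_edges E -> e \notin E.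
Proof. by rewrite inE => /andP[_ /andP[]]. Qed.

Lemma pairsP e : reflect (exists u v, u != v /\ e = [set u; v]%SET) (e \in pairs n).
Proof.
rewrite [X in reflect _ X]finset.in_set; apply: (iffP (@cards2P _ e)).
  by move=> [u [v H]]; exists u, v; case: H.
by move=> [u [v [uv ->]]]; exists u, v.
Qed.

Lemma openP E e (vE : valid E) : reflect
  [/\ e \in pairs n, e \notin E &
      forall f g, f \in E -> g \in E -> ~~ triangle e f g]
  (e \in open_edges E).
Proof.
rewrite [X in reflect _ X]finset.in_set; apply: (iffP and3P) => -[ep eE].
  move=> /forallP H; split=> // f g fE gE; apply/negP => /triangleP.
  move=> [u [v [w [uv uw vw [ee ff gg]]]]]; have /negP := H w; apply.
  by apply/fintype.subsetP => z; rewrite ee !inE => /orP[] /eqP->; rewrite -?ff -?gg.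
move=> H; split=> //; apply/forallP => w; apply/negP => /fintype.subsetP sub.
move/pairsP: (ep) => [u [v [uv ee]]]; rewrite ee in sub.
have := sub u; have := sub v; rewrite !inE !eqxx orbT => /(_ isT) vw /(_ isT) uw.
have /negP := H _ _ uw vw; apply; apply/triangleP; exists u, v, w.
(* [nbhd] does not exclude loops by itself; a loop would be a singleton, while [E] consists of
   pairs. *)
have neq a : ([set a; w] \in E)%SET -> a != w.
  by move=> /(valid_pairs vE); rewrite finset.in_set cards2; case: (a != w).
by split=> //; apply: neq.
Qed.

Arguments openP {E} e.
(** A triangle of [e |: E] that is not already in [E] contains [e] exactly once, so its other two
    sides are old edges, and this is what openness of [e] forbids. *)
Lemma addable_open E : valid E -> addable E = open_edges E.
Proof.
move=> vE; apply/setP => e; rewrite [LHS]finset.in_set; apply/and3P/(openP e vE) => -[ep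
  eE].
  move=> tf; split=> // f g fE gE; apply/negP => t.
  have ve : valid (e |: E)%SET.
    apply/andP; split=> //; rewrite finset.subUset finset.sub1set ep /=.
    by case/andP: vE.
  by apply: (valid_triangle ve t); rewrite !inE ?eqxx ?fE ?gE ?orbT.
move=> H; split=> //; apply/forallP => f; apply/implyP; rewrite !inE => hf.
apply/forallP => g; apply/implyP; rewrite !inE => hg.
apply/forallP => h; apply/implyP; rewrite !inE => hh; apply/negP => t.
(* [key] treats the triangles whose first side is [e]; the symmetries of [triangle] bring [e] there
   from the other two positions. *)
have key f' g' h' : triangle f' g' h' -> f' = e -> g' \in (e |: E)%SET ->
    h' \in (e |: E)%SET -> False.
  move=> t' fe; rewrite fe in t' *; rewrite !inE => /orP[/eqP ge|gE] /orP[/eqP he|hE].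
  - by move: (triangle_neq t'); rewrite ge eqxx.
  - by move: (triangle_neq t'); rewrite ge eqxx.
  - by move: t'; rewrite triangleACB => /triangle_neq; rewrite he eqxx.
  - by move: (H _ _ gE hE); rewrite t'.
case/orP: hf => [/eqP|fE].
  by move=> fe; apply: (key f g h) => //; rewrite !inE.
case/orP: hg => [/eqP ge|gE].
  apply: (key g f h) => //; first by rewrite triangleBAC.
    by rewrite !inE fE orbT.
  by rewrite !inE.
case/orP: hh => [/eqP he|hE]; last exact: (valid_triangle vE t).
apply: (key h f g) => //; first by rewrite triangleBAC triangleACB.
  by rewrite !inE fE orbT.
by rewrite !inE gE orbT.
Qed.

Lemma valid_add E e : valid E -> e \in open_edges E -> valid (e |: E)%SET.
Proof.
move=> vE eO; have := eO; rewrite -(addable_open vE) finset.in_set => /and3P[ep _ tf].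
rewrite /valid tf andbT finset.subUset finset.sub1set ep /=.
by case/andP: vE.
Qed.

Lemma valid0 : valid (finset.set0 : graph n).
Proof.
rewrite /valid finset.sub0set; apply/forallP => f; apply/implyP; by rewrite inE.
Qed.

(* [Y_e] as a set of edges. *)
Definition Yset E e : graph n :=
  [set f in open_edges E | [exists g in E, triangle e f g]].

Lemma YsetP E e f :
  reflect (f \in open_edges E /\ exists2 g, g \in E & triangle e f g)
    (f \in Yset E e).
Proof.
rewrite [X in reflect _ X]inE; apply: (iffP andP) => -[fO].
  by move=> /existsP[g /andP[gE t]]; split=> //; exists g.
by move=> [g gE t]; split=> //; apply/existsP; exists g; rewrite gE.
Qed.

Lemma Yset_sym E e f : e \in open_edges E -> f \in Yset E e -> e \in Yset E f.
Proof.
by move=> eO /YsetP[fO [g gE t]]; apply/YsetP; split=> //; exists g; rewrite // triangleBAC.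
Qed.

Lemma Yset_irrefl E e : e \notin Yset E e.
Proof. by apply/YsetP => -[_ [g _ /triangle_neq]]; rewrite eqxx. Qed.

Lemma open_add E e : valid E -> e \in open_edges E ->
  open_edges (e |: E)%SET = (open_edges E :\: (e |: Yset E e))%SET.
Proof.
move=> vE eO; have ve := valid_add vE eO.
apply/setP => f; rewrite finset.in_setD !finset.in_setU1; apply/(openP f ve)/idP.
  move=> [fp]; rewrite finset.in_setU1 negb_or => /andP[fe fE] H.
  have fO : f \in open_edges E.
    by apply/(openP _ vE); split=> // g h gE hE; apply: H; rewrite !inE ?gE ?hE orbT.
  rewrite fO andbT negb_or fe /=; apply/YsetP => -[_ [g gE t]].
  have := H e g; rewrite !finset.in_setU1 eqxx gE orbT => /(_ isT isT).
  by rewrite triangleBAC t.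
rewrite negb_or => /andP[/andP[fe fY] fO]; split; first exact: open_pairs fO.
  by rewrite !inE negb_or fe open_notin.
move=> g h; rewrite !inE => gE hE; apply/negP => t.
have [_ _ Hf] := openP f vE fO.
case/orP: gE hE => [/eqP ge|gE] /orP[/eqP he|hE].
- by move: t; rewrite ge he triangleBAC triangleACB => /triangle_neq; rewrite eqxx.
- move/negP: fY; apply; apply/YsetP; split=> //; exists h => //.
  by rewrite triangleBAC -ge.
- move/negP: fY; apply; apply/YsetP; split=> //; exists g => //.
  by rewrite triangleBAC triangleACB -he.
- by move: (Hf _ _ gE hE); rewrite t.
Qed.

Lemma no_Yset_open_triangle E e f h : valid E -> e \in open_edges E ->
  f \in Yset E e -> h \in open_edges E -> triangle e f h -> False.
Proof.
move=> vE eO /YsetP[fO [g gE t]] hO t'.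
by move: (open_notin hO); rewrite -(triangle_third_unique t t') gE.
Qed.

(** Write [e = uv]. If [f] and [g] met outside [e], say [f = uw] and [g = vw], the edge witnessing
    [f] would be [vw = g], which is open and so not in [E]. Hence they share an endpoint of [e]:
    [f = ub], [g = uc], [h = bc], and the witnesses [vb], [vc] form a triangle with [h]. So [h] is
    neither open nor an edge. *)
Lemma Yset_pair_triangle E e f g h : valid E -> e \in open_edges E ->
  f \in Yset E e -> g \in Yset E e -> triangle f g h ->
  exists f' g', [/\ f' \in E, g' \in E & triangle h f' g'].
Proof.
move=> vE eO /YsetP[fO [f1 f1E /triangleP[u [v [w [uv uw vw [ee ff ff1]]]]]]].
move=> /YsetP[gO [g1 g1E /triangleP[u' [v' [w' [uv' uw' vw' [ee' gg gg1]]]]]]].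
move=> /triangleP[a [b [c [ab ac bc [fab gac hbc]]]]].
have fN := open_notin fO; have gN := open_notin gO.
rewrite ff in fab fN; rewrite gg in gac gN; rewrite ee in ee'; subst h.
case: (set2_eq_cases ee') => -[? ?]; subst u' v';
case: (set2_eq_cases fab) => -[? ?]; subst;
case: (set2_eq_cases gac) => -[? ?]; subst;
  rewrite ?eqxx // in uv uw vw uv' uw' vw' ab ac bc;
  try (by rewrite f1E in gN); try (by rewrite g1E in fN);
  try (by rewrite finset.setUC f1E in gN);
  try (by rewrite finset.setUC g1E in fN);
  try (by rewrite eqxx in uv uw vw uv' uw' vw' ab ac bc).
exists [set b; v]%SET, [set c; v]%SET.
split; [by rewrite finset.setUC|by rewrite finset.setUC|].
by apply/triangleP; exists b, c, v; split; rewrite // eq_sym.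
Qed.

Lemma Yset_pair_open E e f g h : valid E -> e \in open_edges E ->
  f \in Yset E e -> g \in Yset E e -> h \in open_edges E -> triangle f g h -> False.
Proof.
move=> vE eO fY gY hO t.
have [f' [g' [f'E g'E t']]] := Yset_pair_triangle vE eO fY gY t.
by have [_ _ H] := openP _ vE hO; move: (H _ _ f'E g'E); rewrite t'.
Qed.

Lemma Yset_pair_edge E e f g h : valid E -> e \in open_edges E ->
  f \in Yset E e -> g \in Yset E e -> h \in E -> triangle f g h -> False.
Proof.
move=> vE eO fY gY hE t.
have [f' [g' [f'E g'E t']]] := Yset_pair_triangle vE eO fY gY t.
exact: (valid_triangle vE t').
Qed.

End Triangles.

(** * Weighted triangle counts and the exact change in one step *)

Section TriangleCounts.
Variables (R : realType) (n : nat).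
Implicit Types (E S : graph n) (e f g h : {set 'I_n}) (a b c : {set 'I_n} -> R).

(** A symmetric trilinear form. Removing edges from a set becomes the expansion of a product of
    differences of indicators, in which each vanishing term says that some kind of triangle does not
    exist. *)
Definition tri3 a b c : R :=
  \sum_f \sum_g \sum_h a f * b g * c h * (triangle f g h)%:R.

Definition ind S : {set 'I_n} -> R := fun f => (f \in S)%:R.

Lemma tri3BAC a b c : tri3 a b c = tri3 b a c.
Proof.
rewrite /tri3 exchange_big; apply: eq_bigr => g _; apply: eq_bigr => f _.
by apply: eq_bigr => h _; rewrite triangleBAC [a f * _]mulrC.
Qed.

Lemma tri3ACB a b c : tri3 a b c = tri3 a c b.
Proof.
rewrite /tri3; apply: eq_bigr => f _; rewrite exchange_big.
apply: eq_bigr => g _; apply: eq_bigr => h _.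
by rewrite triangleACB; ring.
Qed.

Lemma tri3B a a' b c : tri3 (fun f => a f - a' f) b c = tri3 a b c - tri3 a' b c.
Proof.
rewrite /tri3 -sumrB; apply: eq_bigr => f _; rewrite -sumrB; apply: eq_bigr => g _.
by rewrite -sumrB; apply: eq_bigr => h _; rewrite !mulrBl.
Qed.

Lemma tri3D a a' b c : tri3 (fun f => a f + a' f) b c = tri3 a b c + tri3 a' b c.
Proof.
rewrite /tri3 -big_split; apply: eq_bigr => f _; rewrite -big_split.
apply: eq_bigr => g _; rewrite -big_split.
by apply: eq_bigr => h _; rewrite !mulrDl.
Qed.

Lemma tri3BB a k c : tri3 (fun f => a f - k f) (fun f => a f - k f) c =
  tri3 a a c - 2 * tri3 k a c + tri3 k k c.
Proof.
have H x : tri3 x (fun f => a f - k f) c = tri3 a x c - tri3 k x c.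
  by rewrite tri3BAC tri3B.
by rewrite tri3B !H (tri3BAC a k); ring.
Qed.

Lemma tri3Br a b c c' : tri3 a b (fun f => c f - c' f) = tri3 a b c - tri3 a b c'.
Proof. by rewrite tri3ACB tri3BAC tri3B 2!(tri3BAC _ a) 2!(tri3ACB a _ b). Qed.

Lemma tri3Dr a b c c' : tri3 a b (fun f => c f + c' f) = tri3 a b c + tri3 a b c'.
Proof. by rewrite tri3ACB tri3BAC tri3D 2!(tri3BAC _ a) 2!(tri3ACB a _ b). Qed.

Lemma tri3_eq0 S1 S2 S3 :
  (forall f g h, f \in S1 -> g \in S2 -> h \in S3 -> triangle f g h -> False) ->
  tri3 (ind S1) (ind S2) (ind S3) = 0.
Proof.
move=> H; apply: big1 => f _; apply: big1 => g _; apply: big1 => h _.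
rewrite /ind; case: (boolP (f \in S1)) => fS; last by rewrite !mul0r.
case: (boolP (g \in S2)) => gS; last by rewrite mulr0 !mul0r.
case: (boolP (h \in S3)) => hS; last by rewrite mulr0 !mul0r.
by case: (boolP (triangle f g h)) => t; [case: (H f g h)|rewrite mulr0].
Qed.

Lemma card_triangle_third S S' e :
  (#|[set f in S | [exists g in S', triangle e f g]]%SET|%:R : R) =
  \sum_g \sum_h (g \in S)%:R * (h \in S')%:R * (triangle e g h)%:R.
Proof.
rewrite -sum1_card natr_sum big_mkcond /=; apply: eq_bigr => f _.
rewrite inE; case: (boolP (f \in S)) => fS /=; last first.
  by rewrite big1 // => h _; rewrite !mul0r.
case: ifPn => [/existsP[g /andP[gS t]]|].
  rewrite (bigD1 g) //= gS t big1 ?addr0 ?mulr1 // => h hg.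
  case: (boolP (triangle e f h)) => t'; last by rewrite mulr0.
  by rewrite (triangle_third_unique t' t) eqxx in hg.
move=> H; rewrite big1 // => h _; rewrite mul1r.
case: (boolP (h \in S')) => hS; last by rewrite mul0r.
case: (boolP (triangle e f h)) => t; last by rewrite mulr0.
by case/existsP: H; exists h; rewrite hS.
Qed.

Lemma sum_count_tri3 S S1 S2 :
  \sum_(e in S) (#|[set f in S1 | [exists g in S2, triangle e f g]]%SET|%:R : R) =
  tri3 (ind S) (ind S1) (ind S2).
Proof.
rewrite big_mkcond /=; apply: eq_bigr => e _; rewrite /ind.
case: (boolP (e \in S)) => eS; last first.
  by rewrite big1 // => g _; rewrite big1 // => h _; rewrite !mul0r.
rewrite card_triangle_third; apply: eq_bigr => g _; apply: eq_bigr => h _.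
by rewrite mul1r.
Qed.

Definition Qn E : R := #|open_edges E|%:R.
Definition SX E : R := \sum_(e in open_edges E) (Xcount E e)%:R.
Definition SY E : R := \sum_(e in open_edges E) (Ycount E e)%:R.

Section Step.
Variables (E : graph n) (e : {set 'I_n}).
Hypotheses (vE : valid E) (eO : e \in open_edges E).
Let O := open_edges E.
Let Y := Yset E e.
Let K := (e |: Y)%SET.

Let eK (F : {set 'I_n} -> R) : \sum_(f in K) F f = F e + \sum_(f in Y) F f.
Proof. by rewrite big_setU1 // Yset_irrefl. Qed.

Let KO : K \subset O.
Proof.
rewrite finset.subUset finset.sub1set eO /=.
by apply/fintype.subsetP => f /YsetP[].
Qed.

Lemma open_add_ind : ind (open_edges (e |: E)%SET) = (fun f => ind O f - ind K f).
Proof.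
apply: funext => f; rewrite /ind (open_add vE eO) finset.in_setD -/Y -/K -/O.
case: (boolP (f \in K)) => fK /=; last by rewrite subr0.
by rewrite (fintype.subsetP KO _ fK) subrr.
Qed.

Lemma edge_add_ind : ind (e |: E)%SET = (fun f => ind E f + ind [set e]%SET f).
Proof.
apply: funext => f; rewrite /ind finset.in_setU1 inE.
case: eqP => [->|] /=; last by rewrite addr0.
by rewrite (negbTE (open_notin eO)) add0r.
Qed.

Lemma Qn_add : Qn (e |: E)%SET = Qn E - 1 - (Ycount E e)%:R.
Proof.
rewrite /Qn (open_add vE eO) -/Y -/K -/O.
have := cardsID K O; rewrite (finset.setIidPr KO) => <-.
by rewrite natrD cardsU1 Yset_irrefl natrD /=; ring.
Qed.

(** [K] is the set of edges that stop being open. An open triangle thus loses at most one side,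
    which kills the quadratic and cubic terms in the expansion of [SX]. *)
Lemma KKopen f g h : f \in K -> g \in K -> h \in O -> triangle f g h -> False.
Proof.
have H f' h' : f' \in Y -> h' \in O -> triangle e f' h' -> False.
  by move=> fY hO; apply: no_Yset_open_triangle vE eO fY hO.
rewrite !finset.in_setU1 => /orP[/eqP->|fY] /orP[/eqP->|gY] hO t.
- by move: (triangle_neq t); rewrite eqxx.
- exact: H gY hO t.
- by apply: (H f h) => //; rewrite triangleBAC.
- exact: Yset_pair_open vE eO fY gY hO t.
Qed.

Lemma SX_add : SX (e |: E)%SET = SX E - 3 * ((Xcount E e)%:R +
  \sum_(f in Yset E e) (Xcount E f)%:R).
Proof.
have -> : (Xcount E e)%:R + \sum_(f in Yset E e) (Xcount E f)%:R =
  \sum_(f in K) (Xcount E f)%:R :> R by rewrite eK.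
rewrite /SX !sum_count_tri3 open_add_ind -/O.
set o := ind O; set k := ind K.
have kko : tri3 k k o = 0 by apply: tri3_eq0 => f g h fK gK hO; apply: (KKopen fK gK hO).
have kkk : tri3 k k k = 0.
  apply: tri3_eq0 => f g h fK gK hK; apply: KKopen fK gK _.
  exact: (fintype.subsetP KO).
rewrite tri3BB !tri3Br kko kkk (tri3ACB k o k) kko (tri3ACB o o k) (tri3BAC o k o).
by ring.
Qed.

(** Expansion of [(o - k)(o - k)(d + i)]. Pairs whose third side is the new edge [e] contribute
    [X_e]. The loss is [2 kod - kkd]; its terms containing [e] itself cancel, because both parts
    count the pairs of [e] with its [Y]-partners. *)
Lemma SY_add : SY (e |: E)%SET = SY E + (Xcount E e)%:R -
  2 * \sum_(f in Yset E e) (Ycount E f)%:R.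
Proof.
set o := ind O; set k := ind K; set y := ind Y; set i := ind [set e]%SET; set d := ind E.
have kE : k = (fun f => i f + y f).
  apply: funext => f; rewrite /k /i /y /ind finset.in_setU1 finset.in_set1.
  case: eqP => [->|] /=; last by rewrite add0r.
  by rewrite (negbTE (Yset_irrefl E e)) addr0.
have iko : tri3 k o i = 0.
  rewrite tri3ACB tri3BAC; apply: tri3_eq0 => f g h; rewrite finset.in_set1 => /eqP->.
  rewrite finset.in_setU1 => /orP[/eqP->|gY] hO t.
    by move: (triangle_neq t); rewrite eqxx.
  exact: no_Yset_open_triangle vE eO gY hO t.
have kki : tri3 k k i = 0.
  rewrite tri3ACB tri3BAC; apply: tri3_eq0 => f g h; rewrite finset.in_set1 => /eqP->.
  rewrite finset.in_setU1 => /orP[/eqP->|gY] hK t.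
    by move: (triangle_neq t); rewrite eqxx.
  apply: no_Yset_open_triangle vE eO gY _ t.
  exact: (fintype.subsetP KO).
have yyd : tri3 y y d = 0.
  by apply: tri3_eq0 => f g h; apply: Yset_pair_edge.
have iid : tri3 i i d = 0.
  apply: tri3_eq0 => f g h; rewrite !finset.in_set1 => /eqP-> /eqP-> _ t.
  by move: (triangle_neq t); rewrite eqxx.
(* An open partner of [e] across an edge of [E] lies in [Y] by definition, so [o] may replace [y]
   next to [i] and [d]. *)
have iyd : tri3 i y d = tri3 i o d.
  rewrite /tri3; apply: eq_bigr => f _; apply: eq_bigr => g _; apply: eq_bigr => h _.
  rewrite /i /y /d /o /ind finset.in_set1.
  case: eqP => [->|]; last by rewrite !mul0r.
  case: (boolP (g \in Y)) => [/YsetP[-> _]//|gY].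
  case: (boolP (g \in O)) => [gO|//].
  case: (boolP (h \in E)) => [hE|_]; last by rewrite !mulr0 !mul0r.
  case: (boolP (triangle e g h)) => [t|_]; last by rewrite !mulr0.
  by case/YsetP: gY; split=> //; exists h.
have Ye : (Ycount E e)%:R = tri3 i o d.
  by rewrite -sum_count_tri3 big_set1.
rewrite {1}/SY /Ycount sum_count_tri3 open_add_ind edge_add_ind -/o -/k -/d -/i.
rewrite tri3Dr !tri3BB iko kki.
have -> : tri3 k o d = tri3 i o d + tri3 y o d by rewrite kE tri3D.
have -> : tri3 k k d = 2 * tri3 i o d.
  rewrite kE tri3D (tri3BAC i) (tri3BAC y (fun _ => _)) !tri3D iid yyd.
  by rewrite (tri3BAC y i) iyd; ring.
rewrite sum_count_tri3 -/y -/o -/d.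
have -> : (Xcount E e)%:R = tri3 i o o by rewrite -sum_count_tri3 big_set1.
rewrite /SY sum_count_tri3 -/o -/d (tri3ACB o o i) (tri3BAC o i o).
by ring.
Qed.

End Step.

(** Double counting for the symmetric relation [f \in Yset E e]. It makes the average of a
    neighbourhood sum the average of a product, hence a product of averages plus a covariance. *)
Lemma sum_Yset E (F : {set 'I_n} -> R) :
  \sum_(e in open_edges E) \sum_(f in Yset E e) F f =
  \sum_(f in open_edges E) F f * (Ycount E f)%:R.
Proof.
rewrite (exchange_big_dep (fun f => f \in open_edges E)) /=; last first.
  by move=> e f _ /YsetP[].
apply: eq_bigr => f fO; rewrite big_const -Monoid.iteropE /= -/(_ *+ _).
rewrite mulr_natr; congr (_ *+ _); apply: eq_card => e; rewrite [LHS]inE.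
apply/andP/idP => [[eO fY]|eY]; first exact: (Yset_sym eO fY).
by split; [case/YsetP: eY|apply: Yset_sym].
Qed.
End TriangleCounts.

(** * The chain and its supermartingales *)

Section Chain.
Variables (R : realType) (n : nat).
Implicit Types (E : graph n) (b : nat -> graph n -> R) (ok : nat -> pred (graph n)).

Lemma step_ge0 E E' : 0 <= step R E E'.
Proof. by rewrite /step; case: ifP => _; rewrite ?divr_ge0. Qed.

Lemma sum_step E (F : graph n -> R) :
  \sum_E' step R E E' * F E' =
  if addable E == finset.set0 then F E
  else (\sum_(e in addable E) F (e |: E)%SET) / #|addable E|%:R.
Proof.
rewrite /step; case: ifP => _.
  rewrite (bigD1 E) //= eqxx mul1r big1 ?addr0 // => E' /negbTE->.
  by rewrite mul0r.
rewrite [X in _ = X / _](_ : _ = \sum_(E' in [set (e |: E)%SET | e in addable E]%SET) F E').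
  rewrite mulr_suml [RHS]big_mkcond /=; apply: eq_bigr => E' _.
  by case: ifP => _; rewrite ?mul1r ?mul0r // mulrC.
rewrite big_imset //= => e f; rewrite !finset.in_set => /and3P[_ eE _] /and3P[_ fE _].
move=> /setP/(_ e); rewrite !finset.in_setU1 eqxx (negbTE eE) orbF.
by rewrite orbF => /esym/eqP.
Qed.

Lemma sum_step1 E : \sum_E' step R E E' = 1.
Proof.
have := sum_step E (fun=> 1); under eq_bigr do rewrite mulr1.
move=> ->; case: ifPn => // ne; rewrite sumr_const divff //.
by rewrite pnatr_eq0 cards_eq0.
Qed.

Definition extend m (G : trajectory n m) E : trajectory n m.+1 :=
  [ffun i : 'I_m.+2 => if unlift ord_max i is Some j then G j else E].

Lemma extend_widen m (G : trajectory n m) E (i : 'I_m.+1) :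
  extend G E (widen_ord (leqnSn m.+1) i) = G i.
Proof.
rewrite ffunE; have -> : widen_ord (leqnSn m.+1) i = lift ord_max i.
  by apply: val_inj; rewrite /= /bump leqNgt ltn_ord.
by rewrite liftK.
Qed.

Lemma extend_max m (G : trajectory n m) E : extend G E ord_max = E.
Proof. by rewrite ffunE unlift_none. Qed.

Lemma sum_trajectoryS m (F : trajectory n m.+1 -> R) :
  \sum_G F G = \sum_(G : trajectory n m) \sum_E F (extend G E).
Proof.
rewrite pair_big /=.
rewrite (reindex (fun p : trajectory n m * graph n => extend p.1 p.2)) //=.
exists (fun G : trajectory n m.+1 =>
  ([ffun i => G (widen_ord (leqnSn m.+1) i)], G ord_max)) => [[G E] _|G _] /=.
  congr pair; last exact: extend_max.
  by apply/ffunP => i; rewrite ffunE extend_widen.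
apply/ffunP => i; rewrite ffunE; case: unliftP => [j ->|-> //].
by rewrite ffunE; congr (G _); apply: val_inj; rewrite /= /bump leqNgt ltn_ord.
Qed.

Lemma trajectory_law_extend m (G : trajectory n m) E :
  trajectory_law R (extend G E) = trajectory_law R G * step R (G ord_max) E.
Proof.
rewrite /trajectory_law big_ord_recr /= -mulrA; congr (_ * _).
  have -> : ord0 = widen_ord (leqnSn m.+1) ord0 by apply: val_inj.
  by rewrite extend_widen.
congr (_ * _).
  apply: eq_bigr => i _; congr (step R _ _).
    rewrite -(extend_widen G E); congr (extend G E _); exact: val_inj.
  rewrite -(extend_widen G E); congr (extend G E _); exact: val_inj.
congr (step R _ _).
  rewrite -(extend_widen G E); congr (extend G E _); exact: val_inj.
rewrite -[RHS](extend_max G E); congr (extend G E _); exact: val_inj.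
Qed.

Lemma trajectory_law_ge0 m (G : trajectory n m) : 0 <= trajectory_law R G.
Proof.
by rewrite mulr_ge0 ?ler0n // prodr_ge0 // => i _; apply: step_ge0.
Qed.

Lemma sum_trajectory0 (F : trajectory n 0 -> R) :
  \sum_G trajectory_law R G * F G = F [ffun=> finset.set0].
Proof.
rewrite (bigD1 [ffun=> finset.set0]) //= big1 ?addr0.
  by rewrite /trajectory_law big_ord0 ffunE eqxx !mul1r.
move=> G neG; rewrite /trajectory_law big_ord0.
case: eqP => [G0|]; last by rewrite !mul0r.
case/eqP: neG; apply/ffunP => i; rewrite ffunE -G0; congr (G _).
by apply: val_inj; case: i => -[].
Qed.

Lemma sum_trajectory_law m : \sum_(G : trajectory n m) trajectory_law R G = 1.
Proof.
elim: m => [|m IH].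
  by have := sum_trajectory0 (fun=> 1); under eq_bigr do rewrite mulr1.
rewrite sum_trajectoryS -[RHS]IH; apply: eq_bigr => G _.
under eq_bigr do rewrite trajectory_law_extend.
by rewrite -mulr_sumr sum_step1 mulr1.
Qed.

Lemma Prob_compl m (A : pred (trajectory n m)) : Prob R A = 1 - Prob R (predC A).
Proof.
rewrite -(sum_trajectory_law m) (bigID A) /= /Prob; by rewrite addrK.
Qed.

(** Strictly before [m], as in the events at [m - 1]: the final state itself is left
    unconstrained. *)
Definition ok_before ok m (G : trajectory n m) : bool :=
  [forall k : 'I_m.+1, (k < m)%N ==> ok k (G k)].

Lemma ok_before_extend ok m (G : trajectory n m) E :
  ok_before ok (extend G E) = ok_before ok G && ok m (G ord_max).
Proof.
apply/forallP/andP => [H|[/forallP H okm] k].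
  have H' (i : 'I_m.+1) : ok i (G i).
    have := H (widen_ord (leqnSn m.+1) i); rewrite extend_widen /= ltn_ord.
    by [].
  by split; [apply/forallP => k; rewrite H' implybT|exact: (H' ord_max)].
apply/implyP; move=> km; have -> : k = widen_ord (leqnSn m.+1) (Ordinal km)
  by exact: val_inj.
rewrite extend_widen /=.
have /orP[/eqP kE|km'] : (k == m :> nat) || (k < m)%N by rewrite -leq_eqVlt.
  have -> : Ordinal km = ord_max by exact: val_inj.
  by rewrite kE.
by have := H (Ordinal km); rewrite /= km'.
Qed.

(* Optional-stopping form of the supermartingale inequality: [b k] is a
   supermartingale only at the states satisfying [ok k]. *)
Lemma supermartingale_bound m ok b :
  (forall k E, (k <= m)%N -> 0 <= b k E) ->
  (forall k E, (k < m)%N -> ok k E -> \sum_E' step R E E' * b k.+1 E' <= b k E) ->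
  \sum_(G : trajectory n m) trajectory_law R G * ((ok_before ok G)%:R * b m (G ord_max))
    <= b 0 finset.set0.
Proof.
elim: m => [|m IH] b0 bS.
  rewrite sum_trajectory0 ffunE; case: ok_before; rewrite ?mul1r ?mul0r //.
  exact: b0.
apply: le_trans (IH _ _); last 2 first.
- by move=> k E km; apply: b0; apply: leqW.
- by move=> k E km; apply: bS; apply: leqW.
rewrite sum_trajectoryS; apply: ler_sum => G _.
under eq_bigr do rewrite trajectory_law_extend ok_before_extend extend_max -mulrA.
rewrite -mulr_sumr ler_wpM2l ?trajectory_law_ge0 //.
case: ok_before => /=; last by rewrite big1 ?mul0r// => E _; rewrite mul0r mulr0.
case: (boolP (ok m (G ord_max))) => okm /=; last first.
  by rewrite mul1r big1 ?b0 // => E _; rewrite mul0r mulr0.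
rewrite mul1r; under eq_bigr do rewrite mul1r.
exact: bS.
Qed.

(** Markov's inequality at threshold 1 for the stopped supermartingale. *)
Lemma Prob_le_supermartingale m ok b (A : pred (trajectory n m)) :
  (forall k E, (k <= m)%N -> 0 <= b k E) ->
  (forall k E, (k < m)%N -> ok k E -> \sum_E' step R E E' * b k.+1 E' <= b k E) ->
  (forall G, A G -> ok_before ok G && (1 <= b m (G ord_max))) ->
  Prob R A <= b 0 finset.set0.
Proof.
move=> b0 bS AP; apply: le_trans (supermartingale_bound b0 bS).
rewrite /Prob big_mkcond; apply: ler_sum => G _.
case: ifP => [/AP/andP[-> b1]|_].
  by rewrite mul1r ler_peMr ?trajectory_law_ge0.
apply: mulr_ge0; first exact: trajectory_law_ge0.
by apply: mulr_ge0; rewrite ?ler0n ?b0.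
Qed.

End Chain.

(** * One step of the process *)

Section RealExpansions.
Variable R : realType.
Implicit Types (z rho alpha beta tau : R).

Lemma expR_le_quadratic z : `|z| <= 1 / 2 -> expR z <= 1 + z + 2 * z ^+ 2.
Proof.
move=> /ler_normlP[z1 z2].
have h : 1 - z <= expR (- z) by have := expR_ge1Dx (- z).
have h1 : 0 < 1 - z by lra.
have -> : expR z = (expR (- z))^-1 by rewrite expRN invrK.
apply: (@le_trans _ _ (1 - z)^-1); first by rewrite lef_pV2 // posrE expR_gt0.
rewrite -[leLHS]mul1r ler_pdivrMr //.
have -> : (1 + z + 2 * z ^+ 2) * (1 - z) = 1 + z ^+ 2 * (1 - 2 * z) by ring.
by rewrite lerDl mulr_ge0 ?sqr_ge0 //; lra.
Qed.

Lemma inv1B_expansion rho tau : 0 <= rho <= tau -> tau <= 1 / 100 ->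
  exists2 k, (1 - rho)^-1 = 1 + rho + k & 0 <= k <= 2 * tau ^+ 2.
Proof.
move=> /andP[r0 rt] t1; have h : 0 < 1 - rho by lra.
exists (rho ^+ 2 / (1 - rho)); first by field; lra.
apply/andP; split; first by rewrite divr_ge0 ?sqr_ge0 // ltW.
have rr : rho ^+ 2 <= tau ^+ 2 by nra.
rewrite ler_pdivrMr //; have := sqr_ge0 tau; nra.
Qed.

(** First-order expansion of the factor by which [A / Q^3] changes when [A] and [Q] are multiplied
    by [1 - alpha] and [1 - rho]. *)
Lemma quotient3_expansion alpha rho tau : 0 <= rho <= tau -> `|alpha| <= tau ->
  tau <= 1 / 100 ->
  `|(1 - alpha) / (1 - rho) ^+ 3 - 1 - (3 * rho - alpha)| <= 20 * tau ^+ 2.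
Proof.
move=> hr /ler_normlP[a1 a2] t1; have [k kE /andP[k0 k1]] := inv1B_expansion hr t1.
move/andP: hr => [r0 rt]; rewrite -exprVn kE.
have t2 : 0 <= tau ^+ 2 by exact: sqr_ge0.
have tt : tau ^+ 2 <= tau / 100 by nra.
(* [1 + a] is the inverse of [1 - rho]; the later [q] is the part of [(1 + a) ^ 3] beyond
   [1 + 3 rho]. *)
set a := rho + k; have a0 : 0 <= a by rewrite /a; lra.
have aT : a <= 103 / 100 * tau by rewrite /a; lra.
have a2' : a ^+ 2 <= 11 / 10 * tau ^+ 2 by nra.
have a3 : 0 <= a ^+ 3 <= tau ^+ 2.
  rewrite exprn_ge0 //= exprS; have : a * a ^+ 2 <= 1 * a ^+ 2.
    by rewrite ler_wpM2r ?sqr_ge0 //; lra.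
  have : a * a ^+ 2 <= 1 / 10 * a ^+ 2 by rewrite ler_wpM2r ?sqr_ge0 //; lra.
  lra.
set q := 3 * k + 3 * a ^+ 2 + a ^+ 3.
have q0 : 0 <= q by rewrite /q; have := sqr_ge0 a; move/andP: a3 => [? ?]; lra.
have q1 : q <= 11 * tau ^+ 2 by rewrite /q; move/andP: a3 => [? ?]; lra.
have -> : (1 - alpha) * (1 + rho + k) ^+ 3 - 1 - (3 * rho - alpha) =
  - (3 * alpha * rho) + (1 - alpha) * q by rewrite /q /a; ring.
have ar : - tau ^+ 2 <= alpha * rho <= tau ^+ 2 by apply/andP; split; nra.
move/andP: ar => [? ?].
have ? : (1 - alpha) * q <= 101 / 100 * q by rewrite ler_wpM2r //; lra.
have ? : 0 <= (1 - alpha) * q by rewrite mulr_ge0 //; lra.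
by apply/ler_normlP; split; lra.
Qed.

Lemma quotient2_expansion beta rho tau : 0 <= rho <= tau -> `|beta| <= tau ->
  tau <= 1 / 100 ->
  `|(1 + beta) / (1 - rho) ^+ 2 - 1 - (beta + 2 * rho)| <= 20 * tau ^+ 2.
Proof.
move=> hr /ler_normlP[a1 a2] t1; have [k kE /andP[k0 k1]] := inv1B_expansion hr t1.
move/andP: hr => [r0 rt]; rewrite -exprVn kE.
have t2 : 0 <= tau ^+ 2 by exact: sqr_ge0.
have tt : tau ^+ 2 <= tau / 100 by nra.
set a := rho + k; have a0 : 0 <= a by rewrite /a; lra.
have aT : a <= 103 / 100 * tau by rewrite /a; lra.
have a2' : a ^+ 2 <= 11 / 10 * tau ^+ 2 by nra.
set q := 2 * k + a ^+ 2.
have q0 : 0 <= q by rewrite /q; have := sqr_ge0 a; lra.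
have q1 : q <= 6 * tau ^+ 2 by rewrite /q; lra.
have -> : (1 + beta) * (1 + rho + k) ^+ 2 - 1 - (beta + 2 * rho) =
  2 * (beta * rho) + (1 + beta) * q by rewrite /q /a; ring.
have ar : - tau ^+ 2 <= beta * rho <= tau ^+ 2 by apply/andP; split; nra.
move/andP: ar => [? ?].
have ? : (1 + beta) * q <= 101 / 100 * q by rewrite ler_wpM2r //; lra.
have ? : 0 <= (1 + beta) * q by rewrite mulr_ge0 //; lra.
by apply/ler_normlP; split; lra.
Qed.

Lemma ln1B_expansion rho tau : 0 <= rho <= tau -> tau <= 1 / 100 ->
  `|ln (1 - rho) + rho| <= 2 * tau ^+ 2.
Proof.
move=> hr t1; have [k kE /andP[k0 k1]] := inv1B_expansion hr t1.
move/andP: hr => [r0 rt]; have h : 0 < 1 - rho by lra.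
have l1 : ln (1 - rho) <= - rho by have := @le_ln1Dx R (- rho); lra.
have l2 : ln (1 - rho)^-1 <= rho + k.
  by rewrite kE -addrA; apply: le_ln1Dx; lra.
rewrite lnV ?posrE // in l2.
by apply/ler_normlP; split; lra.
Qed.

End RealExpansions.

(** * Averages over a finite set *)

Section Mean.
Variables (R : realType) (T : finType) (Op : {set T}).
Hypothesis O0 : 0 < #|Op|%:R :> R.
Implicit Types (F G X Y : T -> R).

Definition mean F : R := (\sum_(e in Op) F e) / #|Op|%:R.

Lemma meanD F G : mean (fun e => F e + G e) = mean F + mean G.
Proof. by rewrite /mean big_split mulrDl. Qed.

Lemma meanZ a F : mean (fun e => a * F e) = a * mean F.
Proof. by rewrite /mean -mulr_sumr mulrA. Qed.

Lemma mean_cst a : mean (fun=> a) = a.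
Proof. by rewrite /mean sumr_const -[X in X / _]mulr_natr mulfK ?gt_eqF. Qed.

Lemma eq_mean F G : (forall e, e \in Op -> F e = G e) -> mean F = mean G.
Proof. by move=> FG; congr (_ / _); apply: eq_bigr. Qed.

Lemma ler_mean F G : (forall e, e \in Op -> F e <= G e) -> mean F <= mean G.
Proof. by move=> FG; apply: ler_wpM2r; [rewrite invr_ge0 ltW|apply: ler_sum]. Qed.

Lemma mean_near F a c : (forall e, e \in Op -> `|F e - a| <= c) -> `|mean F - a| <= c.
Proof.
move=> Fc; have h e : e \in Op -> a - c <= F e <= a + c.
  by move=> /Fc/ler_normlP[? ?]; apply/andP; split; lra.
have l : mean (fun=> a - c) <= mean F by apply: ler_mean => e /h/andP[].
have u : mean F <= mean (fun=> a + c) by apply: ler_mean => e /h/andP[].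
by rewrite !mean_cst in l u; apply/ler_normlP; split; lra.
Qed.

Lemma mean_abs_le F c : (forall e, e \in Op -> `|F e| <= c) -> `|mean F| <= c.
Proof.
by move=> Fc; rewrite -[mean F]subr0; apply: mean_near => e eO; rewrite subr0 Fc.
Qed.

(** Covariance is unchanged by shifting [X] by [x] and [Y] by [y]; both terms left after centring
    are at most [a b]. *)
Lemma mean_covariance X Y x y a b :
  (forall e, e \in Op -> `|X e - x| <= a) ->
  (forall e, e \in Op -> `|Y e - y| <= b) ->
  `|mean (fun e => X e * Y e) - mean X * mean Y| <= 2 * (a * b).
Proof.
move=> hX hY; have mX := mean_near hX; have mY := mean_near hY.
have -> : mean (fun e => X e * Y e) - mean X * mean Y =
   mean (fun e => (X e - x) * (Y e - y)) - (mean X - x) * (mean Y - y).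
  rewrite (@eq_mean (fun e => (X e - x) * (Y e - y))
    (fun e => X e * Y e + ((- y) * X e + ((- x) * Y e + x * y)))); last first.
    by move=> e _; ring.
  by rewrite !meanD !meanZ mean_cst; ring.
rewrite (le_trans (ler_normB _ _)) // mulr_natl mulr2n lerD //.
  by apply: mean_abs_le => e eO; rewrite normrM ler_pM // ?hX ?hY.
by rewrite normrM ler_pM.
Qed.

Lemma mean_expR F s c d : 0 <= s -> s * c <= 1 / 2 ->
  (forall e, e \in Op -> `|F e| <= c) -> mean F <= d ->
  mean (fun e => expR (s * F e)) <= expR (s * d + 2 * (s * c) ^+ 2).
Proof.
move=> s0 sc Fc Fd; apply: le_trans (expR_ge1Dx _).
apply: (@le_trans _ _ (mean (fun e => (1 + 2 * (s * c) ^+ 2) + s * F e))).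
  apply: ler_mean => e /Fc Fe.
  have h : `|s * F e| <= s * c by rewrite normrM ger0_norm // ler_wpM2l.
  apply: (le_trans (expR_le_quadratic (le_trans h sc))).
  have : (s * F e) ^+ 2 <= (s * c) ^+ 2.
    by rewrite -[leLHS]real_normK ?num_real // ler_pXn2r ?nnegrE ?(le_trans _ h).
  lra.
rewrite meanD mean_cst meanZ; have := ler_wpM2l s0 Fd; lra.
Qed.

End Mean.

(** * Drift and size of one step, stated for functions on a finite set *)

Section OneStep.
Variables (R : realType) (T : finType) (Op : {set T}).
Variables (X Y PX PY : T -> R) (x y g tau t nu U V : R).
Let Q : R := #|Op|%:R.
Let mX := mean Op X.
Let mY := mean Op Y.
Hypotheses (Q0 : 0 < Q) (x0 : 0 < x) (y1 : 1 <= y) (g0 : 0 <= g <= 1 / 10).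
Hypotheses (hX : forall e, e \in Op -> `|X e - x| <= g * x)
           (hY : forall e, e \in Op -> `|Y e - y| <= g * y).
Hypotheses (hP : forall e, e \in Op -> 0 <= PX e <= 121 / 100 * (x * y))
           (hS : forall e, e \in Op -> 0 <= PY e <= 121 / 100 * (y * y)).
Hypotheses (mP : mean Op PX = mean Op (fun e => X e * Y e))
           (mS : mean Op PY = mean Op (fun e => Y e * Y e)).
Hypotheses (tauY : 8 * y <= tau * Q) (tauX : 2 * x <= tau * (y * Q)).
Hypotheses (tau1 : tau <= 1 / 100) (nu0 : 0 <= nu <= tau) (t1 : 1 <= t).
Hypotheses (U0 : 0 <= U <= 2) (V0 : 0 <= V <= 2 * t).
Hypotheses (VU : V * (mX / (Q * mY)) = nu * U) (VY : mY / Q = 8 * nu * V).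

(* [lra] ignores section hypotheses, hence the copies. *)
Local Ltac slra := have ? := x0; have ? := y1; have ? := t1; have ? := tauY;
  have ? := tauX; have ? := tau1; lra.

(** Relative changes: adding [e] multiplies [Q], [A = Q mX] and [B = Q mY] by [1 - rho], [1 - alpha]
    and [1 + beta]. *)
Definition step_rho e := (1 + Y e) / Q.
Definition step_alpha e := 3 * (X e + PX e) / (Q * mX).
Definition step_beta e := (X e - 2 * PY e) / (Q * mY).
Definition step_dU e := U * ((1 - step_alpha e) / (1 - step_rho e) ^+ 3 - 1).
Definition step_dV e := V * ((1 + step_beta e) / (1 - step_rho e) ^+ 2 - 1).
Definition step_dL e := ln (1 - step_rho e).
(** One bound for all three drifts: [2 / Q] comes from the edge [e] itself, [g ^ 2 tau] from the
    covariances, [20 tau ^ 2] from the second-order terms, and [4 t] dominates the prefactors [U],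
    [V] and 1. *)
Definition step_theta := 4 * t * (2 / Q + g ^+ 2 * tau + 20 * tau ^+ 2).

Let xb e : e \in Op -> 9 / 10 * x <= X e <= 11 / 10 * x.
Proof.
move=> /hX/ler_normlP[? ?]; have /andP[? ?] := g0.
have : g * x <= 1 / 10 * x by rewrite ler_wpM2r // ltW.
by move=> ?; apply/andP; split; slra.
Qed.

Let yb e : e \in Op -> 9 / 10 * y <= Y e <= 11 / 10 * y.
Proof.
move=> /hY/ler_normlP[? ?]; have /andP[? ?] := g0.
have : g * y <= 1 / 10 * y by rewrite ler_wpM2r //; slra.
by move=> ?; apply/andP; split; slra.
Qed.

Let mXb : 9 / 10 * x <= mX.
Proof.
have /ler_normlP[? ?] := mean_near Q0 hX; have /andP[? ?] := g0.
have : g * x <= 1 / 10 * x by rewrite ler_wpM2r // ltW.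
by rewrite /mX; slra.
Qed.

Let mYb : 9 / 10 * y <= mY.
Proof.
have /ler_normlP[? ?] := mean_near Q0 hY; have /andP[? ?] := g0.
have : g * y <= 1 / 10 * y by rewrite ler_wpM2r //; slra.
by rewrite /mY; slra.
Qed.
Local Ltac slra ::= have ? := x0; have ? := y1; have ? := t1; have ? := tauY;
  have ? := tauX; have ? := tau1; have ? := mXb; have ? := mYb; lra.

Let mX0 : 0 < mX. Proof. by apply: lt_le_trans mXb; slra. Qed.
Let mY0 : 0 < mY. Proof. by apply: lt_le_trans mYb; slra. Qed.
Let QX0 : 0 < Q * mX. Proof. exact: mulr_gt0. Qed.
Let QY0 : 0 < Q * mY. Proof. exact: mulr_gt0. Qed.
Let tau0 : 0 <= tau. Proof. by case/andP: nu0 => ? ?; slra. Qed.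
Local Ltac slra ::= have ? := x0; have ? := y1; have ? := t1; have ? := tauY;
  have ? := tauX; have ? := tau1; have ? := mXb; have ? := mYb; have ? := tau0; lra.

Let rho_bound e : e \in Op -> 0 <= step_rho e <= tau.
Proof.
move=> /yb/andP[y2 y3]; rewrite /step_rho; apply/andP; split.
  by rewrite divr_ge0 // ?ltW //; slra.
by rewrite ler_pdivrMr //; slra.
Qed.

Let alpha_bound e : e \in Op -> 0 <= step_alpha e <= tau.
Proof.
move=> eO; have /andP[x2 x3] := xb eO; have /andP[P1 P2] := hP eO.
rewrite /step_alpha; apply/andP; split; first by rewrite divr_ge0 ?(ltW QX0) //; slra.
rewrite ler_pdivrMr // mulrA.
have h : x <= x * y by rewrite ler_peMr // ltW.
have h1 : 8 * y * (9 / 10 * x) <= tau * Q * mX by rewrite ler_pM //; slra.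
slra.
Qed.

Let beta_bound e : e \in Op -> `|step_beta e| <= tau.
Proof.
move=> eO; have /andP[x2 x3] := xb eO; have /andP[S1 S2] := hS eO.
rewrite /step_beta normrM [`|_^-1|]gtr0_norm ?invr_gt0 // ler_pdivrMr // mulrA.
have h1 : 8 * y * (9 / 10 * y) <= tau * Q * mY by rewrite ler_pM //; slra.
have h2 : 9 / 10 * (tau * (y * Q)) <= tau * Q * mY.
  have -> : 9 / 10 * (tau * (y * Q)) = tau * Q * (9 / 10 * y) by ring.
  by rewrite ler_wpM2l // mulr_ge0 // ltW.
by apply/ler_normlP; split; slra.
Qed.

Let g2tau : 0 <= g ^+ 2 * tau. Proof. by rewrite mulr_ge0 ?sqr_ge0. Qed.
Let g2y : 8 * (g ^+ 2 * y) <= g ^+ 2 * tau * Q.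
Proof. by have := ler_wpM2l (sqr_ge0 g) tauY; slra. Qed.
Local Ltac slra ::= have ? := x0; have ? := y1; have ? := t1; have ? := tauY;
  have ? := tauX; have ? := tau1; have ? := mXb; have ? := mYb; have ? := tau0; have ? :=
    g2tau; have ? := g2y; lra.

(** The contributions [3 / Q] of [e] itself cancel, and what remains is exactly
    [- 3 cov(X, Y) / (Q mX)]. This is why [A] is divided by the cube of [Q]. *)
Lemma mean_lin1 : `|mean Op (fun e => 3 * step_rho e - step_alpha e)| <= g ^+ 2 * tau.
Proof.
have cov := mean_covariance Q0 hX hY; rewrite -/mX -/mY -mP in cov.
have -> : mean Op (fun e => 3 * step_rho e - step_alpha e) =
  - (3 * (mean Op PX - mX * mY) / (Q * mX)).
  rewrite (@eq_mean _ _ _ _ (fun e => 3 / Q + (3 / Q * Y e +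
     (- (3 / (Q * mX)) * X e + - (3 / (Q * mX)) * PX e)))).
    rewrite !meanD !meanZ (mean_cst Q0) -/mX -/mY; field.
    by rewrite !gt_eqF.
  by move=> e _; rewrite /step_rho /step_alpha; ring.
rewrite normrN normrM [`|_^-1|]gtr0_norm ?invr_gt0 // ler_pdivrMr // normrM.
rewrite [`|3|]ger0_norm //.
have h : g ^+ 2 * tau * Q * (9 / 10 * x) <= g ^+ 2 * tau * Q * mX.
  by rewrite ler_wpM2l // mulr_ge0 // ltW.
have h2 : 8 * (g ^+ 2 * y) * (9 / 10 * x) <= g ^+ 2 * tau * Q * (9 / 10 * x).
  by rewrite ler_wpM2r //; slra.
have h3 : 0 <= g ^+ 2 * y * x.
  by apply: mulr_ge0; [apply: mulr_ge0; [exact: sqr_ge0|slra]|slra].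
rewrite (mulrA _ Q); apply: le_trans (le_trans h2 h).
apply: (le_trans (ler_wpM2l _ cov)) => //; lra.
Qed.

(** Here the [2 / Q] due to [e] does not cancel; the other error is [2 var(Y) / (Q mY)]. *)
Lemma mean_lin2 : `|mean Op (fun e => step_beta e + 2 * step_rho e) - mX / (Q * mY)|
  <= 2 / Q + g ^+ 2 * tau.
Proof.
have cov := mean_covariance Q0 hY hY; rewrite -/mY -mS in cov.
have -> : mean Op (fun e => step_beta e + 2 * step_rho e) - mX / (Q * mY) =
  2 / Q - (2 * (mean Op PY - mY * mY) / (Q * mY)).
  rewrite (@eq_mean _ _ _ _ (fun e => 2 / Q + (2 / Q * Y e +
     ((Q * mY)^-1 * X e + - (2 / (Q * mY)) * PY e)))).
    rewrite !meanD !meanZ (mean_cst Q0) -/mX -/mY; field.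
    by rewrite !gt_eqF.
  by move=> e _; rewrite /step_rho /step_beta; ring.
rewrite (le_trans (ler_normB _ _)) // lerD //.
  by rewrite ger0_norm // divr_ge0 // ltW.
rewrite normrM [`|_^-1|]gtr0_norm ?invr_gt0 // ler_pdivrMr // normrM.
rewrite [`|2|]ger0_norm //.
have h : g ^+ 2 * tau * Q * (9 / 10 * y) <= g ^+ 2 * tau * Q * mY.
  by rewrite ler_wpM2l // mulr_ge0 // ltW.
have h2 : 8 * (g ^+ 2 * y) * (9 / 10 * y) <= g ^+ 2 * tau * Q * (9 / 10 * y).
  by rewrite ler_wpM2r //; slra.
have h3 : 0 <= g ^+ 2 * y * y.
  by apply: mulr_ge0; [apply: mulr_ge0; [exact: sqr_ge0|slra]|slra].
rewrite (mulrA _ Q); apply: le_trans (le_trans h2 h).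
apply: (le_trans (ler_wpM2l _ cov)) => //; lra.
Qed.

Lemma mean_rho : mean Op step_rho = Q^-1 + 8 * nu * V.
Proof.
rewrite (@eq_mean _ _ _ _ (fun e => Q^-1 + Q^-1 * Y e)).
  by rewrite meanD meanZ (mean_cst Q0) -VY [in RHS]mulrC.
by move=> e _; rewrite /step_rho; ring.
Qed.

Let tau2 : 0 <= tau ^+ 2. Proof. exact: sqr_ge0. Qed.
Let tau2' : tau ^+ 2 <= tau / 100. Proof. by have := tau0; have := tau1; nra. Qed.
Let Qi : 0 < Q^-1. Proof. by rewrite invr_gt0. Qed.
Local Ltac slra ::= have ? := x0; have ? := y1; have ? := t1; have ? := tauY;
  have ? := tauX; have ? := tau1; have ? := mXb; have ? := mYb; have ? := tau0; have ? :=
    g2tau; have ? := g2y; have ? := tau2; have ? := tau2'; have ? := Qi; lra.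

Lemma mean_dU : `|mean Op step_dU| <= step_theta.
Proof.
have h e : e \in Op -> `|step_dU e - U * (3 * step_rho e - step_alpha e)| <= U * (20 *
  tau ^+ 2).
  move=> eO; rewrite /step_dU -mulrBr normrM ger0_norm; last by case/andP: U0.
  apply: ler_wpM2l; first by case/andP: U0.
  apply: quotient3_expansion => //; first exact: rho_bound.
  by have /andP[? ?] := alpha_bound eO; rewrite ger0_norm.
have := mean_abs_le Q0 h.
rewrite (@eq_mean _ _ _ _ (fun e => step_dU e + (- U) * (3 * step_rho e - step_alpha
  e))); last first.
  by move=> e _; ring.
rewrite meanD [X in _ + X]meanZ => /ler_normlP[h1 h2]; have /ler_normlP[h3 h4] := mean_lin1.
have /andP[? ?] := U0.
have Up : 0 <= U by case/andP: U0.
have u1 := ler_wpM2l Up h3; have u2 := ler_wpM2l Up h4.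
have k : U * (g ^+ 2 * tau + 20 * tau ^+ 2) <= step_theta.
  by rewrite /step_theta; apply: ler_pM; slra.
apply/ler_normlP; split; lra.
Qed.

Lemma mean_dV : `|mean Op step_dV - nu * U| <= step_theta.
Proof.
have /andP[? ?] := V0.
have h e : e \in Op -> `|step_dV e - V * (step_beta e + 2 * step_rho e)| <= V * (20 * tau
  ^+ 2).
  move=> eO; rewrite /step_dV -mulrBr normrM ger0_norm //.
  apply: ler_wpM2l => //.
  apply: quotient2_expansion => //; first exact: rho_bound.
  exact: beta_bound.
have := mean_abs_le Q0 h.
rewrite (@eq_mean _ _ _ _ (fun e => step_dV e + (- V) * (step_beta e + 2 * step_rho e)));
  last first.
  by move=> e _; ring.
rewrite meanD [X in _ + X]meanZ => /ler_normlP[h1 h2]; have /ler_normlP[h3 h4] := mean_lin2.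
have Vp : 0 <= V by case/andP: V0.
have u1 := ler_wpM2l Vp h3; have u2 := ler_wpM2l Vp h4.
have k : V * (2 / Q + g ^+ 2 * tau + 20 * tau ^+ 2) <= step_theta.
  by rewrite /step_theta; apply: ler_wpM2r; slra.
rewrite -VU; apply/ler_normlP; split; lra.
Qed.

Lemma mean_dL : `|mean Op step_dL + 8 * nu * V| <= step_theta.
Proof.
have h e : e \in Op -> `|step_dL e + step_rho e| <= 2 * tau ^+ 2.
  by move=> eO; apply: ln1B_expansion => //; apply: rho_bound.
have := mean_abs_le Q0 h; rewrite meanD mean_rho => /ler_normlP[h1 h2].
have k : 1 * (2 / Q + g ^+ 2 * tau + 20 * tau ^+ 2) <= step_theta.
  by rewrite /step_theta; apply: ler_wpM2r; slra.
apply/ler_normlP; split; slra.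
Qed.

Lemma dU_bound e : e \in Op -> `|step_dU e| <= 10 * tau.
Proof.
move=> eO; have /andP[r0 r1] := rho_bound eO; have /andP[a0 a1] := alpha_bound eO.
have /ler_normlP[] : `|(1 - step_alpha e) / (1 - step_rho e) ^+ 3 - 1 - (3 * step_rho e -
  step_alpha e)|
    <= 20 * tau ^+ 2.
  by apply: quotient3_expansion; rewrite ?ger0_norm // r0.
rewrite /step_dU; set w := _ / _ - 1 => h1 h2; have /andP[? ?] := U0.
have w1 : `|w| <= 5 * tau by apply/ler_normlP; split; slra.
rewrite normrM ger0_norm //.
have -> : 10 * tau = 2 * (5 * tau) by ring.
by rewrite ler_pM.
Qed.

Lemma dV_bound e : e \in Op -> `|step_dV e| <= 8 * t * tau.
Proof.
move=> eO; have /andP[r0 r1] := rho_bound eO; have bb := beta_bound eO.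
have /ler_normlP[] : `|(1 + step_beta e) / (1 - step_rho e) ^+ 2 - 1 - (step_beta e + 2 *
  step_rho e)|
    <= 20 * tau ^+ 2.
  by apply: quotient2_expansion; rewrite // r0.
move/ler_normlP: bb => [b1 b2].
rewrite /step_dV; set w := _ / _ - 1 => h1 h2; have /andP[? ?] := V0.
have w1 : `|w| <= 4 * tau by apply/ler_normlP; split; slra.
rewrite normrM ger0_norm //.
have -> : 8 * t * tau = (2 * t) * (4 * tau) by ring.
by rewrite ler_pM.
Qed.

Lemma dL_bound e : e \in Op -> `|step_dL e| <= 2 * tau.
Proof.
move=> eO; have rb := rho_bound eO; have /andP[r0 r1] := rb.
have /ler_normlP[] : `|step_dL e + step_rho e| <= 2 * tau ^+ 2 by exact: ln1B_expansion.
by move=> h1 h2; apply/ler_normlP; split; slra.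
Qed.

(** Exact increments of [V - t U] and [ln Q + 8 t V - 4 t (t + nu) U] as [t] becomes [t + nu]. The
    product [t (t + nu)] in place of [t ^ 2] makes the terms in [nu U] cancel on average without a
    discretisation error. *)
Definition step_dW2 e := step_dV e - (t + nu) * step_dU e - nu * U.
Definition step_dW3 e := step_dL e + 8 * (t + nu) * step_dV e + 8 * nu * V
  - 4 * (t + nu) * (t + 2 * nu) * step_dU e - 8 * (t + nu) * nu * U.

Lemma theta_ge0 : 0 <= step_theta.
Proof. by apply: le_trans mean_dU. Qed.

Let tt1 : t <= t ^+ 2. Proof. by have := t1; nra. Qed.
Local Ltac slra ::= have ? := x0; have ? := y1; have ? := t1; have ? := tauY;
  have ? := tauX; have ? := tau1; have ? := mXb; have ? := mYb; have ? := tau0; have ? :=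
    g2tau; have ? := g2y; have ? := tau2; have ? := tau2'; have ? := Qi; have ? := tt1; lra.

Let normM_le (a b c d : R) : 0 <= a -> a <= c -> `|b| <= d -> `|a * b| <= c * d.
Proof.
by move=> a0 ac bd; rewrite normrM ger0_norm // ler_pM.
Qed.

Lemma mean_dU_le : `|mean Op step_dU| <= 40 * t ^+ 2 * step_theta.
Proof.
apply: le_trans mean_dU _; rewrite ler_peMl ?theta_ge0 //.
have := t1; have := tt1; slra.
Qed.

Lemma mean_dW2_le : `|mean Op step_dW2| <= 40 * t ^+ 2 * step_theta.
Proof.
rewrite /step_dW2 (@eq_mean _ _ _ _ (fun e => step_dV e + ((- (t + nu)) * step_dU e + -
  (nu * U)))); last first.
  by move=> e _; ring.
rewrite !meanD (meanZ Op (- (t + nu)) step_dU) (mean_cst Q0).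
have h1 := mean_dV; have th := theta_ge0; have /andP[? ?] := nu0; have := t1 => ?.
have h2 : `|(t + nu) * mean Op step_dU| <= (2 * t) * step_theta.
  by have := tau1 => ?; apply: normM_le mean_dU => //; lra.
move/ler_normlP: h1 => [? ?]; move/ler_normlP: h2 => [? ?].
have h3 := ler_wpM2r th tt1; have h4 := ler_wpM2r th t1.
by apply/ler_normlP; split; lra.
Qed.

Lemma mean_dW3_le : `|mean Op step_dW3| <= 40 * t ^+ 2 * step_theta.
Proof.
rewrite /step_dW3 (@eq_mean _ _ _ _ (fun e => step_dL e + (8 * (t + nu) * step_dV e +
   ((- (4 * (t + nu) * (t + 2 * nu))) * step_dU e + (8 * nu * V - 8 * (t + nu) * nu *
     U)))));
  last first.
  by move=> e _; ring.
rewrite !meanD (meanZ Op (8 * (t + nu)) step_dV) (meanZ Op _ step_dU) !(mean_cst Q0).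
have h0 := mean_dL; have th := theta_ge0; have /andP[? ?] := nu0; have := t1 => ?.
have h1 : `|8 * (t + nu) * (mean Op step_dV - nu * U)| <= (16 * t) * step_theta.
  by apply: normM_le mean_dV; slra.
have := tau1 => ?.
have tn : (t + nu) * (t + 2 * nu) <= (11 / 10 * t) * (11 / 10 * t)
  by rewrite ler_pM //; lra.
have tn0 : 0 <= (t + nu) * (t + 2 * nu) by rewrite mulr_ge0 //; lra.
have h2 : `|4 * (t + nu) * (t + 2 * nu) * mean Op step_dU| <= (5 * t ^+ 2) * step_theta.
  by apply: normM_le mean_dU; have := sqr_ge0 t; lra.
move/ler_normlP: h0 => [? ?]; move/ler_normlP: h1 => [? ?]; move/ler_normlP: h2 => [? ?].
have h3 := ler_wpM2r th tt1; have h4 := ler_wpM2r th t1.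
by apply/ler_normlP; split; lra.
Qed.

Let t2tau : tau <= t * tau /\ t * tau <= t ^+ 2 * tau.
Proof. by split; [have := ler_wpM2r tau0 t1|have := ler_wpM2r tau0 tt1]; slra. Qed.

Lemma dU_le e : e \in Op -> `|step_dU e| <= 400 * t ^+ 2 * tau.
Proof.
by move=> /dU_bound h; apply: le_trans h _; have [? ?] := t2tau; have := tau0; slra.
Qed.

Lemma dW2_le e : e \in Op -> `|step_dW2 e| <= 400 * t ^+ 2 * tau.
Proof.
move=> eO; have /andP[n0 n1] := nu0; have := t1 => ?.
have h1 : `|(t + nu) * step_dU e| <= (2 * t) * (10 * tau).
  by apply: normM_le (dU_bound eO); slra.
have h2 : `|nu * U| <= tau * 2.
  by case/andP: U0 => ? ?; apply: normM_le => //; rewrite ger0_norm.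
have := dV_bound eO; rewrite /step_dW2 => /ler_normlP[? ?].
move/ler_normlP: h1 => [? ?]; move/ler_normlP: h2 => [? ?]; have [? ?] := t2tau.
by have := tau0 => ?; apply/ler_normlP; split; lra.
Qed.

Lemma dW3_le e : e \in Op -> `|step_dW3 e| <= 400 * t ^+ 2 * tau.
Proof.
move=> eO; have /andP[n0 n1] := nu0; have := t1 => ?.
have := tau1 => ?.
have tn : (t + nu) * (t + 2 * nu) <= (11 / 10 * t) * (11 / 10 * t)
  by rewrite ler_pM //; lra.
have tn0 : 0 <= (t + nu) * (t + 2 * nu) by rewrite mulr_ge0 //; lra.
have h1 : `|4 * (t + nu) * (t + 2 * nu) * step_dU e| <= (5 * t ^+ 2) * (10 * tau).
  by apply: normM_le (dU_bound eO); have := sqr_ge0 t; lra.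
have h2 : `|8 * (t + nu) * step_dV e| <= (16 * t) * (8 * t * tau).
  by apply: normM_le (dV_bound eO); lra.
have h3 : `|8 * nu * V| <= (8 * tau) * (2 * t).
  by case/andP: V0 => ? ?; apply: normM_le; rewrite ?ger0_norm //; lra.
have h4 : `|8 * (t + nu) * (nu * U)| <= (16 * t) * (tau * 2).
  apply: normM_le; [lra|lra|].
  by case/andP: U0 => ? ?; apply: normM_le => //; rewrite ger0_norm.
have := dL_bound eO; rewrite /step_dW3 => /ler_normlP[? ?].
move/ler_normlP: h1 => [? ?]; move/ler_normlP: h2 => [? ?].
move/ler_normlP: h3 => [? ?]; move/ler_normlP: h4 => [? ?]; have [? ?] := t2tau.
by have := tau0 => ?; apply/ler_normlP; split; lra.
Qed.

Definition step_dW (i : nat) e :=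
  match i with 0%N => step_dU e | 1%N => step_dW2 e | _ => step_dW3 e end.

Lemma step_dW_bounds :
  [/\ forall i e, e \in Op -> `|step_dW i e| <= 400 * t ^+ 2 * tau,
      forall i, `|mean Op (step_dW i)| <= 40 * t ^+ 2 * step_theta &
      forall e, e \in Op -> step_rho e < 1].
Proof.
split=> [[|[|i]] e /=|[|[|i]]|e eO].
- exact: dU_le.
- exact: dW2_le.
- exact: dW3_le.
- exact: mean_dU_le.
- exact: mean_dW2_le.
- exact: mean_dW3_le.
- by have /andP[_ h] := rho_bound eO; apply: le_lt_trans h _; slra.
Qed.

End OneStep.

(** * The near-martingales of the graph process *)

Section Martingales.
Variables (R : realType) (n : nat) (N : R).
Hypothesis N0 : 0 < N.
Implicit Types (E : graph n) (e : {set 'I_n}) (t : R).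

(* Normalised so that, along the heuristic trajectory, [Uf] is 1 and [Vf] is the
   time [t]. *)
Definition Uf E : R := SX R E * N ^+ 2 / (8 * Qn R E ^+ 3).
Definition Vf E : R := SY R E * N / (8 * Qn R E ^+ 2).

(* Three near-martingales: the drift of [Uf] vanishes, that of [Vf] is [Uf / N],
   and that of [ln Qn] is [- 8 * Vf / N]. *)
Definition Wf (i : nat) t E : R :=
  match i with
  | 0%N => Uf E
  | 1%N => Vf E - t * Uf E
  | _ => ln (Qn R E) + 8 * t * Vf E - 4 * t * (t + N^-1) * Uf E
  end.

Local Notation Xr E := (fun e => (Xcount E e)%:R : R).
Local Notation Yr E := (fun e => (Ycount E e)%:R : R).
Local Notation PX E := (fun e => \sum_(f in Yset E e) (Xcount E f)%:R : R).
Local Notation PY E := (fun e => \sum_(f in Yset E e) (Ycount E f)%:R : R).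

Lemma Wf_add E e t i : valid E -> e \in open_edges E ->
  0 < Qn R E -> 0 < SX R E -> 0 < SY R E ->
  step_rho (open_edges E) (Yr E) e < 1 ->
  Wf i (t + N^-1) (e |: E)%SET - Wf i t E =
  step_dW (open_edges E) (Xr E) (Yr E) (PX E) (PY E) t N^-1 (Uf E) (Vf E) i e.
Proof.
move=> vE eO Q0 A0 B0; set r := step_rho _ _ _ => r1.
have Q1 : Qn R (e |: E)%SET = Qn R E * (1 - r).
  rewrite (Qn_add R vE eO) /r /step_rho -/(Qn R E); field; exact: lt0r_neq0.
have r0 : 1 - r != 0 by apply: lt0r_neq0; lra.
have Qn0 := lt0r_neq0 Q0; have An0 := lt0r_neq0 A0; have Bn0 := lt0r_neq0 B0.
have Nn0 := lt0r_neq0 N0.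
have mX : mean (open_edges E) (Xr E) = SX R E / Qn R E by [].
have mY : mean (open_edges E) (Yr E) = SY R E / Qn R E by [].
have U1 : Uf (e |: E)%SET =
    Uf E + step_dU (open_edges E) (Xr E) (Yr E) (PX E) (Uf E) e.
  rewrite /step_dU -/r /step_alpha -/(Qn R E) mX /Uf (SX_add R vE eO) Q1.
  by field; rewrite r0 An0 Qn0.
have V1 : Vf (e |: E)%SET =
    Vf E + step_dV (open_edges E) (Xr E) (Yr E) (PY E) (Vf E) e.
  rewrite /step_dV -/r /step_beta -/(Qn R E) mY /Vf (SY_add R vE eO) Q1.
  by field; rewrite r0 Bn0 Qn0.
have L1 : ln (Qn R (e |: E)%SET) = ln (Qn R E) + step_dL (open_edges E) (Yr E) e.
  by rewrite Q1 lnM ?posrE //; lra.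
case: i => [|[|i]] /=.
- by rewrite U1 addrC addKr.
- by rewrite /step_dW2 U1 V1; ring.
- by rewrite /step_dW3 U1 V1 L1; ring.
Qed.

Lemma VU_identity E : 0 < Qn R E -> 0 < SY R E ->
  Vf E * (mean (open_edges E) (Xr E) / (Qn R E * mean (open_edges E) (Yr E))) =
  N^-1 * Uf E.
Proof.
move=> Q0 B0; rewrite /mean -/(SX R E) -/(SY R E) -/(Qn R E) /Uf /Vf.
by field; rewrite !lt0r_neq0.
Qed.

Lemma VY_identity E : 0 < Qn R E ->
  mean (open_edges E) (Yr E) / Qn R E = 8 * N^-1 * Vf E.
Proof.
move=> Q0; rewrite /mean -/(SY R E) -/(Qn R E) /Vf.
by field; rewrite !lt0r_neq0.
Qed.

Definition near_counts E (x y g : R) := forall e, e \in open_edges E ->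
  `|(Xcount E e)%:R - x| <= g * x /\ `|(Ycount E e)%:R - y| <= g * y.

(** The two hypotheses with [8 * y] and [2 * x] say that [tau] dominates the relative changes
    [Y / Q] of [Q] and [X / (Y Q)] of [B]. The factor [160 t ^ 3] is [40 t ^ 2] times the [4 t] of
    [step_theta]. *)
Lemma Wf_step_bounds E (t x y g tau : R) : valid E ->
  0 < Qn R E -> 0 < x -> 1 <= y -> 0 <= g <= 1 / 10 -> near_counts E x y g ->
  8 * y <= tau * Qn R E -> 2 * x <= tau * (y * Qn R E) ->
  tau <= 1 / 100 -> N^-1 <= tau -> 1 <= t ->
  Uf E <= 2 -> Vf E <= 2 * t ->
  let F i e := Wf i (t + N^-1) (e |: E)%SET - Wf i t E in
  (forall i e, e \in open_edges E -> `|F i e| <= 400 * t ^+ 2 * tau) /\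
  (forall i, `|mean (open_edges E) (F i)| <=
     160 * t ^+ 3 * (2 / Qn R E + g ^+ 2 * tau + 20 * tau ^+ 2)).
Proof.
move=> vE Q0 x0 y1 g01 nc tY tX tau1 nutau t1 U2 V2 F.
have /andP[g0 g1] := g01.
have hX e : e \in open_edges E -> `|(Xcount E e)%:R - x| <= g * x by move=> /nc[].
have hY e : e \in open_edges E -> `|(Ycount E e)%:R - y| <= g * y by move=> /nc[].
have gx : g * x <= 1 / 10 * x by rewrite ler_wpM2r // ltW.
have gy : g * y <= 1 / 10 * y by rewrite ler_wpM2r //; lra.
have Xb e : e \in open_edges E -> 0 < ((Xcount E e)%:R : R) <= 11 / 10 * x.
  by move=> /hX/ler_normlP[? ?]; apply/andP; split; lra.
have Yb e : e \in open_edges E -> 0 < ((Ycount E e)%:R : R) <= 11 / 10 * y.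
  by move=> /hY/ler_normlP[? ?]; apply/andP; split; lra.
have YO e f : f \in Yset E e -> f \in open_edges E by case/YsetP.
have [e0 e0O] : exists e, e \in open_edges E.
  by apply/set0Pn; rewrite -cards_eq0 -(pnatr_eq0 R) lt0r_neq0.
have A0 : 0 < SX R E.
  rewrite /SX (bigD1 e0) //=; have /andP[h _] := Xb _ e0O.
  by apply: (ltr_pwDl h); apply: sumr_ge0 => f _; exact: ler0n.
have B0 : 0 < SY R E.
  rewrite /SY (bigD1 e0) //=; have /andP[h _] := Yb _ e0O.
  by apply: (ltr_pwDl h); apply: sumr_ge0 => f _; exact: ler0n.
(* At most [11 / 10 y] summands, each at most [11 / 10 c]: hence [121 / 100]. *)
have sumb e (c : R) (Z : {set 'I_n} -> R) : e \in open_edges E -> 0 < c ->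
    (forall f, f \in open_edges E -> 0 < Z f <= 11 / 10 * c) ->
    0 <= \sum_(f in Yset E e) Z f <= 121 / 100 * (c * y).
  move=> eO c0 Zb; apply/andP; split.
    by apply: sumr_ge0 => f /YO/Zb/andP[/ltW].
  apply: (@le_trans _ _ (\sum_(f in Yset E e) (11 / 10 * c))).
    by apply: ler_sum => f /YO/Zb/andP[].
  rewrite sumr_const -[X in X <= _]mulr_natr -/(Ycount E e).
  have /andP[_ h] := Yb _ eO.
  apply: (@le_trans _ _ (11 / 10 * c * (11 / 10 * y))); last by lra.
  by rewrite ler_wpM2l //; lra.
have U0 : 0 <= Uf E <= 2.
  rewrite U2 andbT divr_ge0 ?mulr_ge0 ?sqr_ge0 ?exprn_ge0 //; exact: ltW.
have V0 : 0 <= Vf E <= 2 * t.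
  rewrite V2 andbT divr_ge0 ?mulr_ge0 ?sqr_ge0 ?exprn_ge0 //; exact: ltW.
have hPX e : e \in open_edges E -> 0 <= PX E e <= 121 / 100 * (x * y).
  by move=> eO; apply: (sumb e x (Xr E)).
have hPY e : e \in open_edges E -> 0 <= PY E e <= 121 / 100 * (y * y).
  by move=> eO; apply: (sumb e y (Yr E)) => //; lra.
have mPX : mean (open_edges E) (PX E) =
    mean (open_edges E) (fun e => (Xcount E e)%:R * (Ycount E e)%:R).
  by rewrite /mean (sum_Yset E (Xr E)).
have mPY : mean (open_edges E) (PY E) =
    mean (open_edges E) (fun e => (Ycount E e)%:R * (Ycount E e)%:R).
  by rewrite /mean (sum_Yset E (Yr E)).
have nu0 : 0 <= N^-1 <= tau by rewrite nutau andbT invr_ge0 ltW.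
have [b1 b2 b3] := step_dW_bounds Q0 x0 y1 g01 hX hY hPX hPY mPX mPY tY tX tau1
  nu0 t1 U0 V0 (VU_identity Q0 B0) (VY_identity Q0).
split=> [i e eO|i].
  by rewrite /F Wf_add //; [exact: b1|exact: b3].
have -> : mean (open_edges E) (F i) =
  mean (open_edges E) (step_dW (open_edges E) (Xr E) (Yr E) (PX E) (PY E) t N^-1 (Uf E)
    (Vf E) i).
  by apply: eq_mean => e eO; rewrite /F Wf_add //; exact: b3.
apply: le_trans (b2 i) _; rewrite /step_theta -/(Qn R E) le_eqVlt; apply/orP; left.
by apply/eqP; ring.
Qed.

End Martingales.

(** * Exponential supermartingales *)

Section Supermartingale.
Variables (R : realType) (n : nat).
Implicit Types (E : graph n) (N s t D : R) (ref : nat -> R).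

Definition expdev s D z : R := expR (s * (z - D)) + expR (s * (- z - D)).

(** The union bound is built in: six one-sided exponentials are summed, so a value below 1 confines
    all three processes to within [D]. *)
Definition hf N s ref t D E : R :=
  \sum_(i < 3) expdev s D (Wf N i t E - ref i).

Lemma expdev_ge0 s D z : 0 <= expdev s D z.
Proof. by rewrite addr_ge0 ?expR_ge0. Qed.

Lemma hf_ge0 N s ref t D E : 0 <= hf N s ref t D E.
Proof. by apply: sumr_ge0 => i _; apply: expdev_ge0. Qed.

Lemma hf_lt1 N s ref t D E : 0 < s -> hf N s ref t D E < 1 ->
  forall i, (i < 3)%N -> `|Wf N i t E - ref i| <= D.
Proof.
move=> s0 h i i3; set z := Wf _ _ _ _ - _.
have ez : expdev s D z < 1.
  apply: le_lt_trans h; rewrite /hf (bigD1 (Ordinal i3)) //= lerDl.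
  by apply: sumr_ge0 => j _; apply: expdev_ge0.
have small u : expR (s * u) < 1 -> u <= 0.
  by rewrite -expR0 ltr_expR pmulr_rlt0 // => /ltW.
have h1 : z - D <= 0.
  by apply: small; apply: le_lt_trans ez; rewrite lerDl expR_ge0.
have h2 : - z - D <= 0.
  by apply: small; apply: le_lt_trans ez; rewrite lerDr expR_ge0.
by apply/ler_normlP; split; lra.
Qed.

Lemma hf_le N s ref t D d E : 0 < s ->
  (forall i, (i < 3)%N -> `|Wf N i t E - ref i| <= d) ->
  hf N s ref t D E <= 6 * expR (s * (d - D)).
Proof.
move=> s0 h; have -> : 6 * expR (s * (d - D)) = \sum_(i < 3) (2 * expR (s * (d - D))).
  by rewrite sumr_const card_ord -[RHS]mulr_natr; ring.
apply: ler_sum => i _; have /ler_normlP[h1 h2] := h _ (ltn_ord i).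
by rewrite /expdev mulrDl mul1r lerD // ler_expR ler_pM2l // lerB.
Qed.

Lemma sum_step_mean E (F : graph n -> R) : valid E -> 0 < Qn R E ->
  \sum_E' step R E E' * F E' = mean (open_edges E) (fun e => F (e |: E)%SET).
Proof.
move=> vE Q0; rewrite sum_step (addable_open vE) ifF //.
by apply/negbTE; rewrite -cards_eq0 -(pnatr_eq0 R) lt0r_neq0.
Qed.

Lemma mean_sum3 (T : finType) (Op : {set T}) (F : 'I_3 -> T -> R) :
  mean Op (fun e => \sum_(i < 3) F i e) = \sum_(i < 3) mean Op (F i).
Proof. by rewrite /mean exchange_big /= mulr_suml. Qed.

(** The tolerance widens from [D] to [D'] by enough to pay for the drift [d] and for the quadratic
    term [2 s c ^ 2] of the exponential. *)
Lemma mean_expdev (T : finType) (Op : {set T}) (F : T -> R) s c d D D' z :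
  0 < #|Op|%:R :> R -> 0 < s -> s * c <= 1 / 2 ->
  (forall e, e \in Op -> `|F e| <= c) -> `|mean Op F| <= d ->
  d + 2 * s * c ^+ 2 <= D' - D ->
  mean Op (fun e => expdev s D' (z + F e)) <= expdev s D z.
Proof.
move=> Q0 s0 sc Fc /ler_normlP[d1 d2] DD.
have key (G : T -> R) w : (forall e, e \in Op -> `|G e| <= c) -> mean Op G <= d ->
    mean Op (fun e => expR (s * (w + G e - D'))) <= expR (s * (w - D)).
  move=> Gc Gd; rewrite (@eq_mean _ _ _ _ (fun e => expR (s * (w - D')) * expR (s * G e))).
    rewrite meanZ; apply: (@le_trans _ _ (expR (s * (w - D')) * expR (s * d + 2 * (s * c)
      ^+ 2))).
      by rewrite ler_wpM2l ?expR_ge0 // mean_expR // ltW.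
    rewrite -expRD ler_expR; have := ler_wpM2l (ltW s0) DD; lra.
  by move=> e _; rewrite -expRD; congr expR; ring.
rewrite /expdev meanD lerD //; first exact: key.
rewrite (@eq_mean _ _ _ _ (fun e => expR (s * (- z + - F e - D')))).
  apply: key => [e eO|]; first by rewrite normrN Fc.
  rewrite (@eq_mean _ _ _ _ (fun e => -1 * F e)) ?meanZ; first by lra.
  by move=> e _; rewrite mulN1r.
by move=> e _; congr expR; ring.
Qed.

Lemma hf_step N s ref t (c d D D' : R) E : valid E -> 0 < Qn R E -> 0 < s ->
  s * c <= 1 / 2 -> d + 2 * s * c ^+ 2 <= D' - D ->
  let F i e := Wf N i (t + N^-1) (e |: E)%SET - Wf N i t E in
  (forall i e, e \in open_edges E -> `|F i e| <= c) ->
  (forall i, `|mean (open_edges E) (F i)| <= d) ->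
  \sum_E' step R E E' * hf N s ref (t + N^-1) D' E' <= hf N s ref t D E.
Proof.
move=> vE Q0 s0 sc DD F Fc Fd; rewrite sum_step_mean // mean_sum3.
apply: ler_sum => i _.
rewrite (@eq_mean _ _ _ _ (fun e => expdev s D' (Wf N i t E - ref i + F i e))).
  apply: (@mean_expdev _ _ _ _ c d) => //; exact: Fc.
by move=> e _; congr expdev; rewrite /F; ring.
Qed.

(** Here [a = sqrt n] and [G = e^(2t^2) n^(-1/4)], so that typical values are [X = 2 / G^4],
    [Y = 4 t / G^2] and [Q] about [a^3 / (2 G^2)]; [tau] is a generous bound on relative changes per
    step. The last inequality keeps drift plus quadratic term below [4 t G i^3], a lower bound for
    the growth of [G] in one step. *)
Lemma phase2_numeric (a i G t L C Q : R) : 0 < a -> i = a^-1 -> 0 < G -> i <= G ^+ 2 ->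
  1 <= t <= L -> 1 <= C -> 10 ^+ 10 * C ^+ 2 * L ^+ 13 * G <= 1 ->
  a ^+ 3 / (5 * G ^+ 2) <= Q ->
  let tau := 300 * t * i ^+ 3 in let g := C * (G * L ^+ 4) in
  [/\ g <= 1 / 10, 8 * (4 * t / G ^+ 2) <= tau * Q,
      2 * (2 / G ^+ 4) <= tau * (4 * t / G ^+ 2 * Q), tau <= 1 / 100 &
  [/\ i ^+ 3 <= tau, 1 <= 4 * t / G ^+ 2, a * (400 * t ^+ 2 * tau) <= 1 / 2 &
    160 * t ^+ 3 * (2 / Q + g ^+ 2 * tau + 20 * tau ^+ 2) +
      2 * a * (400 * t ^+ 2 * tau) ^+ 2 <= 4 * t * G * i ^+ 3]].
Proof.
move=> a0 iE G0 iG /andP[t1 tL] C1 HG HQ tau g.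
have t0 : 0 < t by lra.
have i0 : 0 < i by rewrite iE invr_gt0.
have ai : a * i = 1 by rewrite iE mulfV // lt0r_neq0.
have C2 : 1 <= C ^+ 2 by rewrite exprn_ege1.
have L1 : 1 <= L by lra.
have tpow k : 1 <= t ^+ k by rewrite exprn_ege1.
have Lpow k : 1 <= L ^+ k by rewrite exprn_ege1.
(* [p] dominates every relative error below: [C ^ 2 L ^ 8] comes from squaring [g], and [t ^ 5] is
   the highest power needed. With [t <= L] this accounts for the [L ^ 13] of the hypothesis. *)
pose p := t ^+ 5 * (C ^+ 2 * L ^+ 8 * G).
have CLG : 0 < C ^+ 2 * L ^+ 8 * G.
  apply: mulr_gt0 => //; apply: mulr_gt0; [exact: (lt_le_trans ltr01 C2)|exact:
    (lt_le_trans ltr01 (Lpow _))].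
have p1 : 10 ^+ 10 * p <= 1.
  apply: le_trans HG; rewrite /p.
  have -> : 10 ^+ 10 * C ^+ 2 * L ^+ 13 * G = 10 ^+ 10 * (L ^+ 5 * (C ^+ 2 * L ^+ 8 * G))
    by ring.
  rewrite ler_wpM2l ?exprn_ge0 // ler_wpM2r ?(ltW CLG) // lerXn2r ?nnegrE //; lra.
have Gle : G <= C ^+ 2 * L ^+ 8 * G.
  rewrite ler_peMl ?(ltW G0) //; apply: mulr_ege1; [exact: C2|exact: Lpow].
have tG k : (k <= 5)%N -> 0 < t ^+ k * (C ^+ 2 * L ^+ 8 * G) <= p.
  move=> k5; rewrite mulr_gt0 //=; last exact: (lt_le_trans ltr01 (tpow k)).
  by rewrite /p ler_wpM2r ?(ltW CLG) // ler_weXn2l.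
have tG' k : (k <= 5)%N -> 0 < t ^+ k * G <= p.
  move=> k5; rewrite mulr_gt0 //=; last exact: (lt_le_trans ltr01 (tpow k)).
  have /andP[_ h] := tG _ k5; apply: le_trans h.
  by rewrite ler_wpM2l // (le_trans ler01 (tpow k)).
have p0 : 0 < p by have /andP[+ _] := tG' 0%N isT; have /andP[_ +] := tG' 0%N isT; lra.
have G1 : G <= p by have /andP[_] := tG' 0%N isT; rewrite expr0 mul1r.
have ps : p <= 1 / 10 ^+ 9.
  by rewrite ler_pdivlMr; lra.
have G2 : G ^+ 2 <= p * G by rewrite expr2 ler_wpM2r // ltW.
have pG : p * G <= G / 10 ^+ 9 by have := ler_wpM2r (ltW G0) ps; lra.
have Gs : G <= 1 / 10 ^+ 9 by lra.
have iG1 : i <= G / 10 ^+ 9 by lra.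
have i1 : i <= 1 by lra.
have i20 : 0 < i ^+ 2 by rewrite exprn_gt0.
have i30 : 0 < i ^+ 3 by rewrite exprn_gt0.
have i2G : i ^+ 2 <= G * i by rewrite expr2 ler_wpM2r ?(ltW i0) //; lra.
have Gi : G * i <= G * 1 by rewrite ler_wpM2l // ltW.
have i3i2 : i ^+ 3 <= i ^+ 2 by rewrite exprS ler_piMl // ltW.
have Gn0 := lt0r_neq0 G0.
have Q0 : 0 < Q by apply: lt_le_trans HQ; rewrite divr_gt0 ?mulr_gt0 ?exprn_gt0.
have QiV : Q^-1 <= 5 * G ^+ 2 * i ^+ 3.
  have -> : 5 * G ^+ 2 * i ^+ 3 = (a ^+ 3 / (5 * G ^+ 2))^-1.
    by rewrite iE; field; rewrite Gn0 lt0r_neq0.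
  by rewrite lef_pV2 ?posrE // divr_gt0 ?mulr_gt0 ?exprn_gt0.
have tauQ : 60 * t / G ^+ 2 <= tau * Q.
  have -> : 60 * t / G ^+ 2 = tau * (a ^+ 3 / (5 * G ^+ 2)).
    by rewrite /tau iE; field; rewrite Gn0 lt0r_neq0.
  apply: (ler_wpM2l _ HQ); apply: (mulr_ge0 _ (ltW i30)).
  exact: mulr_ge0 (ler0n R 300) (ltW t0).
have iG2 : 0 < (G ^+ 2)^-1 by rewrite invr_gt0 exprn_gt0.
have iG2' : 1 <= (G ^+ 2)^-1 by rewrite invf_ge1 ?exprn_gt0 // expr_le1 //; lra.
have tiG : (G ^+ 2)^-1 <= t * (G ^+ 2)^-1 by rewrite ler_peMl // ltW.
have /andP[_ t1G] := tG' 1%N isT; have /andP[_ t2G] := tG' 2%N isT.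
have /andP[_ t3G] := tG' 3%N isT; have /andP[_ t4G] := tG' 4%N isT.
have /andP[_ t5G] := tG' 5%N isT; have /andP[_ t3C] := tG 3%N isT.
have gp : g <= p.
  rewrite /g; have /andP[_ h] := tG 0%N isT; rewrite expr0 mul1r in h.
  apply: le_trans h; have -> : C ^+ 2 * L ^+ 8 * G = C * (C * L ^+ 4) * (G * L ^+ 4)
    by ring.
  apply: ler_wpM2r; first exact: mulr_ge0 (ltW G0) (le_trans ler01 (Lpow 4)).
  apply: ler_peMr; first exact: le_trans ler01 C1.
  apply: mulr_ege1; [exact: C1|exact: Lpow].
have ti3 : t * i ^+ 3 <= p.
  have : t * i ^+ 3 <= t ^+ 1 * G by rewrite expr1 ler_wpM2l //; lra.
  lra.
split.
- lra.
- have := mulr_ge0 (_ : 0 <= t) (ltW iG2); lra.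
- have -> : 2 * (2 / G ^+ 4) = 4 * (G ^+ 2)^-1 * (G ^+ 2)^-1 by field.
  have -> : tau * (4 * t / G ^+ 2 * Q) = 4 * (tau * Q) * (t * (G ^+ 2)^-1) by ring.
  have iG20 := ltW iG2; have tauQ' : 4 * (G ^+ 2)^-1 <= 4 * (tau * Q) by lra.
  by apply: ler_pM tauQ' tiG => //; exact: mulr_ge0.
- by rewrite /tau; lra.
split.
- have : i ^+ 3 <= t * i ^+ 3 by rewrite ler_peMl // ltW.
  by rewrite /tau; lra.
- lra.
- have -> : a * (400 * t ^+ 2 * tau) = (12 * 10 ^+ 4) * (t ^+ 3 * i ^+ 2) * (a * i)
  by rewrite /tau; ring.
  rewrite ai.
  have : t ^+ 3 * i ^+ 2 <= t ^+ 3 * G by rewrite ler_wpM2l ?(le_trans ler01 (tpow _))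
    //; lra.
  lra.
have e1 : 2 * a * (400 * t ^+ 2 * tau) ^+ 2 =
    288 * 10 ^+ 8 * (t ^+ 6 * i ^+ 2) * i ^+ 3 * (a * i) by rewrite /tau; ring.
have e2 : 160 * t ^+ 3 * (2 / Q + g ^+ 2 * tau + 20 * tau ^+ 2) =
   320 * t ^+ 3 / Q + (48 * 10 ^+ 3) * t ^+ 4 * (g ^+ 2) * i ^+ 3 +
   288 * 10 ^+ 6 * (t ^+ 5 * i ^+ 3) * i ^+ 3 by rewrite /tau; ring.
rewrite e1 e2 ai.
have q1 : t ^+ 3 / Q <= t ^+ 3 * (5 * G ^+ 2 * i ^+ 3).
  by rewrite ler_wpM2l // (le_trans ler01 (tpow _)).
have tGi : 0 < t * G * i ^+ 3 by rewrite !mulr_gt0.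
have q2 : t ^+ 3 * (5 * G ^+ 2 * i ^+ 3) <= 5 * p * (t * G * i ^+ 3).
  have -> : t ^+ 3 * (5 * G ^+ 2 * i ^+ 3) = 5 * (t ^+ 2 * G) * (t * G * i ^+ 3) by ring.
  by rewrite ler_wpM2r ?(ltW tGi) //; lra.
have q3 : t ^+ 4 * (g ^+ 2) * i ^+ 3 <= p * (t * G * i ^+ 3).
  have -> : t ^+ 4 * (g ^+ 2) * i ^+ 3 = t ^+ 3 * (C ^+ 2 * L ^+ 8 * G) * (t * G * i ^+ 3).
    by rewrite /g; ring.
  by rewrite ler_wpM2r // ltW.
have Gd0 : 0 < G / 10 ^+ 9 by rewrite divr_gt0 // exprn_gt0.
have iG' : i <= G by clear -iG1 G0; lra.
have i2G' : i ^+ 2 <= G by clear -i2G Gi; lra.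
have q4 : t ^+ 5 * i ^+ 3 * i ^+ 3 <= p * (t * G * i ^+ 3) / 10 ^+ 9.
  have -> : p * (t * G * i ^+ 3) / 10 ^+ 9 = p * t * (G / 10 ^+ 9) * i ^+ 3 by ring.
  rewrite ler_wpM2r ?(ltW i30) //.
  apply: (@le_trans _ _ ((t ^+ 4 * G) * t * (G / 10 ^+ 9))); last first.
    by rewrite ler_wpM2r ?(ltW Gd0) // ler_wpM2r ?(ltW t0).
  have -> : t ^+ 5 * i ^+ 3 = t ^+ 4 * i ^+ 2 * t * i by ring.
  apply: (ler_pM _ (ltW i0) _ iG1).
    exact: mulr_ge0 (mulr_ge0 (exprn_ge0 _ (ltW t0)) (ltW i20)) (ltW t0).
  exact: ler_wpM2r (ltW t0) _ _ (ler_wpM2l (exprn_ge0 _ (ltW t0)) i2G').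
have q5 : t ^+ 6 * i ^+ 2 * i ^+ 3 <= p * (t * G * i ^+ 3) / 10 ^+ 9.
  have -> : p * (t * G * i ^+ 3) / 10 ^+ 9 = p * t * (G / 10 ^+ 9) * i ^+ 3 by ring.
  rewrite ler_wpM2r ?(ltW i30) //.
  apply: (@le_trans _ _ ((t ^+ 5 * G) * t * (G / 10 ^+ 9))); last first.
    by rewrite ler_wpM2r ?(ltW Gd0) // ler_wpM2r ?(ltW t0).
  have -> : t ^+ 6 * i ^+ 2 = t ^+ 5 * i * t * i by ring.
  apply: (ler_pM _ (ltW i0) _ iG1).
    exact: mulr_ge0 (mulr_ge0 (exprn_ge0 _ (ltW t0)) (ltW i0)) (ltW t0).
  exact: ler_wpM2r (ltW t0) _ _ (ler_wpM2l (exprn_ge0 _ (ltW t0)) iG').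
have q6 : p * (t * G * i ^+ 3) <= 1 / 10 ^+ 9 * (t * G * i ^+ 3).
  by rewrite ler_wpM2r // ltW.
lra.
Qed.

End Supermartingale.

(** * Relative errors *)

Section RelativeErrors.
Variable R : realType.
Implicit Types (z r w U P d t nu : R).

(** Applied with [r] the ratio of [Q] to its trajectory and [w = 1 - 1/n], the discrepancy between
    ['C(n, 2)] and [n^2 / 2]. *)
Lemma product_near1 r w z : z <= 1 / 100 -> `|r - 1| <= z -> 0 <= 1 - w <= z ->
  `|r * w - 1| <= 5 / 2 * z /\ `|r ^+ 2 * w ^+ 2 - 1| <= 6 * z.
Proof.
move=> z1 /ler_normlP[r1 r2] /andP[w1 w2]; have z0 : 0 <= z by lra.
have h : `|r * w - 1| <= 5 / 2 * z.
  have w0 : 0 <= w by lra.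
  have a1 : (1 - z) * w <= r * w by rewrite ler_wpM2r //; lra.
  have a2 : r * w <= (1 + z) * w by rewrite ler_wpM2r //; lra.
  have a3 : (1 - z) * (1 - z) <= (1 - z) * w by rewrite ler_wpM2l //; lra.
  have a4 : (1 + z) * w <= (1 + z) * 1 by rewrite ler_wpM2l //; lra.
  have zz : z * z <= 1 / 100 * z by rewrite ler_wpM2r.
  have zz0 : 0 <= z * z by rewrite mulr_ge0.
  by apply/ler_normlP; split; lra.
split=> //; rewrite -exprMn; move/ler_normlP: h; set p := r * w => -[p1 p2].
have p0 : 0 <= p by lra.
have b1 : (1 - 5 / 2 * z) * (1 - 5 / 2 * z) <= p * p by rewrite ler_pM //; lra.
have b2 : p * p <= (1 + 5 / 2 * z) * (1 + 5 / 2 * z) by rewrite ler_pM //; lra.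
have zz : z * z <= 1 / 100 * z by rewrite ler_wpM2r.
  have zz0 : 0 <= z * z by rewrite mulr_ge0.
by rewrite expr2; apply/ler_normlP; split; lra.
Qed.

Lemma mul_near1 U P z : z <= 1 / 100 -> `|U - 1| <= z -> `|P - 1| <= 6 * z ->
  `|U * P - 1| <= 10 * z.
Proof.
move=> z1 /ler_normlP[u1 u2] /ler_normlP[p1 p2]; have z0 : 0 <= z by lra.
have b1 : (1 - z) * (1 - 6 * z) <= U * P by rewrite ler_pM //; lra.
have b2 : U * P <= (1 + z) * (1 + 6 * z) by rewrite ler_pM //; lra.
have zz : z * z <= 1 / 100 * z by rewrite ler_wpM2r.
  have zz0 : 0 <= z * z by rewrite mulr_ge0.
by apply/ler_normlP; split; lra.
Qed.

Lemma div_near1 U P u z : z <= 1 / 100 -> u = U * P -> `|u - 1| <= z ->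
  `|P - 1| <= 6 * z -> `|U - 1| <= 10 * z.
Proof.
move=> z1 uE /ler_normlP[u1 u2] /ler_normlP[p1 p2]; have z0 : 0 <= z by lra.
have P0 : 0 < P by lra.
have zz : z * z <= 1 / 100 * z by rewrite ler_wpM2r.
  have zz0 : 0 <= z * z by rewrite mulr_ge0.
have zP : 10 * z * (94 / 100) <= 10 * z * P by rewrite ler_wpM2l; lra.
apply/ler_normlP; split.
  rewrite -(ler_pM2r P0); lra.
rewrite -(ler_pM2r P0); lra.
Qed.

Lemma expR_near1 z d : d <= 1 / 2 -> `|z| <= d -> `|expR z - 1| <= 2 * d.
Proof.
move=> d1 zd; have d0 : 0 <= d by apply: le_trans zd.
have := expR_le_quadratic (le_trans zd d1); have := expR_ge1Dx z.
have zz : z ^+ 2 <= d * d.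
  by rewrite -[leLHS]real_normK ?num_real // expr2 ler_pM.
have dd : d * d <= 1 / 2 * d by rewrite ler_wpM2r.
move/ler_normlP: zd => [z1 z2] e1 e2.
case: (lerP z 0) => zs.
  have : expR z <= 1 by rewrite -expR0 ler_expR.
  by move=> ?; apply/ler_normlP; split; lra.
have zz2 : z ^+ 2 <= 1 / 2 * z by rewrite expr2 ler_wpM2r //; lra.
by apply/ler_normlP; split; lra.
Qed.

(** With [W] the third deviation, [ln Q - ln c2 + 4 t^2 = W - 8 t (V - t U) - 4 t^2 (U - 1) + 4 t nu
    U], which is at most [14 t^2 d]; exponentiating doubles it to [28 t^2 d]. *)
Lemma W_to_ratios (Q c2 U V t nu d : R) : 0 < Q -> 0 < c2 -> 1 <= t -> 0 <= nu ->
  8 * nu <= d -> 28 * t ^+ 2 * d <= 1 / 100 ->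
  `|U - 1| <= d -> `|V - t * U| <= d ->
  `|ln Q + 8 * t * V - 4 * t * (t + nu) * U - ln c2| <= d ->
  let z := 28 * t ^+ 2 * d in
  [/\ `|Q / (expR (- 4 * t ^+ 2) * c2) - 1| <= z, `|U - 1| <= z & `|V / t - 1| <= z].
Proof.
move=> Q0 c0 t1 nu0 nud dz /ler_normlP[u1 u2] /ler_normlP[v1 v2] /ler_normlP[l1 l2] z.
have d0 : 0 <= d by lra.
have t2 : t <= t ^+ 2 by rewrite expr2 ler_peMl //; lra.
have td : t * d <= t ^+ 2 * d by rewrite ler_wpM2r.
have dd : d <= t * d by rewrite ler_peMl.
have tv1 : t * (V - t * U) <= t * d by rewrite ler_wpM2l //; lra.
have tv2 : t * (- (V - t * U)) <= t * d by rewrite ler_wpM2l //; lra.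
have t20 : 0 <= t ^+ 2 by rewrite exprn_ge0; lra.
have tu1 : t ^+ 2 * (U - 1) <= t ^+ 2 * d by rewrite ler_wpM2l.
have tu2 : t ^+ 2 * (- (U - 1)) <= t ^+ 2 * d by rewrite ler_wpM2l //; lra.
have tn1 : t * (8 * nu) <= t * d by rewrite ler_wpM2l; lra.
have tn0 : 0 <= t * nu by rewrite mulr_ge0; lra.
have tn2 : t * nu * U <= t * nu * 2 by rewrite ler_wpM2l //; lra.
have tn3 : t * nu * 0 <= t * nu * U by rewrite ler_wpM2l //; lra.
split.
- have -> : Q / (expR (- 4 * t ^+ 2) * c2) = expR (ln Q - ln c2 + 4 * t ^+ 2).
    rewrite expRD expRB !lnK ?posrE // mulNr expRN; field.
    by rewrite (lt0r_neq0 (expR_gt0 _)) (lt0r_neq0 c0).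
  have -> : z = 2 * (14 * t ^+ 2 * d) by rewrite /z; ring.
  by apply: expR_near1; [lra|apply/ler_normlP; split; lra].
- by apply/ler_normlP; rewrite /z; split; lra.
- have t0 : 0 < t by lra.
  have -> : V / t - 1 = (V - t) / t by field; exact: lt0r_neq0.
  rewrite normrM [`|t^-1|]gtr0_norm ?invr_gt0 // ler_pdivrMr //.
  have su1 : t * (U - 1) <= t * d by rewrite ler_wpM2l // ltW.
  have su2 : t * (- (U - 1)) <= t * d by rewrite ler_wpM2l ?(ltW t0) //; lra.
  have z0 : 0 <= z by apply: mulr_ge0 => //; apply: mulr_ge0.
  have zt : z <= z * t by rewrite ler_peMr.
  by apply/ler_normlP; rewrite /z in zt *; split; lra.
Qed.

(** The converse passage, needed where the initial phase ends. With [r] the ratio for [Q] and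
    [v = V / t], the third deviation is [ln r + 8 t^2 (v - 1) - 4 t^2 (U - 1) - 4 t nu U]; its terms
    cost 2, 80, 40 and 8 times at most [t^2 d]. *)
Lemma ratios_to_W (Q c2 U V t nu d : R) : 0 < Q -> 0 < c2 -> 1 <= t -> 0 <= nu ->
  nu <= d -> d <= 1 / 1000 -> `|Q / (expR (- 4 * t ^+ 2) * c2) - 1| <= d ->
  `|U - 1| <= 10 * d -> `|V / t - 1| <= 10 * d ->
  [/\ `|U - 1| <= 140 * t ^+ 2 * d, `|V - t * U| <= 140 * t ^+ 2 * d &
  `|ln Q + 8 * t * V - 4 * t * (t + nu) * U - ln c2| <= 140 * t ^+ 2 * d].
Proof.
move=> Q0 c0 t1 nu0 nud d1.
set v := V / t => /ler_normlP[r1 r2] /ler_normlP[u1 u2] /ler_normlP[v1 v2].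
have t0 : 0 < t by lra.
have VE : V = t * v by rewrite /v; field; exact: lt0r_neq0.
have d0 : 0 <= d by lra.
have t2 : t <= t ^+ 2 by rewrite expr2 ler_peMl //; lra.
have td : t * d <= t ^+ 2 * d by rewrite ler_wpM2r.
have dd : d <= t * d by rewrite ler_peMl.
have t20 : 0 <= t ^+ 2 by rewrite exprn_ge0; lra.
have tu1 : t ^+ 2 * (U - 1) <= t ^+ 2 * (10 * d) by rewrite ler_wpM2l.
have tu2 : t ^+ 2 * (- (U - 1)) <= t ^+ 2 * (10 * d) by rewrite ler_wpM2l //; lra.
have tv1 : t ^+ 2 * (v - 1) <= t ^+ 2 * (10 * d) by rewrite ler_wpM2l.
have tv2 : t ^+ 2 * (- (v - 1)) <= t ^+ 2 * (10 * d) by rewrite ler_wpM2l //; lra.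
have su1 : t * (U - 1) <= t * (10 * d) by rewrite ler_wpM2l //; lra.
have su2 : t * (- (U - 1)) <= t * (10 * d) by rewrite ler_wpM2l //; lra.
have sv1 : t * (v - 1) <= t * (10 * d) by rewrite ler_wpM2l //; lra.
have sv2 : t * (- (v - 1)) <= t * (10 * d) by rewrite ler_wpM2l //; lra.
have tn1 : t * nu <= t * d by rewrite ler_wpM2l //; lra.
have tn0 : 0 <= t * nu by rewrite mulr_ge0 //; lra.
have tn2 : t * nu * U <= t * nu * 2 by rewrite ler_wpM2l //; lra.
have tn3 : t * nu * 0 <= t * nu * U by rewrite ler_wpM2l //; lra.
set r := Q / _ in r1 r2.
have r0 : 0 < r by rewrite divr_gt0 ?mulr_gt0 ?expR_gt0.
have QE : Q = r * (expR (- 4 * t ^+ 2) * c2).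
  by rewrite /r; field; rewrite (lt0r_neq0 (expR_gt0 _)) (lt0r_neq0 c0).
clearbody r; have lnr : ln Q = ln r - 4 * t ^+ 2 + ln c2.
  by rewrite QE !lnM ?posrE ?mulr_gt0 ?expR_gt0 // expRK; ring.
have l1 : ln r <= d.
  have := @le_ln1Dx R (r - 1); rewrite (_ : 1 + (r - 1) = r); last ring.
  by move=> h; apply: (le_trans (h _)); clear -r0 r2; lra.
have l2 : - (2 * d) <= ln r.
  have := @le_ln1Dx R (r^-1 - 1); rewrite (_ : 1 + (r^-1 - 1) = r^-1); last ring.
  rewrite lnV ?posrE // => h.
  have rV : r^-1 <= 1 + 2 * d.
    have dd1 : d * d <= 1 / 1000 * d by rewrite ler_wpM2r.
    have rd : (1 - d) * (2 * d) <= r * (2 * d) by apply: ler_wpM2r; [exact: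
      mulr_ge0|clear -r1; lra].
    by rewrite -(ler_pM2r r0) mulVf ?lt0r_neq0 //; clear -rd dd1 d0 r1; lra.
  have rV0 : 0 < r^-1 by rewrite invr_gt0.
  by have := h ltac:(clear -rV0; lra); clear -rV; lra.
rewrite lnr VE; split; apply/ler_normlP; split; lra.
Qed.

End RelativeErrors.

Section States.
Variables (R : realType) (n : nat).
Implicit Types (E : graph n) (a G t L C D : R).

Lemma phase2_step a G t L C D D' (ref : nat -> R) E : 0 < a -> 0 < G ->
  a^-1 <= G ^+ 2 -> 1 <= t <= L -> 1 <= C ->
  10 ^+ 10 * C ^+ 2 * L ^+ 13 * G <= 1 -> valid E ->
  near_counts E (2 / G ^+ 4) (4 * t / G ^+ 2) (C * (G * L ^+ 4)) ->
  a ^+ 3 / (5 * G ^+ 2) <= Qn R E -> Uf (a ^+ 3) E <= 2 -> Vf (a ^+ 3) E <= 2 * t ->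
  4 * t * G * a^-1 ^+ 3 <= D' - D ->
  \sum_E' step R E E' * hf (a ^+ 3) a ref (t + (a ^+ 3)^-1) D' E' <=
    hf (a ^+ 3) a ref t D E.
Proof.
move=> a0 G0 aG tL C1 HG vE nc HQ U2 V2 DD.
have [g1 tY tX tau1 [nt y1 sc key]] := phase2_numeric a0 erefl G0 aG tL C1 HG HQ.
have a30 : 0 < a ^+ 3 by rewrite exprn_gt0.
have /andP[t1 _] := tL.
have L0 : 0 <= L by case/andP: tL => ? ?; apply: le_trans (le_trans t1 _).
have g0 : 0 <= C * (G * L ^+ 4) <= 1 / 10.
  rewrite g1 andbT; apply: mulr_ge0 (le_trans ler01 C1) _.
  exact: mulr_ge0 (ltW G0) (exprn_ge0 _ L0).
have Q0 : 0 < Qn R E by apply: lt_le_trans HQ; rewrite divr_gt0 ?mulr_gt0 ?exprn_gt0.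
have x0 : 0 < 2 / G ^+ 4 by rewrite divr_gt0 ?exprn_gt0.
have nt' : (a ^+ 3)^-1 <= 300 * t * a^-1 ^+ 3 by rewrite -exprVn.
have [b1 b2] := Wf_step_bounds a30 vE Q0 x0 y1 g0 nc tY tX tau1 nt' t1 U2 V2.
exact: (hf_step ref vE Q0 a0 sc (le_trans key DD) b1 b2).
Qed.

Lemma avgX_ratio a G c2 E : 0 < a -> 0 < G -> 1 < a -> 0 < Qn R E ->
  c2 = a ^+ 2 * (a ^+ 2 - 1) / 2 ->
  SX R E / Qn R E / (2 / G ^+ 4) =
  Uf (a ^+ 3) E * ((Qn R E / (c2 / (G ^+ 2 * a))) ^+ 2 * (1 - (a ^+ 2)^-1) ^+ 2).
Proof.
move=> a0 G0 a1 Q0 ->; have : a ^+ 2 - 1 != 0.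
  by rewrite lt0r_neq0 // subr_gt0 exprn_egt1.
move=> h; rewrite /Uf; field.
by rewrite (lt0r_neq0 a0) (lt0r_neq0 G0) (lt0r_neq0 Q0) h.
Qed.

Lemma avgY_ratio a G t c2 E : 0 < a -> 0 < G -> 1 < a -> 0 < t -> 0 < Qn R E ->
  c2 = a ^+ 2 * (a ^+ 2 - 1) / 2 ->
  SY R E / Qn R E / (4 * t / G ^+ 2) =
  Vf (a ^+ 3) E / t * (Qn R E / (c2 / (G ^+ 2 * a)) * (1 - (a ^+ 2)^-1)).
Proof.
move=> a0 G0 a1 t0 Q0 ->; have : a ^+ 2 - 1 != 0.
  by rewrite lt0r_neq0 // subr_gt0 exprn_egt1.
move=> h; rewrite /Vf; field.
by rewrite (lt0r_neq0 a0) (lt0r_neq0 t0) (lt0r_neq0 G0) (lt0r_neq0 Q0) h.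
Qed.

End States.

(** * Scales *)

Section Scales.
Variables (R : realType) (n : nat).
Implicit Types (t k : R).

Definition sqn : R := Num.sqrt n%:R.
Definition qin : R := n%:R `^ (- (1 / 4)).
(** The common scale: [gq] and [gy] are [Gt] times powers of [ln n], while the time-dependent
    exponentials in [Xt], [Yt] and [Qt] become negative powers of it. *)
Definition Gt t : R := expR (2 * t ^+ 2) * qin.
Definition c2n : R := 'C(n, 2)%:R.

Hypothesis n1 : (1 < n)%N.

Let n0 : 0 < n%:R :> R. Proof. by rewrite ltr0n; apply: ltn_trans n1. Qed.

Lemma sqn_gt0 : 0 < sqn. Proof. by rewrite sqrtr_gt0. Qed.
Lemma qin_gt0 : 0 < qin. Proof. exact: powR_gt0. Qed.
Lemma Gt_gt0 t : 0 < Gt t. Proof. by rewrite mulr_gt0 ?expR_gt0 ?qin_gt0. Qed.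

Lemma sqn2 : sqn ^+ 2 = n%:R. Proof. by rewrite sqr_sqrtr // ltW. Qed.

Lemma sqn_gt1 : 1 < sqn.
Proof. by rewrite -(@ltr_pXn2r _ 2) ?nnegrE ?ltW ?sqn_gt0 // expr1n sqn2 ltr1n. Qed.

Lemma sqn_expR : sqn = expR (ln n%:R / 2).
Proof.
apply/eqP; rewrite -(@eqrXn2 _ 2) ?ltW ?sqn_gt0 ?expR_gt0 // sqn2 -expRM_natl.
by rewrite mulrC divfK // lnK.
Qed.

Lemma qin_expR : qin = expR (- (ln n%:R / 4)).
Proof. by rewrite /qin /powR gt_eqF //; congr expR; field. Qed.

Lemma qin2 : qin ^+ 2 = sqn^-1.
Proof. by rewrite sqn_expR qin_expR -expRN -expRM_natl; congr expR; field. Qed.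

Lemma n32_sqn : n32 R n = sqn ^+ 3.
Proof.
by rewrite /n32 /powR gt_eqF // sqn_expR -expRM_natl; congr expR; field.
Qed.

Lemma Gt2 t : Gt t ^+ 2 = expR (4 * t ^+ 2) / sqn.
Proof. by rewrite exprMn qin2 -expRM_natl; congr (expR _ * _); ring. Qed.

Lemma Gt4 t : Gt t ^+ 4 = expR (8 * t ^+ 2) / n%:R.
Proof.
have -> : Gt t ^+ 4 = (Gt t ^+ 2) ^+ 2 by ring.
rewrite Gt2 exprMn exprVn sqn2 -expRM_natl; congr (expR _ * _); ring.
Qed.

Lemma Xt_Gt k : Xt n k = 2 / Gt (time_of n k) ^+ 4.
Proof.
rewrite /Xt Gt4 mulNr expRN; field.
by rewrite (lt0r_neq0 (expR_gt0 _)) lt0r_neq0.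
Qed.

Lemma Yt_Gt k : Yt n k = 4 * time_of n k / Gt (time_of n k) ^+ 2.
Proof.
rewrite /Yt Gt2 mulNr expRN -/sqn; field.
by rewrite (lt0r_neq0 (expR_gt0 _)) lt0r_neq0 // sqn_gt0.
Qed.

Lemma Qt_Gt k : Qt n k = c2n / (Gt (time_of n k) ^+ 2 * sqn).
Proof.
rewrite /Qt Gt2 mulNr expRN -/c2n; field.
by rewrite (lt0r_neq0 (expR_gt0 _)) lt0r_neq0 // sqn_gt0.
Qed.

Lemma c2n_sqn : c2n = sqn ^+ 2 * (sqn ^+ 2 - 1) / 2.
Proof.
have h : (2 * 'C(n, 2) = n * n.-1)%N by rewrite -mul_bin_diag bin1 mulnC.
have : (2 * 'C(n, 2))%:R = (n * n.-1)%:R :> R by rewrite h.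
rewrite !natrM -subn1 natrB; last exact: ltnW.
rewrite sqn2 /c2n; lra.
Qed.

Lemma c2n_gt0 : 0 < c2n.
Proof. by rewrite ltr0n bin_gt0. Qed.

Lemma Gt_ge_qin t : qin <= Gt t.
Proof.
rewrite ler_peMl ?(ltW qin_gt0) // -[X in X <= _]expR0 ler_expR.
by rewrite mulr_ge0 // sqr_ge0.
Qed.

Lemma sqnV_le t : sqn^-1 <= Gt t ^+ 2.
Proof. by rewrite -qin2 lerXn2r ?nnegrE ?(ltW qin_gt0) ?(ltW (Gt_gt0 _)) ?Gt_ge_qin. Qed.

Lemma Gt_mono t t' : 0 <= t -> t <= t' -> Gt t <= Gt t'.
Proof.
move=> t0 tt; rewrite ler_wpM2r ?(ltW qin_gt0) // ler_expR ler_wpM2l // lerXn2r ?nnegrE //.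
exact: le_trans tt.
Qed.

(** The derivative of [Gt] is [4 t Gt]; its increment over one step is the whole drift budget. *)
Lemma Gt_diff t nu : 0 <= t -> 0 <= nu -> 4 * t * Gt t * nu <= Gt (t + nu) - Gt t.
Proof.
move=> t0 nu0.
have -> : Gt (t + nu) = Gt t * expR (4 * t * nu + 2 * nu ^+ 2).
  rewrite /Gt mulrAC -expRD; congr (expR _ * _); ring.
have h := expR_ge1Dx (4 * t * nu + 2 * nu ^+ 2).
have h2 : 0 <= nu ^+ 2 by exact: sqr_ge0.
have : Gt t * (1 + 4 * t * nu) <= Gt t * expR (4 * t * nu + 2 * nu ^+ 2).
  by rewrite ler_wpM2l ?(ltW (Gt_gt0 _)) //; lra.
lra.
Qed.

Lemma time_ofS (k : nat) : time_of n k.+1%:R = time_of n k%:R + (sqn ^+ 3)^-1 :> R.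
Proof. by rewrite /time_of n32_sqn -natr1 mulrDl mul1r. Qed.

Lemma Qt_diff (k : nat) (L : R) : 1 <= L -> time_of n k%:R <= L -> 1000 * L <= sqn ->
  `|Qt n k%:R - Qt n k.+1%:R - Yt n k%:R| <= 1 :> R.
Proof.
move=> L1 tL La; have a0 := sqn_gt0; set a := sqn in a0 La.
pose i := a^-1; have i0 : 0 < i by rewrite invr_gt0.
have ai : a * i = 1 by rewrite mulfV // lt0r_neq0.
set t := time_of n k%:R in tL; have t0 : 0 <= t by rewrite divr_ge0 ?powR_ge0.
have Li : L * i <= 1 / 1000.
  by have := ler_wpM2r (ltW i0) La; rewrite ai; lra.
have ile : i <= L * i by rewrite ler_peMl // ltW.
have Li2 : (L * i) ^+ 2 <= 1 / 1000 * (1 / 1000).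
  by rewrite expr2 ler_pM //; lra.
have i2 : i ^+ 2 <= 1 / 1000 * (1 / 1000).
  by rewrite expr2 ler_pM //; lra.
have i20 : 0 <= i ^+ 2 by exact: sqr_ge0.
have i4 : i ^+ 4 <= 1 / 1000.
  have -> : i ^+ 4 = i ^+ 2 * i ^+ 2 by ring.
  by apply: le_trans (ler_pM i20 i20 i2 i2) _; lra.
have i40 : 0 <= i ^+ 4 by rewrite exprn_ge0 // ltW.
have ti : t * i <= L * i by rewrite ler_wpM2r // ltW.
have ti0 : 0 <= t * i by rewrite mulr_ge0 // ltW.
(* [z] is the increment of [4 t ^ 2] over a step of length [i ^ 3]. Its first-order effect [c2n * z]
   is [4 t a] up to a small error, which is [Yt] after multiplication by [w]. *)
pose w := expR (- 4 * t ^+ 2); pose z := 8 * t * i ^+ 3 + 4 * i ^+ 6.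
have w0 : 0 < w by rewrite expR_gt0.
have w1 : w <= 1 by rewrite -expR0 ler_expR; have := sqr_ge0 t; lra.
have E1 : Qt n k.+1%:R = w * expR (- z) * c2n.
  rewrite /Qt time_ofS -/t -/a -expRD; congr (expR _ * _); rewrite /z /i.
  by field; rewrite lt0r_neq0.
have E0 : Qt n k%:R = w * c2n by [].
have EY : Yt n k%:R = 4 * t * w * a by [].
have cz : c2n * z = 4 * t * a + 2 * i ^+ 2 - 4 * t * i - 2 * i ^+ 4.
  by rewrite c2n_sqn /z /i -/a; field; rewrite lt0r_neq0.
have ipow (j : nat) : 0 <= i ^+ j by rewrite exprn_ge0 // ltW.
have z0 : 0 <= z by apply: addr_ge0; apply: mulr_ge0 => //; apply: mulr_ge0.
have zi : z <= 12 * (L * i) * i ^+ 2.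
  have -> : z = (8 * (t * i) + 4 * (i ^+ 4)) * i ^+ 2 by rewrite /z; ring.
  rewrite ler_wpM2r //.
  have : i ^+ 4 <= 1 * i by rewrite exprSr ler_wpM2r ?(ltW i0) // exprn_ile1 ?(ltW i0)
    //; lra.
  lra.
have zh : `|- z| <= 1 / 2.
  rewrite normrN ger0_norm //; apply: (le_trans zi).
  have Li0 : 0 <= L * i := le_trans ti0 ti.
  apply: (@le_trans _ _ (12 * (L * i) * 1)); last by clear -Li; lra.
  by apply: (ler_wpM2l (mulr_ge0 (ler0n R 12) Li0)); clear -i2; lra.
have e1 := expR_ge1Dx (- z); have e2 := expR_le_quadratic zh.
have c0 := c2n_gt0.
have cz2 : c2n * z ^+ 2 <= 1 / 100.
  have c2a : c2n <= a ^+ 4.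
    rewrite c2n_sqn -/a; have : 0 <= a ^+ 2 by exact: sqr_ge0.
    have -> : a ^+ 4 = a ^+ 2 * a ^+ 2 by ring.
    have : 0 <= a ^+ 2 * a ^+ 2 by rewrite mulr_ge0 ?sqr_ge0.
    by clear; lra.
  apply: (@le_trans _ _ (a ^+ 4 * (12 * (L * i) * i ^+ 2) ^+ 2)).
    apply: ler_pM; [exact: ltW|exact: sqr_ge0|exact: c2a|].
    by rewrite lerXn2r ?nnegrE //; apply: le_trans zi.
  have -> : a ^+ 4 * (12 * (L * i) * i ^+ 2) ^+ 2 = 144 * (L * i) ^+ 2 * (a * i) ^+ 4
    by ring.
  by rewrite ai expr1n; clear -Li2; lra.
rewrite E1 E0 EY.
have W1 : w * (c2n * (1 - z)) <= w * (c2n * expR (- z)).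
  by rewrite ler_wpM2l ?(ltW w0) // ler_wpM2l ?(ltW c0).
have W2 : w * (c2n * expR (- z)) <= w * (c2n * (1 - z + 2 * z ^+ 2)).
  rewrite ler_wpM2l ?(ltW w0) // ler_wpM2l ?(ltW c0) //.
  by move: e2; rewrite sqrrN.
pose A := 2 * i ^+ 2 - 4 * t * i - 2 * i ^+ 4.
have wA1 : w * A <= 1 / 2.
  apply: (@le_trans _ _ (w * (1 / 2))); last by clear -w1; lra.
  by apply: (ler_wpM2l (ltW w0)); clear -i2 i40 ti0; rewrite /A; lra.
have wA2 : w * (A - 2 * (c2n * z ^+ 2)) >= - (1 / 2).
  apply: (@le_trans _ _ (w * (- (1 / 2)))); first by clear -w1; lra.
  by apply: (ler_wpM2l (ltW w0)); clear -i20 ti Li i4 cz2; rewrite /A; lra.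
have W1' : w * c2n - w * expR (- z) * c2n <= w * (c2n * z).
  by clear -W1; lra.
have W2' : w * (c2n * z - 2 * (c2n * z ^+ 2)) <= w * c2n - w * expR (- z) * c2n.
  by clear -W2; lra.
rewrite cz in W1' W2'; rewrite /A in wA1 wA2.
by clear -W1' W2' wA1 wA2; apply/ler_normlP; split; lra.
Qed.

End Scales.

(** * Tracking after the initial phase *)

Section Tracking.
Variables (R : realType) (n : nat).
Implicit Types (E : graph n) (t L C T : R).
Local Notation a := (sqn R n).
Local Notation q := (qin R n).
Local Notation G := (@Gt R n).
Local Notation c2 := (c2n R n).

Definition refW (i : nat) : R :=
  match i with 0%N => 1 | 1%N => 0 | _ => ln c2 end.

(* The deviation allowed for the near-martingales at time [u]: the error inherited
   from the initial phase plus a slack which absorbs the drift. *)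
Definition devW L u : R := q * L ^+ 3 / 10 ^+ 4 + G u.

Lemma Qt_expR t : (1 < n)%N -> expR (- 4 * t ^+ 2) * c2 = c2 / (G t ^+ 2 * a).
Proof.
move=> n1; rewrite Gt2 // mulNr expRN; field.
by rewrite (lt0r_neq0 (expR_gt0 _)) (lt0r_neq0 (sqn_gt0 R n1)).
Qed.

Lemma phase2_ratios E t L C : (1 < n)%N -> 1 <= t -> t ^+ 2 <= L -> 100 <= L -> 1 <= C ->
  10 ^+ 10 * C ^+ 2 * L ^+ 13 * G t <= 1 ->
  (forall i, (i < 3)%N -> `|Wf (a ^+ 3) i t E - refW i| <= devW L t) ->
  let z := G t * L ^+ 3 / 100 in
  [/\ 0 < Qn R E, `|Qn R E / (c2 / (G t ^+ 2 * a)) - 1| <= z,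
      `|Uf (a ^+ 3) E - 1| <= z, `|Vf (a ^+ 3) E / t - 1| <= z &
      z <= 1 / 100 /\ (a ^+ 2)^-1 <= z].
Proof.
move=> n1 t1 tL L100 C1 HG hW z.
have a0 := sqn_gt0 R n1; have a1 := sqn_gt1 R n1; have q0 := qin_gt0 R n1.
have G0 := Gt_gt0 n1 t; have aG := sqnV_le n1 t; have c0 := c2n_gt0 R n1.
set g := G t in hW z HG G0 aG *.
have C2 : 1 <= C ^+ 2 by rewrite exprn_ege1.
have L1 : 1 <= L by lra.
have Lpow j : 1 <= L ^+ j by rewrite exprn_ege1.
have L30 : 0 < L ^+ 3 by apply: lt_le_trans (Lpow 3%N).
have gL : 10 ^+ 10 * (g * L ^+ 3) <= 1.
  apply: le_trans HG.
  have -> : 10 ^+ 10 * C ^+ 2 * L ^+ 13 * g = C ^+ 2 * L ^+ 10 * (10 ^+ 10 * (g * L ^+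
    3)) by ring.
  have gL0 : 0 <= g * L ^+ 3 by rewrite mulr_ge0 // ltW.
  apply: ler_peMl; first by rewrite mulr_ge0 ?exprn_ge0.
  apply: mulr_ege1; [exact: C2|exact: Lpow].
have ggL : g <= g * L ^+ 3 by rewrite ler_peMr ?(ltW G0).
have gs : g <= 1 / 10 ^+ 9 by lra.
have g2 : g ^+ 2 <= 1 / 10 ^+ 9 * g by rewrite expr2 ler_wpM2r // ltW.
have aV0 : 0 < a^-1 by rewrite invr_gt0.
have aV1 : a^-1 <= 1 by rewrite invf_le1 // ltW.
have a3V : (a ^+ 3)^-1 <= a^-1.
  by rewrite -exprVn exprS ler_piMr ?(ltW aV0) // exprn_ile1 // ltW.
have a2V : (a ^+ 2)^-1 <= a^-1.
  by rewrite -exprVn expr2 ler_piMr ?(ltW aV0).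
have a30 : 0 <= (a ^+ 3)^-1 by rewrite invr_ge0 exprn_ge0 // ltW.
rewrite /devW -/g in hW; set d := _ + g in hW.
have dl : 8 * (a ^+ 3)^-1 <= d.
  have : 0 <= q * L ^+ 3 / 10 ^+ 4 by apply: divr_ge0; rewrite ?exprn_ge0 // mulr_ge0 //
    ltW.
  by rewrite /d; lra.
(* The factor [t ^ 2] lost in the inversion is free on the inherited error [q L ^ 3], because
   [e^(2t^2)] exceeds it; on the slack [g] it is paid by [t ^ 2 <= L] and [L >= 100]. *)
have tq : t ^+ 2 * q <= g.
  rewrite /g /Gt ler_wpM2r ?(ltW q0) //; have := expR_ge1Dx (2 * t ^+ 2); have := sqr_ge0
    t; lra.
have e1 : t ^+ 2 * q * L ^+ 3 <= g * L ^+ 3 by rewrite ler_wpM2r // ltW.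
have e2 : t ^+ 2 * g <= g * L ^+ 3 / 10 ^+ 4.
  apply: (@le_trans _ _ (L * g)); first by rewrite ler_wpM2r // ltW.
  have : 100 * 100 <= L ^+ 2 by rewrite expr2 ler_pM.
  move=> h; have h2 : L * g * (100 * 100) <= L * g * L ^+ 2.
    by rewrite ler_wpM2l // mulr_ge0 ?(ltW G0) //; lra.
  have -> : g * L ^+ 3 / 10 ^+ 4 = L * g * L ^+ 2 / 10 ^+ 4 by ring.
  lra.
have zd : 28 * t ^+ 2 * d <= z.
  have -> : 28 * t ^+ 2 * d = 28 * (t ^+ 2 * q * L ^+ 3) / 10 ^+ 4 + 28 * (t ^+ 2 * g).
    by rewrite /d; ring.
  have : 0 <= g * L ^+ 3 by rewrite mulr_ge0 // ltW.
  by rewrite /z; lra.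
have z1 : z <= 1 / 100 by rewrite /z; lra.
have h0 := hW 0%N isT; have h1 := hW 1%N isT; have h2 := hW 2%N isT.
rewrite /= in h0 h1 h2.
have d1 : d <= 1 / 2.
  have t2 : 1 <= t ^+ 2 by rewrite exprn_ege1.
  have : d <= t ^+ 2 * d by rewrite ler_peMl //; lra.
  lra.
(* With no open edge, division by zero gives [Uf E = 0], which is too far from 1. *)
have Q0 : 0 < Qn R E.
  rewrite lt_neqAle ler0n andbT eq_sym; apply/negP => /eqP QE.
  move: h0; rewrite /Uf QE expr0n /= mulr0 invr0 mulr0 sub0r normrN normr1; lra.
rewrite subr0 in h1.
have [r1 r2 r3] := W_to_ratios Q0 c0 t1 a30 dl (le_trans zd z1) h0 h1 h2.
rewrite Qt_expR // in r1; split=> //; [exact: le_trans zd|exact: le_trans zd|exact: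
  le_trans zd|].
by split=> //; rewrite /z; lra.
Qed.

Lemma phase2_conclusion E t L C : (1 < n)%N -> 1 <= t -> t ^+ 2 <= L -> 100 <= L -> 1 <=
  C ->
  10 ^+ 10 * C ^+ 2 * L ^+ 13 * G t <= 1 ->
  (forall i, (i < 3)%N -> `|Wf (a ^+ 3) i t E - refW i| <= devW L t) ->
  [/\ `|Qn R E / (c2 / (G t ^+ 2 * a)) - 1| <= G t * L ^+ 3,
      `|SX R E / Qn R E / (2 / G t ^+ 4) - 1| <= G t * L ^+ 3 &
      `|SY R E / Qn R E / (4 * t / G t ^+ 2) - 1| <= G t * L ^+ 3].
Proof.
move=> n1 t1 tL L100 C1 HG hW.
have [Q0 r1 u1 v1 [z1 nz]] := phase2_ratios n1 t1 tL L100 C1 HG hW.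
have a0 := sqn_gt0 R n1; have a1 := sqn_gt1 R n1; have G0 := Gt_gt0 n1 t.
have t0 : 0 < t by lra.
set z := G t * L ^+ 3 / 100 in r1 u1 v1 z1 nz.
have z0 : 0 <= z := le_trans (normr_ge0 _) u1.
have GE : G t * L ^+ 3 = 100 * z by rewrite /z; field.
have w1 : 0 <= 1 - (1 - (a ^+ 2)^-1) <= z.
  rewrite (_ : 1 - (1 - (a ^+ 2)^-1) = (a ^+ 2)^-1) ?nz ?andbT ?invr_ge0 ?sqr_ge0 //.
  by ring.
have [p1 p2] := product_near1 z1 r1 w1.
rewrite GE (avgX_ratio a0 G0 a1 Q0 (c2n_sqn R n1)) (avgY_ratio a0 G0 a1 t0 Q0 (c2n_sqn R
  n1)).
have p1' : `|Qn R E / (c2 / (G t ^+ 2 * a)) * (1 - (a ^+ 2)^-1) - 1| <= 6 * z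
  by apply: le_trans p1 _; lra.
have f1 := mul_near1 z1 u1 p2; have f2 := mul_near1 z1 v1 p1'.
split; [apply: le_trans r1 _|apply: le_trans f1 _|apply: le_trans f2 _]; lra.
Qed.

Lemma phase2_supermartingale E t L C : (1 < n)%N -> 5 <= a -> 1 <= t -> t ^+ 2 <= L ->
  100 <= L -> 1 <= C ->
  10 ^+ 10 * C ^+ 2 * L ^+ 13 * G t <= 1 -> valid E ->
  near_counts E (2 / G t ^+ 4) (4 * t / G t ^+ 2) (C * (G t * L ^+ 4)) ->
  (forall i, (i < 3)%N -> `|Wf (a ^+ 3) i t E - refW i| <= devW L t) ->
  \sum_E' step R E E' *
      hf (a ^+ 3) a refW (t + (a ^+ 3)^-1) (devW L (t + (a ^+ 3)^-1)) E' <=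
    hf (a ^+ 3) a refW t (devW L t) E.
Proof.
move=> n1 a5 t1 tL L100 C1 HG vE nc hW.
have [Q0 r1 u1 v1 [z1 nz]] := phase2_ratios n1 t1 tL L100 C1 HG hW.
have a0 := sqn_gt0 R n1; have a1 := sqn_gt1 R n1; have G0 := Gt_gt0 n1 t.
have t0 : 0 < t by lra.
set z := G t * L ^+ 3 / 100 in r1 u1 v1 z1 nz.
have tL' : 1 <= t <= L.
  by rewrite t1 /=; apply: le_trans tL; rewrite expr2 ler_peMl // ltW.
apply: (@phase2_step _ _ a (G t) t L C) => //.
- exact: sqnV_le.
(* [Qn] is at least half its trajectory; [5 <= a] lets [(a^2 - 1) / 4] dominate [a^2 / 5]. *)
- have c0 := c2n_gt0 R n1; set qt := c2 / _ in r1.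
  have qt0 : 0 < qt by rewrite divr_gt0 // mulr_gt0 ?exprn_gt0.
  have : 1 / 2 <= Qn R E / qt by move/ler_normlP: r1 => [? ?]; lra.
  rewrite ler_pdivlMr // => h; apply: le_trans h.
  have -> : a ^+ 3 / (5 * G t ^+ 2) = a ^+ 3 / 5 / (G t ^+ 2) by field; rewrite lt0r_neq0.
  have -> : 1 / 2 * qt = a * (a ^+ 2 - 1) / 4 / (G t ^+ 2).
    by rewrite /qt c2n_sqn //; field; rewrite !lt0r_neq0.
  rewrite ler_wpM2r ?invr_ge0 ?sqr_ge0 //.
  have : a * (a * a) >= a * (5 * a) by rewrite !ler_wpM2l ?ler_wpM2r // ltW.
  have : a * (5 * a) >= a * (5 * 5) by rewrite !ler_wpM2l // ltW.
  lra.
- by move/ler_normlP: u1 => [? ?]; lra.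
- have : Vf (a ^+ 3) E / t <= 2 by move/ler_normlP: v1 => [? ?]; lra.
  by rewrite ler_pdivrMr.
- have := @Gt_diff R n n1 t (a ^+ 3)^-1 (ltW t0) ltac:(by rewrite invr_ge0 exprn_ge0 //
  ltW).
  by rewrite /devW exprVn; lra.
Qed.

End Tracking.

(** * The initial phase *)

Section InitialPhase.
Variables (R : realType) (n : nat).
Implicit Types (E : graph n) (t C T : R) (k : nat).
Local Notation a := (sqn R n).
Local Notation q := (qin R n).
Local Notation G := (@Gt R n).
Local Notation c2 := (c2n R n).
Local Notation L := (ln n%:R : R).
Local Notation l52 := (L `^ (5 / 2)).
Local Notation tk k := (time_of n k%:R : R).

Lemma sqn_qin : (1 < n)%N -> a = q^-1 ^+ 2.
Proof. by move=> n1; rewrite exprVn qin2 // invrK. Qed.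

Lemma qin_lt1 : (1 < n)%N -> q < 1.
Proof.
move=> n1; have q0 := qin_gt0 R n1; rewrite -(@ltr_pXn2r _ 2) ?nnegrE ?ltW //.
by rewrite expr1n qin2 // invf_lt1 ?sqn_gt0 // sqn_gt1.
Qed.

(* [kappa] bounds the error of [Qn] gained at each step of the initial phase, and
   [delta1] the relative errors at its end. *)
Definition kappa C T : R := 6 * (expR (C * T ^+ 2) * l52) / q.
Definition delta1 C T : R := 20 * (expR ((C + 20) * T ^+ 2) * l52) * q.

Lemma expR_le_mul (x y t T : R) : 0 <= t <= T -> 0 <= y -> x <= y ->
  expR (x * t ^+ 2) <= expR (y * T ^+ 2).
Proof.
move=> /andP[t0 tT] y0 xy; rewrite ler_expR.
apply: (@le_trans _ _ (y * t ^+ 2)); first by rewrite ler_wpM2r // sqr_ge0.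
by rewrite ler_wpM2l // lerXn2r ?nnegrE // (le_trans t0).
Qed.

Lemma l52_ge1 : 1 <= L -> 1 <= l52.
Proof.
move=> L1; rewrite /powR gt_eqF; last by apply: lt_le_trans L1.
by rewrite -[X in X <= _]expR0 ler_expR mulr_ge0 // ln_ge0.
Qed.

Lemma fyYt_le C t T : (1 < n)%N -> 1 <= L -> 0 <= C -> 0 <= t <= T ->
  fy n C t * Yt n (n32 R n) <= 4 * (expR (C * T ^+ 2) * l52) / q.
Proof.
move=> n1 L1 C0 tT; have q0 := qin_gt0 R n1; have a0 := sqn_gt0 R n1.
have N0 : n32 R n != 0 by rewrite n32_sqn // expf_neq0 // lt0r_neq0.
have l1 := l52_ge1 L1.
have -> : fy n C t * Yt n (n32 R n) =
    4 * (expR (C * t ^+ 2) * l52) / q * expR (- 4 * 1 ^+ 2).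
  rewrite /fy /Yt /time_of divff // -/q -/a sqn_qin //; field.
  exact: lt0r_neq0.
have e1 : expR (- 4 * 1 ^+ 2) <= 1 :> R by rewrite -[X in _ <= X]expR0 ler_expR expr1n; lra.
have e2 := expR_le_mul tT C0 (lexx C).
have l0 : 0 <= l52 by lra.
have e3 : expR (C * t ^+ 2) * l52 <= expR (C * T ^+ 2) * l52 by rewrite ler_wpM2r.
have qV : 0 < q^-1 by rewrite invr_gt0.
apply: (@le_trans _ _ (4 * (expR (C * t ^+ 2) * l52) / q * 1)).
  by rewrite ler_wpM2l // divr_ge0 ?(ltW q0) // !mulr_ge0 ?expR_ge0.
by rewrite mulr1 ler_wpM2r ?(ltW qV) //; lra.
Qed.

(** No probability enters: [Y_e] is controlled for every open [e], so each possible choice keeps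
    [Qn] near [Qt]. The 6 in [kappa] is 4 from the event, 1 for [e] itself and 1 from [Qt_diff]. *)
Lemma phase1_step E e k C T : (1 < n)%N -> 1 <= L -> 0 <= C -> tk k <= T -> T <= L ->
  1000 * L <= a -> valid E -> e \in open_edges E ->
  in_pm ((Ycount E e)%:R) (Yt n k%:R) (fy n C (tk k) * Yt n (n32 R n)) ->
  `|Qn R E - Qt n k%:R| <= k%:R * kappa C T ->
  `|Qn R (e |: E)%SET - Qt n k.+1%:R| <= k.+1%:R * kappa C T.
Proof.
move=> n1 L1 C0 tT TL La vE eO /andP[y1 y2] /ler_normlP[h1 h2].
have q0 := qin_gt0 R n1; have q1 := qin_lt1 n1; have l1 := l52_ge1 L1.
have t0 : 0 <= tk k by rewrite divr_ge0 ?powR_ge0.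
have tT' : 0 <= tk k <= T by rewrite t0.
have f1 := fyYt_le n1 L1 C0 tT'.
have /ler_normlP[d1 d2] := Qt_diff n1 L1 (le_trans tT TL) La.
have M1 : 1 <= expR (C * T ^+ 2) by rewrite -[X in X <= _]expR0 ler_expR mulr_ge0 ?sqr_ge0.
have ML : 1 <= expR (C * T ^+ 2) * l52 by exact: mulr_ege1.
have MLq : 1 <= expR (C * T ^+ 2) * l52 / q by rewrite ler_pdivlMr //; lra.
rewrite (Qn_add R vE eO).
have -> : k.+1%:R * kappa C T = k%:R * kappa C T + kappa C T by rewrite -natr1 mulrDl mul1r.
have kE : kappa C T = 6 * (expR (C * T ^+ 2) * l52 / q) by rewrite /kappa; ring.
apply/ler_normlP; split; lra.
Qed.

Lemma phase1_ratio E k C T : (1 < n)%N -> 1 <= L -> 0 <= C -> 0 <= T -> 5 <= a ->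
  k%:R <= T * n32 R n ->
  `|Qn R E - Qt n k%:R| <= k%:R * kappa C T ->
  `|Qn R E / Qt n k%:R - 1| <= delta1 C T.
Proof.
move=> n1 L1 C0 T0 a5 kT h.
have q0 := qin_gt0 R n1; have q1 := qin_lt1 n1; have l1 := l52_ge1 L1.
have a0 := sqn_gt0 R n1; have qV : 0 < q^-1 by rewrite invr_gt0.
have N0 : 0 < n32 R n by rewrite n32_sqn // exprn_gt0.
have t0 : 0 <= tk k by rewrite divr_ge0 ?powR_ge0.
have tT : tk k <= T by rewrite /time_of ler_pdivrMr.
have Q0 : 0 < Qt n k%:R :> R by rewrite mulr_gt0 ?expR_gt0 // c2n_gt0.
have -> : Qn R E / Qt n k%:R - 1 = (Qn R E - Qt n k%:R) / Qt n k%:R.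
  by field; exact: lt0r_neq0.
rewrite normrM [`|_^-1|]gtr0_norm ?invr_gt0 // ler_pdivrMr //.
apply: (le_trans h).
pose M := expR (C * T ^+ 2) * l52.
have M0 : 0 < M by rewrite mulr_gt0 ?expR_gt0 //; lra.
apply: (@le_trans _ _ (T * q^-1 ^+ 6 * (6 * M / q))).
  rewrite (_ : kappa C T = 6 * M / q) //; apply: ler_wpM2r; first
    by have := divr_gt0 M0 q0; lra.
  by apply: le_trans kT _; rewrite n32_sqn // sqn_qin // -exprM.
(* The 20 in the exponent of [delta1] is this 16, which absorbs the number of steps, plus the 4 lost
   by dividing by [Qt]. *)
have Tle : T <= expR (16 * T ^+ 2).
  have := expR_ge1Dx (16 * T ^+ 2); have := sqr_ge0 (T - 1); rewrite sqrrB expr1n mulr1.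
  by have := sqr_ge0 T; lra.
have Qge : expR (- 4 * T ^+ 2) * (2 / 5 * q^-1 ^+ 8) <= Qt n k%:R.
  apply: ler_pM; rewrite ?expR_ge0 //.
  - by rewrite mulr_ge0 ?exprn_ge0 ?(ltW qV).
  - have T2 : tk k ^+ 2 <= T ^+ 2 by rewrite lerXn2r ?nnegrE.
    by rewrite ler_expR; lra.
  rewrite -/(c2n R n) c2n_sqn // (_ : q^-1 ^+ 8 = a ^+ 4); last
    by rewrite sqn_qin // -exprM.
  have : a * a >= 5 * 5 by rewrite ler_pM.
  move=> aa; have : a ^+ 2 * (a * a) >= a ^+ 2 * (5 * 5) by rewrite ler_wpM2l ?sqr_ge0.
  have : 0 <= a ^+ 2 by exact: sqr_ge0.
  lra.
have d0 : 0 <= delta1 C T.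
  by rewrite /delta1 !mulr_ge0 ?expR_ge0 ?(ltW q0) //; lra.
apply: le_trans (ler_wpM2l d0 Qge).
have -> : delta1 C T * (expR (- 4 * T ^+ 2) * (2 / 5 * q^-1 ^+ 8)) =
   expR (16 * T ^+ 2) * q^-1 ^+ 6 * (8 * M / q).
  rewrite /delta1 /M.
  have -> : expR ((C + 20) * T ^+ 2) = expR (C * T ^+ 2) * expR (16 * T ^+ 2) * expR (4 *
    T ^+ 2).
    by rewrite -!expRD; congr expR; ring.
  rewrite mulNr expRN; field.
  by rewrite (lt0r_neq0 (expR_gt0 _)) lt0r_neq0.
apply: ler_pM.
- by rewrite mulr_ge0 // exprn_ge0 // ltW.
- by rewrite divr_ge0 ?(ltW q0) // mulr_ge0 // ltW.
- by rewrite ler_wpM2r // exprn_ge0 // ltW.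
- by rewrite ler_wpM2r ?(ltW qV) //; lra.
Qed.

(** The absolute errors of the initial phase become relative: dividing by [Xt] costs [e^(8t^2)],
    half of it saved in [fx], and dividing by [Yt] costs [e^(4t^2) / t], whence the bound
    [1 <= t]. *)
Lemma phase1_near E k C T : (1 < n)%N -> 1 <= L -> 0 <= C -> 1 <= tk k <= T ->
  (forall e, e \in open_edges E ->
    in_pm ((Xcount E e)%:R) (Xt n k%:R) (fx n C (tk k) * Xt n (n32 R n)) /\
    in_pm ((Ycount E e)%:R) (Yt n k%:R) (fy n C (tk k) * Yt n (n32 R n))) ->
  near_counts E (2 / G (tk k) ^+ 4) (4 * tk k / G (tk k) ^+ 2) (delta1 C T).
Proof.
move=> n1 L1 C0 /andP[t1 tT] H e eO; have [hx hy] := H e eO.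
have q0 := qin_gt0 R n1; have q1 := qin_lt1 n1; have l1 := l52_ge1 L1.
have a0 := sqn_gt0 R n1; have qV : 0 < q^-1 by rewrite invr_gt0.
have tT' : 0 <= tk k <= T by rewrite tT andbT; lra.
have n0 : 0 <= n%:R :> R by [].
have N0 : n32 R n != 0 by rewrite n32_sqn // expf_neq0 // lt0r_neq0.
rewrite -Xt_Gt // -Yt_Gt //.
have pm (x y d d' : R) : in_pm x y d -> d <= d' -> `|x - y| <= d'.
  by move=> /andP[? ?] ?; apply/ler_normlP; split; lra.
set t := tk k in t1 tT tT' hx hy *.
have l0 : 0 < l52 by lra.
split; [apply: (pm _ _ _ _ hx)|apply: (pm _ _ _ _ hy)].
  have -> : fx n C t * Xt n (n32 R n) =
     expR (- 8 * t ^+ 2) * n%:R * 2 * l52 * q * (expR ((C + 4) * t ^+ 2) * expR (- 8 * 1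
       ^+ 2)).
    rewrite /fx /fy /Xt /time_of divff // -/q.
    have -> : expR ((C + 4) * t ^+ 2) = expR (C * t ^+ 2) * expR (8 * t ^+ 2) / expR (4 *
      t ^+ 2).
      by rewrite -expRD -expRB; congr expR; ring.
    have -> : expR (- 4 * t ^+ 2) = (expR (4 * t ^+ 2))^-1
      by rewrite -expRN; congr expR; ring.
    have -> : expR (- 8 * t ^+ 2) = (expR (8 * t ^+ 2))^-1
      by rewrite -expRN; congr expR; ring.
    by field; rewrite !lt0r_neq0 ?expR_gt0.
  have -> : delta1 C T * Xt n k%:R = expR (- 8 * t ^+ 2) * n%:R * 2 * l52 * q *
    (20 * expR ((C + 20) * T ^+ 2)) by rewrite /delta1 /Xt -/t; ring.
  apply: ler_wpM2l; first by rewrite !mulr_ge0 ?expR_ge0 ?(ltW l0) ?(ltW q0).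
  have e1 : expR ((C + 4) * t ^+ 2) <= expR ((C + 20) * T ^+ 2).
    by apply: expR_le_mul => //; lra.
  have e2 : expR (- 8 * 1 ^+ 2) <= 1 :> R by rewrite -[X in _ <= X]expR0 ler_expR expr1n;
    lra.
  have e0 := expR_gt0 ((C + 20) * T ^+ 2).
  apply: (@le_trans _ _ (expR ((C + 20) * T ^+ 2) * 1)); last lra.
  by apply: ler_pM; rewrite ?expR_ge0.
apply: (le_trans (fyYt_le n1 L1 C0 tT')).
have -> : delta1 C T * Yt n k%:R = 4 * (l52 / q) * (20 * t * expR ((C + 20) * T ^+ 2) *
  expR (- 4 * t ^+ 2)).
  by rewrite /delta1 /Yt -/a sqn_qin // -/t; field; rewrite lt0r_neq0.
have -> : 4 * (expR (C * T ^+ 2) * l52) / q = 4 * (l52 / q) * expR (C * T ^+ 2) by ring.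
apply: ler_wpM2l; first by rewrite mulr_ge0 // divr_ge0 // ltW.
have -> : 20 * t * expR ((C + 20) * T ^+ 2) * expR (- 4 * t ^+ 2) =
  20 * t * (expR ((C + 20) * T ^+ 2) * expR (- 4 * t ^+ 2)) by ring.
apply: (@le_trans _ _ (1 * expR (C * T ^+ 2))); first by rewrite mul1r.
apply: ler_pM; rewrite ?expR_ge0 //; first lra.
rewrite -expRD ler_expR.
have : t ^+ 2 <= T ^+ 2 by rewrite lerXn2r ?nnegrE //; case/andP: tT' => ? ?; lra.
have := sqr_ge0 T; lra.
Qed.

(** [L^(5/2)] times [sqrt L] is [L^3], so the hypothesis trades every factor depending on [T] for a
    half power of [L]. Raising [C + 20] to [C + 21] absorbs [T ^ 2]. *)
Lemma delta1_le C T : (1 < n)%N -> 1 <= L -> 0 <= C ->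
  10 ^+ 8 * expR ((C + 21) * T ^+ 2) <= Num.sqrt L ->
  140 * T ^+ 2 * delta1 C T <= q * L ^+ 3 / 10 ^+ 4 /\
  delta1 C T <= q * L ^+ 3 / 10 ^+ 4.
Proof.
move=> n1 L1 C0 H; have q0 := qin_gt0 R n1; have l1 := l52_ge1 L1.
have L3 : l52 * Num.sqrt L = L ^+ 3.
  have L0 : 0 < L by lra.
  have -> : Num.sqrt L = L `^ (2^-1) by rewrite powR12_sqrt // ltW.
  rewrite -powRD; last by rewrite (gt_eqF L0) implybT.
  have -> : 5 / 2 + 2^-1 = 3%:R :> R by field.
  by rewrite powR_mulrn // ltW.
have M21 : expR ((C + 21) * T ^+ 2) = expR ((C + 20) * T ^+ 2) * expR (T ^+ 2).
  by rewrite -expRD; congr expR; ring.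
have l0 : 0 < l52 by lra.
have h : 10 ^+ 8 * expR ((C + 21) * T ^+ 2) * (l52 * q) <= Num.sqrt L * (l52 * q).
  by rewrite ler_wpM2r // mulr_ge0 // ltW.
rewrite (_ : Num.sqrt L * (l52 * q) = q * L ^+ 3) in h; last by rewrite -L3; ring.
have e0 := expR_gt0 ((C + 20) * T ^+ 2).
have pos : 0 < expR ((C + 20) * T ^+ 2) * l52 * q by rewrite !mulr_gt0.
have e1 := expR_ge1Dx (T ^+ 2).
have T2 : 0 <= T ^+ 2 by exact: sqr_ge0.
have h1 : T ^+ 2 * (expR ((C + 20) * T ^+ 2) * l52 * q) <=
   expR (T ^+ 2) * (expR ((C + 20) * T ^+ 2) * l52 * q).
  by rewrite ler_wpM2r ?(ltW pos) //; lra.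
have h2 : 1 * (expR ((C + 20) * T ^+ 2) * l52 * q) <=
   expR (T ^+ 2) * (expR ((C + 20) * T ^+ 2) * l52 * q).
  by rewrite ler_wpM2r ?(ltW pos) //; lra.
rewrite M21 in h; rewrite /delta1; split; lra.
Qed.

Lemma phase1_end E k C T : (1 < n)%N -> 1 <= L -> 0 <= C -> 1 <= tk k <= T -> 0 < Qn R E ->
  10 ^+ 8 * expR ((C + 21) * T ^+ 2) <= Num.sqrt L -> q * L ^+ 3 <= 1 ->
  near_counts E (2 / G (tk k) ^+ 4) (4 * tk k / G (tk k) ^+ 2) (delta1 C T) ->
  `|Qn R E / Qt n k%:R - 1| <= delta1 C T ->
  forall i, (i < 3)%N -> `|Wf (a ^+ 3) i (tk k) E - refW R n i| <= q * L ^+ 3 / 10 ^+ 4.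
Proof.
move=> n1 L1 C0 /andP[t1 tT] Q0 H qL nc r1.
have [dT dL] := delta1_le n1 L1 C0 H.
have q0 := qin_gt0 R n1; have q1 := qin_lt1 n1; have l1 := l52_ge1 L1.
have a0 := sqn_gt0 R n1; have a1 := sqn_gt1 R n1; have c0 := c2n_gt0 R n1.
have G0 := Gt_gt0 n1 (tk k).
set t := tk k in t1 tT nc G0 *; set d := delta1 C T in dT dL nc r1.
have t0 : 0 < t by lra.
have qd : q <= d.
  have M1 : 1 <= expR ((C + 20) * T ^+ 2).
    by rewrite -[X in X <= _]expR0 ler_expR mulr_ge0 ?sqr_ge0 //; lra.
  have ML : 1 <= expR ((C + 20) * T ^+ 2) * l52 by exact: mulr_ege1.
  have := ler_wpM2r (ltW q0) ML; rewrite /d /delta1; lra.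
have d1 : d <= 1 / 1000 by lra.
have d1' : d <= 1 / 100 by lra.
have aV : a^-1 = q ^+ 2 by rewrite qin2.
have a2d : (a ^+ 2)^-1 <= d.
  by rewrite -exprVn aV -exprM; apply: le_trans qd; rewrite exprS ler_piMr ?exprn_ile1 //
    ltW.
have a3d : (a ^+ 3)^-1 <= d.
  by rewrite -exprVn aV -exprM; apply: le_trans qd; rewrite exprS ler_piMr ?exprn_ile1 //
    ltW.
have w1 : 0 <= 1 - (1 - (a ^+ 2)^-1) <= d.
  rewrite (_ : 1 - (1 - (a ^+ 2)^-1) = (a ^+ 2)^-1) ?a2d ?andbT ?invr_ge0 ?sqr_ge0 //.
  by ring.
have r1' := r1; rewrite Qt_Gt // -/t in r1'.
have [p1 p2] := product_near1 d1' r1' w1.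
have p1' : `|Qn R E / (c2 / (G t ^+ 2 * a)) * (1 - (a ^+ 2)^-1) - 1| <= 6 * d
  by apply: le_trans p1 _; lra.
have rel (x s : R) : 0 < x -> `|s - x| <= d * x -> `|s / x - 1| <= d.
  move=> x0 hs; have -> : s / x - 1 = (s - x) / x by field; exact: lt0r_neq0.
  by rewrite normrM [`|_^-1|]gtr0_norm ?invr_gt0 // ler_pdivrMr.
have x0 : 0 < 2 / G t ^+ 4 by rewrite divr_gt0 ?exprn_gt0.
have y0 : 0 < 4 * t / G t ^+ 2 by apply: divr_gt0; [apply: mulr_gt0|apply: exprn_gt0].
have uX := rel _ _ x0 (mean_near Q0 (fun e eO => (nc e eO).1)).
have uY := rel _ _ y0 (mean_near Q0 (fun e eO => (nc e eO).2)).
have U1 := div_near1 d1' (avgX_ratio a0 G0 a1 Q0 (c2n_sqn R n1)) uX p2.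
have V1 := div_near1 d1' (avgY_ratio a0 G0 a1 t0 Q0 (c2n_sqn R n1)) uY p1'.
have a30 : 0 <= (a ^+ 3)^-1 by rewrite invr_ge0 exprn_ge0 // ltW.
have r1'' := r1'; rewrite -Qt_expR // in r1''.
have [w0 w2 w3] := ratios_to_W Q0 c0 t1 a30 a3d d1 r1'' U1 V1.
have fin : 140 * t ^+ 2 * d <= q * L ^+ 3 / 10 ^+ 4.
  apply: le_trans dT; apply: (ler_wpM2r (le_trans (ltW q0) qd)).
  apply: (ler_wpM2l (ler0n R 140)).
  by rewrite lerXn2r ?nnegrE ?(ltW t0) // (le_trans (ltW t0)).
case=> [|[|[|//]]] _ /=.
- exact: le_trans fin.
- by rewrite subr0; exact: le_trans fin.
- exact: le_trans fin.
Qed.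

End InitialPhase.

(** * Assembly *)

Section FixedSize.
Variables (R : realType) (n : nat) (C T : R).
Implicit Types (E : graph n) (k m : nat).
Local Notation a := (sqn R n).
Local Notation q := (qin R n).
Local Notation G := (@Gt R n).
Local Notation c2 := (c2n R n).
Local Notation L := (ln n%:R : R).
Local Notation tk k := (time_of n k%:R : R).

(** Both events are conjunctions over time of a condition on the current graph; this is that
    condition, with [T] for the value of [omega]. *)
Definition okXY k E : bool :=
  [forall e in open_edges E,
    let x := (Xcount E e)%:R in let t := tk k in
    if k%:R <= T * n32 R n then in_pm x (Xt n k%:R) (fx n C t * Xt n (n32 R n))
    else in_pm x (Xt n k%:R) (gx n C t * Xt n k%:R)] &&
  [forall e in open_edges E,
    let y := (Ycount E e)%:R in let t := tk k in
    if k%:R <= T * n32 R n then in_pm y (Yt n k%:R) (fy n C t * Yt n (n32 R n))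
    else in_pm y (Yt n k%:R) (gy n t * Yt n k%:R)].

Lemma events_ok m (H : trajectory n m) :
  eventX C T m.-1 H -> eventY C T m.-1 H -> ok_before okXY H.
Proof.
move=> /forallP hX /forallP hY; apply/forallP => k; apply/implyP => km.
have km' : (k <= m.-1)%N by case: m H k km hX hY => // p H k km _ _.
have /implyP/(_ km') := hX k; have /implyP/(_ km') := hY k.
by move=> h1 h2; apply/andP; split.
Qed.

(** Six exponentials at rate [sqrt n], each starting with a gap of at least [n^(-1/4)]. *)
Definition eta : R := 6 * expR (- (a * q)).

(* Bounds the probability that a trajectory in state [E] at time [k] satisfies the
   events and yet ends outside the claimed range; [m0] is the last step of the
   initial phase. *)
Definition bnd m0 k E : R :=
  if ~~ valid E then 1 else
  if (k <= m0)%N then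
    if `|Qn R E - Qt n k%:R| <= k%:R * kappa n C T then eta else 1
  else Num.min 1 (hf (a ^+ 3) a (refW R n) (tk k) (devW n L (tk k)) E).

Hypotheses (n1 : (1 < n)%N) (L100 : 100 <= L) (La : 1000 * L <= a) (C1 : 1 <= C)
  (T2 : 2 <= T) (HA : 10 ^+ 8 * expR ((C + 21) * T ^+ 2) <= Num.sqrt L)
  (eta1 : eta <= 1).

Lemma eta_ge0 : 0 <= eta. Proof. by rewrite mulr_ge0 ?expR_ge0. Qed.

Lemma bnd_ge0 m0 k E : 0 <= bnd m0 k E.
Proof.
rewrite /bnd; case: ifP => // _; case: ifP => _; first by case: ifP => // _; exact: eta_ge0.
by rewrite le_min ler01 hf_ge0.
Qed.

Lemma bnd_le1 m0 k E : bnd m0 k E <= 1.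
Proof.
rewrite /bnd; case: ifP => // _; case: ifP => _; first by case: ifP => // _; exact: eta1.
by rewrite ge_min lexx.
Qed.

(** Because [bnd] is capped at 1, nothing is to be proved at states where it equals 1; the drift
    estimates are needed only where the invariants hold. *)
Lemma step_bnd_le1 m0 k E : \sum_E' step R E E' * bnd m0 k E' <= 1.
Proof.
rewrite -(sum_step1 R E); apply: ler_sum => E' _.
by rewrite ler_piMr ?step_ge0 ?bnd_le1.
Qed.

Variables (m m0 : nat).
Hypotheses (m0T : m0%:R <= T * n32 R n) (Tm0 : T * n32 R n < m0.+1%:R)
  (Tm : T * n32 R n < m%:R) (tm : tk m ^+ 2 <= L)
  (HG : 10 ^+ 10 * C ^+ 2 * L ^+ 13 * G (tk m) <= 1).

Let L1 : 1 <= L. Proof. by have := L100; lra. Qed.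
Let C0 : 0 <= C. Proof. by have := C1; lra. Qed.
Let a5 : 5 <= a. Proof. by have := La; have := L100; lra. Qed.
Let N0 : 0 < n32 R n. Proof. by rewrite n32_sqn // exprn_gt0 // sqn_gt0. Qed.

Let tk_mono k j : (k <= j)%N -> tk k <= tk j.
Proof. by move=> kj; rewrite ler_wpM2r ?invr_ge0 ?(ltW N0) // ler_nat. Qed.

Let tk0 k : 0 <= tk k. Proof. by rewrite divr_ge0 // ltW. Qed.

Let tkT k : (k <= m0)%N -> tk k <= T.
Proof.
move=> km; apply: le_trans (tk_mono km) _; by rewrite ler_pdivrMr.
Qed.

Let tm0 : 1 <= tk m0.
Proof.
have h : T < tk m0.+1 by rewrite ltr_pdivlMr.
rewrite time_ofS // in h.
have : (a ^+ 3)^-1 <= 1.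
  by rewrite -n32_sqn // invf_le1 // n32_sqn // exprn_ege1 // ltW // sqn_gt1.
by have := T2; lra.
Qed.

Let tk1 k : (m0 <= k)%N -> 1 <= tk k.
Proof. by move=> km; apply: le_trans tm0 (tk_mono km). Qed.

Let tkL k : (k <= m)%N -> tk k ^+ 2 <= L.
Proof. by move=> km; apply: le_trans tm; rewrite lerXn2r ?nnegrE ?tk_mono. Qed.

Let TL : T <= L.
Proof.
have h : T < tk m by rewrite ltr_pdivlMr.
have : tk m <= tk m ^+ 2 by rewrite expr2 ler_peMl ?tk0 //; have := T2; lra.
by have := tm; lra.
Qed.

Let C2L k : 0 <= 10 ^+ 10 * C ^+ 2 * L ^+ k.
Proof. by rewrite !mulr_ge0 ?exprn_ge0 //; have := C0; have := L1; lra. Qed.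

Let HGk k : (k <= m)%N -> 10 ^+ 10 * C ^+ 2 * L ^+ 13 * G (tk k) <= 1.
Proof.
by move=> km; apply: le_trans HG; rewrite ler_wpM2l ?C2L // Gt_mono ?tk0 ?tk_mono.
Qed.

Let qL3 : q * L ^+ 3 <= 1.
Proof.
have h0 : (1 : R) <= 10 ^+ 10 * C ^+ 2 * L ^+ 10.
  apply: mulr_ege1; last by rewrite exprn_ege1.
  by apply: mulr_ege1; rewrite exprn_ege1 //; lra.
apply: le_trans (HGk (leqnn m)).
have -> : 10 ^+ 10 * C ^+ 2 * L ^+ 13 * G (tk m) =
  (10 ^+ 10 * C ^+ 2 * L ^+ 10) * (G (tk m) * L ^+ 3) by ring.
have L3 : 0 <= L ^+ 3 by rewrite exprn_ge0 //; have := L1; lra.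
apply: (@le_trans _ _ (G (tk m) * L ^+ 3)).
  by rewrite ler_wpM2r // Gt_ge_qin.
by rewrite ler_peMl // mulr_ge0 // ltW // Gt_gt0.
Qed.

Lemma okXY_late k E : (m0 < k)%N -> okXY k E ->
  near_counts E (2 / G (tk k) ^+ 4) (4 * tk k / G (tk k) ^+ 2) (C * (G (tk k) * L ^+ 4)).
Proof.
move=> mk /andP[/forallP hX /forallP hY] e eO.
have kT : (k%:R <= T * n32 R n) = false.
  by apply/negbTE; rewrite -ltNge; apply: lt_le_trans Tm0 _; rewrite ler_nat.
have /implyP/(_ eO) := hX e; have /implyP/(_ eO) := hY e; rewrite /= kT => h1 h2.
have G0 := Gt_gt0 n1 (tk k).
rewrite -Xt_Gt // -Yt_Gt //.
have Y0 : 0 <= Yt n k%:R :> R.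
  rewrite Yt_Gt //; apply: divr_ge0; last by rewrite exprn_ge0 // ltW.
  by apply: mulr_ge0.
have gxE : gx n C (tk k) = C * (G (tk k) * L ^+ 4) by [].
split; first by rewrite gxE in h2; move/andP: h2 => [? ?]; apply/ler_normlP; split; lra.
have g1 : gy n (tk k) * Yt n k%:R <= C * (G (tk k) * L ^+ 4) * Yt n k%:R.
  apply: ler_wpM2r => //; rewrite (_ : gy n (tk k) = G (tk k) * L ^+ 4) //.
  apply: ler_peMl; last exact: C1.
  by apply: mulr_ge0; [exact: ltW|rewrite exprn_ge0 //; have := L1; lra].
by move/andP: h1 => [? ?]; apply/ler_normlP; split; lra.
Qed.

Lemma okXY_early k E : (k <= m0)%N -> okXY k E -> forall e, e \in open_edges E ->
    in_pm ((Xcount E e)%:R) (Xt n k%:R) (fx n C (tk k) * Xt n (n32 R n)) /\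
    in_pm ((Ycount E e)%:R) (Yt n k%:R) (fy n C (tk k) * Yt n (n32 R n)).
Proof.
move=> mk /andP[/forallP hX /forallP hY] e eO.
have kT : k%:R <= T * n32 R n.
  by apply: le_trans m0T; rewrite ler_nat.
by have /implyP/(_ eO) := hX e; have /implyP/(_ eO) := hY e; rewrite /= kT => h1 h2.
Qed.

Lemma early_ratio k E : (k <= m0)%N ->
  `|Qn R E - Qt n k%:R| <= k%:R * kappa n C T ->
  `|Qn R E / Qt n k%:R - 1| <= delta1 n C T.
Proof.
move=> km h; apply: phase1_ratio => //; first by have := T2; lra.
by apply: le_trans m0T; rewrite ler_nat.
Qed.

Lemma early_Qn_gt0 k E : (k <= m0)%N ->
  `|Qn R E - Qt n k%:R| <= k%:R * kappa n C T -> 0 < Qn R E.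
Proof.
move=> km h; have /ler_normlP[h1 h2] := early_ratio km h.
have [_ dL] := delta1_le n1 L1 C0 HA; have := qL3 => qL.
have Q0 : 0 < Qt n k%:R :> R by rewrite mulr_gt0 ?expR_gt0 // c2n_gt0.
have : 0 < Qn R E / Qt n k%:R by lra.
by rewrite pmulr_lgt0 // invr_gt0.
Qed.

Lemma bnd_step k E : (k < m)%N -> okXY k E ->
  \sum_E' step R E E' * bnd m0 k.+1 E' <= bnd m0 k E.
Proof.
move=> km ok; rewrite {2}/bnd; case: ifPn => [_|]; first exact: step_bnd_le1.
rewrite negbK => vE.
have late j F : (m0 < j)%N -> bnd m0 j F <= Num.min 1 (hf (a ^+ 3) a (refW R n) (tk j)
  (devW n L (tk j)) F)
    \/ ~~ valid F.
  by move=> mj; rewrite /bnd; case: (valid F) => /=; [left; rewrite leqNgt mj|right].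
have sum_late : (m0 <= k)%N -> 0 < Qn R E ->
    \sum_E' step R E E' * bnd m0 k.+1 E' <=
    \sum_E' step R E E' * hf (a ^+ 3) a (refW R n) (tk k.+1) (devW n L (tk k.+1)) E'.
  move=> mk Q0; rewrite !sum_step_mean //; apply: ler_mean => // e eO.
  have [h|] := late k.+1 (e |: E)%SET mk; last by rewrite (valid_add vE eO).
  by apply: le_trans h _; rewrite ge_min lexx orbT.
case: ifPn => [km0|].
  case: ifPn => [inv|_]; last exact: step_bnd_le1.
  have Q0 := early_Qn_gt0 km0 inv.
  move: (km0); rewrite leq_eqVlt => /orP[/eqP kE|km0'].
    (* The crossing: at time [m0] the early bounds still hold, but the step leads into the second
       phase. They are stronger than the late ones, so the exponential bound can be started here,
       where the deviation is below [devW] by [G >= q]. *)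
    have mk : (m0 <= k)%N by rewrite kE.
    have tT : 1 <= tk k <= T by rewrite tk1 //= tkT.
    have nc1 := phase1_near n1 L1 C0 tT (okXY_early km0 ok).
    have [dT dL] := delta1_le n1 L1 C0 HA.
    have hW := phase1_end n1 L1 C0 tT Q0 HA qL3 nc1 (early_ratio km0 inv).
    have G0 := Gt_gt0 n1 (tk k); have := Gt_ge_qin n1 (tk k) => qG.
    have q0 := qin_gt0 R n1.
    have L30 : 0 <= L ^+ 3 by rewrite exprn_ge0 //; have := L1; lra.
    have qL0 : 0 <= q * L ^+ 3 / 10 ^+ 4 by have := mulr_ge0 (ltW q0) L30; lra.
    apply: le_trans (sum_late mk Q0) _; rewrite time_ofS //.
    apply: le_trans (phase2_supermartingale n1 a5 (tk1 mk) (tkL (ltnW km)) L100 C1 (HGk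
      (ltnW km)) vE _ _) _.
    - move=> e eO; have [h1 h2] := nc1 e eO.
      have dg : delta1 n C T <= C * (G (tk k) * L ^+ 4).
        apply: (le_trans dL).
        have e1 : q * L ^+ 3 <= G (tk k) * L ^+ 3 by rewrite ler_wpM2r.
        have e2 : G (tk k) * L ^+ 3 <= G (tk k) * L ^+ 4.
          by rewrite ler_wpM2l ?(ltW G0) // exprS ler_peMl.
        have e3 : G (tk k) * L ^+ 4 <= C * (G (tk k) * L ^+ 4).
          by rewrite ler_peMl // mulr_ge0 ?(ltW G0) ?exprn_ge0 //; have := L1; lra.
        have := mulr_ge0 (ltW q0) L30; lra.
      split; [apply: le_trans h1 _|apply: le_trans h2 _]; rewrite ler_wpM2r //.
        by rewrite divr_ge0 ?exprn_ge0 ?(ltW G0).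
      by apply: divr_ge0; [apply: mulr_ge0|rewrite exprn_ge0 // ltW].
    - by move=> i i3; apply: le_trans (hW i i3) _; rewrite /devW; lra.
    apply: le_trans (hf_le _ (sqn_gt0 R n1) hW) _.
    rewrite ler_wpM2l // ler_expR /devW.
    have -> : q * L ^+ 3 / 10 ^+ 4 - (q * L ^+ 3 / 10 ^+ 4 + G (tk k)) = - G (tk k) by ring.
    by rewrite mulrN lerN2 ler_wpM2l // ltW // sqn_gt0.
  (* Before [m0] every choice of [e] preserves the invariant, so the bound stays equal to [eta]. *)
  rewrite sum_step_mean //.
  rewrite (@eq_mean _ _ _ _ (fun=> eta)); first by rewrite mean_cst.
  move=> e eO; rewrite /bnd (valid_add vE eO) /= km0'.
  have [_ hy] := okXY_early km0 ok eO.
  by rewrite (phase1_step n1 L1 C0 (tkT km0) TL La vE eO hy inv).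
rewrite -ltnNge => mk; rewrite le_min step_bnd_le1 /=.
(* No separate stopping time for the deviations is needed: if [h >= 1] the cap applies, and if
   [h < 1] that inequality itself puts the three processes in range, so the step estimates are
   available. *)
set h := hf _ _ _ _ _ E; case: (lerP 1 h) => h1.
  exact: le_trans (step_bnd_le1 _ _ _) h1.
have hW := hf_lt1 (sqn_gt0 R n1) h1.
have [Q0 _ _ _ _] := phase2_ratios n1 (tk1 (ltnW mk)) (tkL (ltnW km)) L100 C1 (HGk (ltnW
  km)) hW.
apply: le_trans (sum_late (ltnW mk) Q0) _; rewrite time_ofS //.
exact: (phase2_supermartingale n1 a5 (tk1 (ltnW mk)) (tkL (ltnW km)) L100 C1
  (HGk (ltnW km)) vE (okXY_late mk ok) hW).
Qed.

Lemma bnd0 : bnd m0 0 finset.set0 = eta.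
Proof.
rewrite /bnd valid0 /= mul0r /Qn /Qt /time_of mul0r expr0n /= mulr0 expR0 mul1r.
have -> : open_edges (finset.set0 : graph n) = pairs n.
  apply/setP => e; rewrite [LHS]finset.in_set finset.in_set0 /=.
  case: (boolP (e \in pairs n)) => //= ep.
  apply/forallP => v; apply/negP => /fintype.subsetP sub.
  by move/pairsP: ep => [u [u' [_ eE]]]; have := sub u; rewrite eE !inE eqxx => /(_ isT).
have -> : #|pairs n| = 'C(n, 2).
  by rewrite -[n in RHS]card_ord -card_draws.
by rewrite subrr normr0 lexx.
Qed.

Lemma Prob_fixed_size :
  1 - eta <=
    Prob R (fun H : trajectory n m =>
      ~~ (eventX C T m.-1 H && eventY C T m.-1 H) ||
      [&& in_pm (#|open_edges (H ord_max)|%:R / Qt n m%:R) 1 (gq n (tk m)),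
          in_pm (avg_open R (@Xcount n) (H ord_max) / Xt n m%:R) 1 (gq n (tk m))
        & in_pm (avg_open R (@Ycount n) (H ord_max) / Yt n m%:R) 1 (gq n (tk m))]).
Proof.
rewrite Prob_compl lerD2l lerN2 -bnd0.
apply: (@Prob_le_supermartingale _ _ m okXY (bnd m0)).
- by move=> k E _; apply: bnd_ge0.
- by move=> k E; apply: bnd_step.
move=> H /=; rewrite negb_or negbK => /andP[/andP[hX hY] bad].
rewrite (events_ok hX hY) /= leNgt; apply/negP => h.
move/negP: bad; apply; move: h; rewrite /bnd; case: ifP; first by rewrite ltxx.
move=> _; have mm : (m0 < m)%N by rewrite -(ltr_nat R); apply: le_lt_trans Tm.
rewrite leqNgt mm /= gt_min ltxx /= => h.
have hW := hf_lt1 (sqn_gt0 R n1) h.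
have [c1 c3 c4] := phase2_conclusion n1 (tk1 (ltnW mm)) tm L100 C1 HG hW.
have pm (x d : R) : `|x - 1| <= d -> in_pm x 1 d.
  by move=> /ler_normlP[? ?]; apply/andP; split; lra.
by apply/and3P; split; apply: pm; rewrite ?Qt_Gt ?Xt_Gt ?Yt_Gt.
Qed.

End FixedSize.

(** * Growth rates and the choice of parameters *)

Section Asymptotics.
Variable R : realType.
Implicit Types (c K M eps C : R).

Lemma expR_dominates_pow c K (j : nat) : 0 < c ->
  exists2 M : R, 1 <= M & forall x, M <= x -> K * x ^+ j <= expR (c * x).
Proof.
move=> c0; pose f : R := (j.+1)`!%:R / c ^+ j.+1.
have f0 : 0 < f by rewrite divr_gt0 ?exprn_gt0 // ltr0n fact_gt0.
exists (1 + `|K| * f); first by rewrite lerDl mulr_ge0 // ltW.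
move=> x xM; have x0 : 0 <= x by apply: le_trans xM; rewrite addr_ge0 // mulr_ge0 // ltW.
have h := @expR_ge1Dxn R (c * x) j (mulr_ge0 (ltW c0) x0).
have {}h : (c * x) ^+ j.+1 / (j.+1)`!%:R <= expR (c * x)
  by apply: le_trans h; rewrite lerDr.
apply: le_trans h.
have -> : (c * x) ^+ j.+1 / (j.+1)`!%:R = x / f * x ^+ j.
  rewrite /f exprMn exprS [x ^+ j.+1]exprS; field.
  by rewrite (lt0r_neq0 c0) expf_neq0 ?(lt0r_neq0 c0) // pnatr_eq0 -lt0n fact_gt0.
rewrite ler_wpM2r ?exprn_ge0 // ler_pdivlMr //.
by apply: le_trans (ler_wpM2r (ltW f0) (ler_norm K)) _; lra.
Qed.

Lemma near_ln_ge M : \forall n \near \oo, M <= ln (n%:R : R).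
Proof.
near=> n; have h : expR M <= n%:R by near: n; exact: nbhs_infty_ger.
by rewrite -[M]expRK ler_ln ?posrE ?expR_gt0 // (lt_le_trans (expR_gt0 M)).
Unshelve. all: by end_near. Qed.

(** Chosen so that [e^((C + 21) omega^2)] is at most the fourth root of [ln n]. The other fourth
    root contained in [sqrt (ln n)] beats [10 ^ 8] once [ln n >= 10 ^ 32]. *)
Definition omega0 C (n : nat) : R := Num.sqrt (ln (ln n%:R) / (4 * (C + 21))).

Lemma omega0_cvg C : 0 <= C -> omega0 C n @[n --> \oo] --> +oo.
Proof.
move=> C0; apply/cvgryPge => A; have d0 : 0 < 4 * (C + 21) by lra.
near=> n; have h : expR (A ^+ 2 * (4 * (C + 21))) <= ln (n%:R : R).
  by near: n; exact: near_ln_ge.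
rewrite (le_trans (ler_norm A)) // -sqrtr_sqr ler_wsqrtr // ler_pdivlMr //.
by rewrite -[leLHS]expRK ler_ln ?posrE ?expR_gt0 // (lt_le_trans (expR_gt0 _) h).
Unshelve. all: by end_near. Qed.

Lemma omega0_growth C (n : nat) w : 0 <= C -> 0 <= w -> w <= omega0 C n ->
  10 ^+ 32 <= ln (n%:R : R) ->
  10 ^+ 8 * expR ((C + 21) * w ^+ 2) <= Num.sqrt (ln n%:R).
Proof.
move=> C0 w0 ww; set L := ln n%:R => L32; have d0 : 0 < 4 * (C + 21) by lra.
have L0 : 0 < L by apply: lt_le_trans L32; rewrite exprn_gt0.
have lL0 : 0 <= ln L by rewrite ln_ge0 // (le_trans _ L32) // exprn_ege1 //; lra.
have w2 : w ^+ 2 * (4 * (C + 21)) <= ln L.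
  rewrite -ler_pdivlMr // -[leRHS]sqr_sqrtr; last by rewrite divr_ge0 // ltW.
  by rewrite lerXn2r ?nnegrE // sqrtr_ge0.
pose y := expR (ln L / 4).
have yL : y ^+ 2 = Num.sqrt L.
  apply/eqP; rewrite -(@eqrXn2 _ 2) ?sqrtr_ge0 ?exprn_ge0 ?expR_ge0 // sqr_sqrtr ?(ltW
    L0) //.
  by rewrite -exprM -expRM_natl (_ : _ * _ = ln L) ?lnK ?posrE //; field.
have y8 : 10 ^+ 8 <= y.
  rewrite -(@ler_pXn2r _ 4) ?nnegrE ?exprn_ge0 ?expR_ge0 // -exprM.
  by rewrite (_ : y ^+ 4 = L) // /y -expRM_natl (_ : _ * _ = ln L) ?lnK ?posrE //; field.
rewrite -yL expr2; apply: ler_pM; rewrite ?exprn_ge0 ?expR_ge0 //.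
by rewrite ler_expR; lra.
Qed.

(** [2 c^2 = 1/4 - sqrt 2 eps + 2 eps^2]; with [7/5 <= sqrt 2] and [eps < 1/5] this is at most
    [1/4 - eps]. The [1/4] cancels [n^(-1/4)] in [Gt], and a factor [n^(-eps)] remains. *)
Lemma tstar_bound eps (x : R) : 0 < eps < 1 / 5 -> 0 <= x ->
  let c := (2 * Num.sqrt 2)^-1 - eps in
  2 * (c * Num.sqrt x) ^+ 2 <= x / 4 - eps * x /\ (c * Num.sqrt x) ^+ 2 <= x /\ 0 < c.
Proof.
move=> /andP[e0 e1] x0 c; pose s : R := Num.sqrt 2.
have s2 : s ^+ 2 = 2 by rewrite sqr_sqrtr.
have s0 : 0 <= s by exact: sqrtr_ge0.
have s1 : 7 / 5 <= s.
  rewrite -(@ler_pXn2r _ 2) ?nnegrE // s2 expr2; lra.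
have s3 : s <= 3 / 2.
  rewrite -(@ler_pXn2r _ 2) ?nnegrE // s2 expr2; lra.
have sV : (2 * s)^-1 = s / 4.
  by apply: (mulfI (_ : 2 * s != 0)); rewrite ?mulfV ?lt0r_neq0 //; nra.
have cE : c = s / 4 - eps by rewrite /c sV.
have c2 : c ^+ 2 = 1 / 8 - s / 2 * eps + eps ^+ 2.
  by rewrite cE sqrrB exprMn s2; field.
have xx : (c * Num.sqrt x) ^+ 2 = c ^+ 2 * x by rewrite exprMn sqr_sqrtr.
have ee : eps ^+ 2 <= 1 / 5 * eps by rewrite expr2 ler_wpM2r // ltW.
have se : 7 / 5 * eps <= s * eps by rewrite ler_wpM2r // ltW.
rewrite xx; split; [|split].
- have -> : x / 4 - eps * x = (1 / 4 - eps) * x by ring.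
  by rewrite mulrA ler_wpM2r // c2; lra.
- by rewrite -[leRHS]mul1r ler_wpM2r // c2; lra.
- by rewrite cE; lra.
Qed.

End Asymptotics.

Theorem theorem6p1 (R : realType) :
  exists2 eps0 : R, 0 < eps0 &
  forall eps : R, 0 < eps < eps0 ->
  exists C0 : R, forall C : R, C0 <= C ->
  exists2 omega0 : nat -> R, omega0 n @[n --> \oo] --> +oo &
  forall omega : nat -> R, omega n @[n --> \oo] --> +oo ->
  (\forall n \near \oo, omega n <= omega0 n) ->
  \forall n \near \oo, forall m : nat,
    omega n * n32 R n < m%:R <= mstar n eps ->
    let t := time_of n m%:R in
    1 - n%:R `^ (- 2 * ln n%:R) <=
    Prob R (fun G : trajectory n m =>
      ~~ (eventX C (omega n) m.-1 G && eventY C (omega n) m.-1 G) ||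
      [&& in_pm (#|open_edges (G ord_max)|%:R / Qt n m%:R) 1 (gq n t),
          in_pm (avg_open R (@Xcount n) (G ord_max) / Xt n m%:R) 1 (gq n t)
        & in_pm (avg_open R (@Ycount n) (G ord_max) / Yt n m%:R) 1 (gq n t)]).
Proof.
exists (1 / 5); first by lra.
move=> eps epsB; exists 1 => C C1; have C0 : 0 <= C by lra.
exists (omega0 C); first exact: omega0_cvg.
move=> omega omega_cvg omega_le.
have omega_ge2 : \forall n \near \oo, 2 <= omega n by move/cvgryPge: omega_cvg; apply.
have eps0 : 0 < eps by case/andP: epsB.
have [M1 M1_1 HM1] := @expR_dominates_pow R eps (10 ^+ 10 * C ^+ 2) 13 eps0.
(* 7 is 2 for the exponent in [n^(-2 log n)] plus 5, since the prefactor 6 of [eta] is at most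
   [e^5]. *)
have [M2 M2_1 HM2] := @expR_dominates_pow R (1 / 4) 7 2 ltac:(lra).
have [M3 M3_1 HM3] := @expR_dominates_pow R (1 / 2) 1000 1 ltac:(lra).
near=> n => m /andP[Tm mM].
have n1 : (1 < n)%N by near: n; exact: nbhs_infty_gt.
have L32 : 10 ^+ 32 <= ln (n%:R : R) by near: n; exact: near_ln_ge.
have LM1 : M1 <= ln (n%:R : R) by near: n; exact: near_ln_ge.
have LM2 : M2 <= ln (n%:R : R) by near: n; exact: near_ln_ge.
have LM3 : M3 <= ln (n%:R : R) by near: n; exact: near_ln_ge.
have w2 : 2 <= omega n by near: n.
have ww : omega n <= omega0 C n by near: n.
set L := ln n%:R in L32 LM1 LM2 LM3 *.
have L100 : 100 <= L by apply: le_trans L32; rewrite (_ : 10 ^+ 32 = 10 ^+ 2 * 10 ^+ 30)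
  ?ler_peMr ?exprn_ege1 //; lra.
have La : 1000 * L <= sqn R n.
  by rewrite sqn_expR //; have := HM3 L LM3; rewrite expr1 (_ : 1 / 2 * L = L / 2) //; ring.
have HA := omega0_growth C0 (_ : 0 <= omega n) ww L32.
have {}HA := HA ltac:(lra).
have N0 : 0 < n32 R n by rewrite n32_sqn // exprn_gt0 // sqn_gt0.
have L0 : 0 <= L by lra.
have [tb1 [tb2 tb3]] := tstar_bound epsB L0.
set t := time_of n m%:R.
have t0 : 0 <= t by rewrite divr_ge0 // ltW.
have tt : t <= tstar n eps by rewrite ler_pdivrMr.
have t2 : t ^+ 2 <= (((2 * Num.sqrt 2)^-1 - eps) * Num.sqrt L) ^+ 2.
  by rewrite lerXn2r ?nnegrE //; exact: le_trans tt.
have HG : 10 ^+ 10 * C ^+ 2 * L ^+ 13 * Gt n t <= 1.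
  have Gle : Gt n t <= expR (- (eps * L)).
    by rewrite /Gt qin_expR // -expRD ler_expR -/L; lra.
  apply: (@le_trans _ _ (expR (eps * L) * expR (- (eps * L)))); last first.
    by rewrite -expRD subrr expR0.
  apply: ler_pM; rewrite ?(ltW (Gt_gt0 _ _)) ?HM1 //.
  by apply: mulr_ge0; rewrite ?mulr_ge0 ?exprn_ge0.
have etaL : eta R n <= n%:R `^ (- 2 * L).
  have -> : n%:R `^ (- 2 * L) = expR (- (2 * L ^+ 2)).
    by rewrite /powR gt_eqF ?ltr0n ?(ltn_trans _ n1) // -/L; congr expR; ring.
  have aq : sqn R n * qin R n = expR (1 / 4 * L).
    by rewrite sqn_expR // qin_expR // -expRD -/L; congr expR; field.
  have h := HM2 L LM2.
  have L2 : 1 <= L ^+ 2 by rewrite exprn_ege1 //; lra.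
  have h6 : 6 <= expR 5 :> R by have := expR_ge1Dx (5 : R); lra.
  rewrite /eta aq; apply: (@le_trans _ _ (expR 5 * expR (- expR (1 / 4 * L)))).
    by rewrite ler_wpM2r // expR_ge0.
  by rewrite -expRD ler_expR; lra.
have eta1 : eta R n <= 1.
  apply: (le_trans etaL); rewrite /powR gt_eqF ?ltr0n ?(ltn_trans _ n1) //.
  rewrite -[X in _ <= X]expR0 ler_expR -/L; have := mulr_ge0 L0 L0; lra.
have wN : 0 <= omega n * n32 R n by rewrite mulr_ge0 ?(ltW N0) //; lra.
(* The initial phase ends at the integer part of [omega n * n^(3/2)]. *)
have /andP[m0T Tm0] := truncn_itv wN.
apply: le_trans (Prob_fixed_size n1 L100 La C1 w2 HA eta1 m0T Tm0 Tm (le_trans t2 tb2) HG).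
by rewrite lerD2l lerN2.
Unshelve. all: by end_near. Qed.
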